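(* Let $Q$ be a quiver with vertex set $I=\{1,\dots,n\}$ without loops and oriented $2$-cycles, $W$ a finite potential on $Q$, and $\mathbf{k}=(k_1,\dots,k_l)\in I^l$ such that $(Q^{\mathrm{pf}},W)$ is successively f-mutatable with respect to $\mathbf{k}$. Then for every $i\in I$ the polynomial $F_{\mathbf{k},i}(\underline y)$ has a unique monomial of maximal degree. Furthermore, this monomial has coefficient $1$, and it is divisible by all the other monomials occurring in $F_{\mathbf{k},i}(\underline y)$.
   Context: $Q(i,j)$ is the number of arrows $i\to j$ in $Q$. The quiver with principal framing $Q^{\mathrm{pf}}$ has vertices $I\sqcup I^*$, $I^*=\{1^*,\dots,n^*\}$, and arrows those of $Q$ together with one arrow $i^*\to i$ for each $i\in I$. Quiver mutation. $\mu_k^{\mathrm{pre}}Q$ is obtained from $Q$ by adding an arrow $[\beta\alpha]:u\to v$ for each pair $u\xrightarrow{\alpha}k\xrightarrow{\beta}v$ and replacing each arrow $a$ incident to $k$ by an opposite arrow $a^*$; $\mu_kQ$ is obtained by then removing a maximal collection of disjoint oriented $2$-cycles. Seeds. The mutation at $k$ of a seed $(Q\mid\underline u)$ is $(\mu_kQ\mid\underline u^{\mathrm{new}})$, where $u_k$ is replaced by $u_k^{-1}(\prod_iu_i^{Q(i,k)}+\prod_iu_i^{Q(k,i)})$ and other variables are unchanged. $\mathrm{FZ}^{\mathrm{pf}}_{\mathbf{k},i}(\underline X)$ is the variable at vertex $i$ of the seed $\mu_{k_l}\cdots\mu_{k_1}(Q^{\mathrm{pf}}\mid\underline X)$, with initial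 variables $X_j,X_{j^*}$ ($j\in I$). The $F$-polynomial is $F_{\mathbf{k},i}(\underline y):=\mathrm{FZ}^{\mathrm{pf}}_{\mathbf{k},i}(\underline X)|_{X_j=1,\,X_{j^*}=y_j}$. QP mutation. A finite potential $W$ is a finite linear combination of oriented cycles (up to rotation); a potential on $Q$ is also one on $Q^{\mathrm{pf}}$. The Jacobi algebra is $\mathbb{C}Q/\langle\partial_aW\rangle$ with $\partial_a(a_1\cdots a_m)=\sum_i\delta_{a,a_i}a_{i+1}\cdots a_ma_1\cdots a_{i-1}$. $\mu_k^{\mathrm{pre}}W:=[W]+\Delta$, where $[W]$ replaces each composition of $\alpha,\beta$ through $k$ by $[\beta\alpha]$ and $\Delta$ is the sum of the $3$-cycles formed by $[\beta\alpha],\beta^*,\alpha^*$. Two finite QPs are right f-equivalent if there is an algebra isomorphism of their (uncompleted) path algebras, fixing vertices, taking one potential to the other. A potential is reduced if it has no cycles of length $<3$; a QP is trivial if its Jacobi algebra is spanned by the vertex idempotents. A finite QP is f-reducible if right f-equivalent to a direct sum (union of arrow sets, sum of potentials) of a finite reduced QP and a finite trivial QP; $\mu_k(Q,W)$ is the reduced part of $(\mu_k^{\mathrm{pre}}Q,\mu_k^{\mathrm{pre}}W)$. $(Q,W)$ is f-mutatable at $k$ if $(\mu_k^{\mathrm{pre}}Q,\mu_k^{\mathrm{pre}}W)$ is f-reducible and the quiver of $\mu_k(Q,W)$ is $\mu_kQ$; it is successively f-mutatable with respect to $\mathbf{k}$ if $\mu_{k_{s-1}}\cdots\mu_{k_1}(Q,W)$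 is f-mutatable at $k_s$ for all $s\le l$. *)

(* Defs.v *)
From HB Require Import structures.
From mathcomp Require Import all_boot all_order all_algebra.
From mathcomp Require Import complex reals.
From mathcomp Require finmap monalg mpoly.

Set Implicit Arguments.
Unset Strict Implicit.
Unset Printing Implicit Defensive.

Import GRing.Theory.
Local Open Scope ring_scope.

Record quiver (V : finType) := Quiver {
  arrow : finType;
  src : arrow -> V;
  tgt : arrow -> V
}.
Arguments src {V q} _.
Arguments tgt {V q} _.

Definition num_arrows (V : finType) (Q : quiver V) (i j : V) : nat :=
  #|[set a : arrow Q | (src a == i) && (tgt a == j)]|.

Definition loop_free (V : finType) (Q : quiver V) : Prop :=
  forall a : arrow Q, src a <> tgt a.

Definition two_cycle_free (V : finType) (Q : quiver V) : Prop :=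
  forall a b : arrow Q, ~ (src a = tgt b /\ src b = tgt a).

(* Isomorphism of quivers that is the identity on the vertex set. *)
Definition quiver_iso (V : finType) (Q Q' : quiver V) : Prop :=
  exists f : arrow Q -> arrow Q',
    [/\ bijective f, forall a, src (f a) = src a & forall a, tgt (f a) = tgt a].

(* The vertex [inl i] is i and the vertex [inr i] is i^*; the arrow [inr i] is
   the framing arrow i^* -> i. *)
Definition framed_quiver (I : finType) (Q : quiver I) : quiver (I + I)%type :=
  @Quiver (I + I)%type (arrow Q + I)%type
    (fun a => match a with inl b => inl (src b) | inr i => inr i end)
    (fun a => match a with inl b => inl (tgt b) | inr i => inl i end).

Section QuiverMutation.
Variables (V : finType) (k : V) (Q : quiver V).

Definition through (c : arrow Q * arrow Q) : bool :=
  (tgt c.1 == k) && (src c.2 == k).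

(* [inl a] is the arrow a if a is not incident to k, and a^* otherwise;
   [inr (alpha, beta)] is the composite arrow [beta alpha]. *)
Definition premutation_arrow : finType :=
  (arrow Q + {c : arrow Q * arrow Q | through c})%type.

Definition incident (a : arrow Q) : bool := (src a == k) || (tgt a == k).

Definition premutation : quiver V :=
  @Quiver V premutation_arrow
    (fun x => match x with
              | inl a => if incident a then tgt a else src a
              | inr c => src (val c).1
              end)
    (fun x => match x with
              | inl a => if incident a then src a else tgt a
              | inr c => tgt (val c).2
              end).
End QuiverMutation.

Section TwoCycleReduction.
Variables (V : finType) (Q : quiver V).

Definition disjoint_two_cycles (C : {set arrow Q * arrow Q}) : bool :=
  [forall c in C,
     [&& c.1 != c.2, src c.1 == tgt c.2 & src c.2 == tgt c.1]] &&
  [forall c in C, forall d in C,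
     (c != d) ==> [disjoint [set c.1; c.2] & [set d.1; d.2]]].

Lemma disjoint_two_cycles0 : disjoint_two_cycles set0.
Proof. by apply/andP; split; apply/forallP => c; rewrite inE. Qed.

(* The choice of the maximal collection is immaterial: different choices give
   isomorphic quivers. *)
Definition max_two_cycles : {set arrow Q * arrow Q} :=
  s2val (maxset_exists disjoint_two_cycles0).

Definition surviving (a : arrow Q) : bool :=
  [forall c in max_two_cycles, (a != c.1) && (a != c.2)].

Definition cancel_two_cycles : quiver V :=
  @Quiver V {a : arrow Q | surviving a}
    (fun a => src (val a)) (fun a => tgt (val a)).
End TwoCycleReduction.

Definition mutation (V : finType) (k : V) (Q : quiver V) : quiver V :=
  cancel_two_cycles (premutation k Q).

Record seed (V : finType) (F : fieldType) := Seed {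
  seed_quiver : quiver V;
  seed_var : V -> F
}.

Definition seed_mutation (V : finType) (F : fieldType) (k : V)
    (s : seed V F) : seed V F :=
  let: Seed Q u := s in
  Seed (mutation k Q)
    (fun j => if j == k
              then (u k)^-1 * (\prod_i u i ^+ num_arrows Q i k
                               + \prod_i u i ^+ num_arrows Q k i)
              else u j).

Definition seed_mutations (V : finType) (F : fieldType) (ks : seq V)
    (s : seed V F) : seed V F :=
  foldl (fun s k => seed_mutation k s) s ks.

Section FPolynomial.
Import mpoly.
Variables (n : nat) (Q : quiver 'I_n).

(* The variables X_j are the first n and the variables X_{j^*} the last n
   indeterminates. *)
Definition initial_var (v : 'I_n + 'I_n) : {fraction {mpoly rat[n + n]}} :=
  tofrac 'X_(unsplit v).

Definition FZ_pf (ks : seq 'I_n) (i : 'I_n) : {fraction {mpoly rat[n + n]}} :=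
  seed_var (seed_mutations [seq inl k | k <- ks]
              (Seed (framed_quiver Q) initial_var)) (inl i).

Definition specialize (p : {mpoly rat[n + n]}) : {mpoly rat[n]} :=
  p \mPo [tuple match split v with inl _ => 1 | inr j => 'X_j end
         | v < n + n].

(* F is the specialization of FZ_pf at X_j = 1, X_{j^*} = y_j. A rational
   function f specializes to F when, for some way of writing it as
   a fraction f = p / q whose denominator does not specialize to 0, the
   quotient of the specializations is F; F does not depend on p and q. *)
Definition is_F_polynomial (ks : seq 'I_n) (i : 'I_n) (F : {mpoly rat[n]}) :
    Prop :=
  exists p q : {mpoly rat[n + n]},
    [/\ FZ_pf ks i = tofrac p / tofrac q, specialize q != 0
      & specialize p = F * specialize q].
End FPolynomial.

Section Paths.
Variables (V : finType) (Q : quiver V).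

(* Paths compose from right to left: a word a_1 ... a_m is a path when
   src a_i = tgt a_{i+1}. A path is stored with its target, so that the empty
   word at v is the vertex idempotent e_v. *)
Fixpoint is_path (v : V) (w : seq (arrow Q)) : bool :=
  if w is a :: w' then (tgt a == v) && is_path (src a) w' else true.

Record qpath := QPath {
  qpath_val :> V * seq (arrow Q);
  _ : is_path qpath_val.1 qpath_val.2
}.
HB.instance Definition _ := [isSub for qpath_val].
HB.instance Definition _ := [Choice of qpath by <:].

Definition ptgt (p : qpath) : V := p.1.
Definition pword (p : qpath) : seq (arrow Q) := p.2.
Definition psrc (p : qpath) : V := last (ptgt p) [seq src a | a <- pword p].
Definition plength (p : qpath) : nat := size (pword p).
Definition is_cycle (p : qpath) : bool := (0 < plength p)%N && (psrc p == ptgt p).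

Lemma is_path_cat v w w' :
  is_path v (w ++ w') = is_path v w && is_path (last v [seq src a | a <- w]) w'.
Proof. by elim: w v => //= a w IHw v; rewrite IHw andbA. Qed.
End Paths.
Arguments ptgt {V Q} _.
Arguments pword {V Q} _.
Arguments psrc {V Q} _.
Arguments plength {V Q} _.
Arguments is_cycle {V Q} _.

Section PathAlgebra.
Import finmap monalg.
Variables (K : fieldType) (V : finType).

Definition path_algebra (Q : quiver V) : Type := {malg K[qpath Q]}.

Section Structure.
Variable Q : quiver V.
Local Notation KQ := (path_algebra Q).

HB.instance Definition _ := GRing.Lmodule.copy KQ {malg K[qpath Q]}.

Definition psupp (x : KQ) : seq (qpath Q) := enum_fset (msupp (x : {malg K[qpath Q]})).
Definition pcoeff (x : KQ) (p : qpath Q) : K := mcoeff p (x : {malg K[qpath Q]}).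
Definition pbasis (p : qpath Q) : KQ := (<< p >> : {malg K[qpath Q]}).

(* The element e_v a_1 ... a_m of the path algebra, which is 0 when the word
   a_1 ... a_m is not a path with target v. *)
Definition word (v : V) (w : seq (arrow Q)) : KQ :=
  if insub (v, w) is Some p then pbasis p else 0.

Definition idem (v : V) : KQ := word v [::].

Definition lin_ext (M : lmodType K) (h : qpath Q -> M) (x : KQ) : M :=
  \sum_(p <- psupp x) pcoeff x p *: h p.

Definition path_mul (p q : qpath Q) : KQ :=
  if psrc p == ptgt q then word (ptgt p) (pword p ++ pword q) else 0.

Definition pa_mul (x y : KQ) : KQ :=
  lin_ext (fun p => lin_ext (path_mul p) y) x.

Definition pa_one : KQ := \sum_v idem v.

Lemma lin_extEw (M : lmodType K) (h : qpath Q -> M) (x : KQ) (d : {fset qpath Q}) :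
  fsubset (msupp (x : {malg K[qpath Q]})) d ->
  lin_ext h x = \sum_(p <- d) pcoeff x p *: h p.
Proof.
move=> le; rewrite /lin_ext (big_fset_incl _ le) //= => p _ /mcoeff_outdom.
by rewrite /pcoeff => ->; rewrite scale0r.
Qed.

Lemma lin_ext_is_linear (M : lmodType K) (h : qpath Q -> M) :
  linear (lin_ext h).
Proof.
move=> a x y.
pose d := fsetU (msupp (x : {malg K[qpath Q]})) (msupp (y : {malg K[qpath Q]})).
rewrite (@lin_extEw _ h x d) ?fsubsetUl // (@lin_extEw _ h y d) ?fsubsetUr //.
rewrite (@lin_extEw _ h _ d).
  rewrite scaler_sumr -big_split /=; apply: eq_bigr => p _.
  rewrite /pcoeff.
  have -> : mcoeff p (a *: x + y : {malg K[qpath Q]}) =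
    a * mcoeff p (x : {malg K[qpath Q]}) + mcoeff p (y : {malg K[qpath Q]}).
    by rewrite mcoeffD mcoeffZ.
  by rewrite scalerDl scalerA.
apply: fsubset_trans (msuppD_le _ _) _.
apply: fsetUSS => //; exact: msuppZ_le.
Qed.

HB.instance Definition _ (M : lmodType K) (h : qpath Q -> M) :=
  GRing.isLinear.Build K KQ M *:%R (lin_ext h) (lin_ext_is_linear h).

Lemma lin_ext_basis (M : lmodType K) (h : qpath Q -> M) p :
  lin_ext h (pbasis p) = h p.
Proof.
rewrite (@lin_extEw _ _ _ [fset p]%fset) ?msuppU_le // big_seq_fset1.
by rewrite /pcoeff /pbasis mcoeffUU scale1r.
Qed.

Lemma pa_decomp (x : KQ) : x = lin_ext pbasis x.
Proof.
rewrite [LHS](monalgE (x : {malg K[qpath Q]})) /lin_ext; apply: eq_bigr => p _.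
apply/malgP => q; rewrite mcoeffU [RHS]mcoeffZ mcoeffU /pcoeff.
by rewrite mulr_natr.
Qed.

Lemma eq_lin_ext (M : lmodType K) (f g : {linear KQ -> M}) :
  (forall p, f (pbasis p) = g (pbasis p)) -> f =1 g.
Proof.
move=> fg x; rewrite [x]pa_decomp /lin_ext !linear_sum.
by apply: eq_bigr => p _; rewrite !linearZ fg.
Qed.

Lemma word_path (p : qpath Q) : word (ptgt p) (pword p) = pbasis p.
Proof.
rewrite /word /ptgt /pword; case: insubP => [q _ qE|].
  by congr pbasis; apply: val_inj; rewrite qE -surjective_pairing.
by rewrite -surjective_pairing => /negP; case; case: p.
Qed.

Lemma word0 (v : V) (w : seq (arrow Q)) : ~~ is_path v w -> word v w = 0.
Proof. by move=> wF; rewrite /word insubF //=; apply: negbTE. Qed.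

Lemma pa_mulE (p q : qpath Q) : pa_mul (pbasis p) (pbasis q) = path_mul p q.
Proof. by rewrite /pa_mul lin_ext_basis lin_ext_basis. Qed.

Definition pa_mulr (y x : KQ) : KQ := pa_mul x y.

Fact pa_mul_linearl (y : KQ) : linear (pa_mulr y).
Proof. by move=> a x x'; rewrite /pa_mulr /pa_mul linearP. Qed.

Fact pa_mul_linearr (x : KQ) : linear (pa_mul x).
Proof.
move=> a y y'; rewrite /pa_mul /lin_ext.
rewrite scaler_sumr -big_split; apply: eq_bigr => p _ /=.
by rewrite -/(lin_ext _ _) linearP scalerDr !scalerA mulrC.
Qed.

HB.instance Definition _ (y : KQ) :=
  GRing.isLinear.Build K KQ KQ *:%R (pa_mulr y) (pa_mul_linearl y).
HB.instance Definition _ (x : KQ) :=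
  GRing.isLinear.Build K KQ KQ *:%R (pa_mul x) (pa_mul_linearr x).

Fact pa_mul0x (y : KQ) : pa_mul 0 y = 0.
Proof. exact: (linear0 (pa_mulr y)). Qed.

Fact pa_mulDl : left_distributive pa_mul +%R.
Proof. by move=> x y z; apply: (linearD (pa_mulr z)). Qed.

Lemma path_mul_word (p : qpath Q) v w :
  pa_mul (pbasis p) (word v w) =
    if psrc p == v then word (ptgt p) (pword p ++ w) else 0.
Proof.
have [wP|wF] := boolP (is_path v w); last first.
  rewrite (word0 wF) linear0; case: eqP => // eqv.
  by rewrite word0 // is_path_cat -/(psrc p) eqv (negbTE wF) andbF.
have -> := word_path (QPath (qpath_val := (v, w)) wP).
by rewrite pa_mulE.
Qed.

Lemma word_mul_path v w (q : qpath Q) :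
  pa_mul (word v w) (pbasis q) =
    if last v [seq src a | a <- w] == ptgt q then word v (w ++ pword q) else 0.
Proof.
have [wP|wF] := boolP (is_path v w); last first.
  rewrite (word0 wF) pa_mul0x.
  by rewrite word0 ?if_same // is_path_cat (negbTE wF).
have -> := word_path (QPath (qpath_val := (v, w)) wP).
by rewrite pa_mulE.
Qed.

Fact pa_mulA : associative pa_mul.
Proof.
move=> x y z.
pose f1 : {linear KQ -> KQ} := pa_mulr (pa_mul y z).
pose f2 : {linear KQ -> KQ} := pa_mulr z \o pa_mulr y.
apply: (@eq_lin_ext _ f1 f2) => p {x}; rewrite /f1 /f2 /= {f1 f2}.
pose f1 : {linear KQ -> KQ} := pa_mul (pbasis p) \o pa_mulr z.
pose f2 : {linear KQ -> KQ} := pa_mulr z \o pa_mul (pbasis p).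
apply: (@eq_lin_ext _ f1 f2) => q {y}; rewrite /f1 /f2 /= {f1 f2}.
pose f1 : {linear KQ -> KQ} := pa_mul (pbasis p) \o pa_mul (pbasis q).
pose f2 : {linear KQ -> KQ} := pa_mul (pa_mul (pbasis p) (pbasis q)).
apply: (@eq_lin_ext _ f1 f2) => r {z}; rewrite /f1 /f2 /= {f1 f2}.
rewrite !pa_mulE /path_mul.
have [qr|qr] := eqVneq (psrc q) (ptgt r); last first.
  rewrite linear0; have [pq|] := eqVneq (psrc p) (ptgt q).
    rewrite word_mul_path map_cat last_cat -/(psrc p) pq -/(psrc q).
    by rewrite (negbTE qr).
  by rewrite pa_mul0x.
rewrite path_mul_word; case: eqVneq => [pq|].
  by rewrite word_mul_path map_cat last_cat -/(psrc p) pq -/(psrc q) qr eqxx catA.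
by rewrite pa_mul0x.
Qed.

Fact pa_mul1x : left_id pa_one pa_mul.
Proof.
move=> x; pose f1 : {linear KQ -> KQ} := pa_mul pa_one.
apply: (@eq_lin_ext _ f1 idfun) => p {x}; rewrite /f1 /pa_one /=.
rewrite -[LHS]/(pa_mulr (pbasis p) _) linear_sum (bigD1 (ptgt p)) //= big1 ?addr0.
  by rewrite /pa_mulr word_mul_path eqxx word_path.
by move=> v /negbTE vp; rewrite /pa_mulr word_mul_path /= vp.
Qed.

Fact pa_mulx1 : right_id pa_one pa_mul.
Proof.
move=> x; pose f1 : {linear KQ -> KQ} := pa_mulr pa_one.
apply: (@eq_lin_ext _ f1 idfun) => p {x}; rewrite /f1 /pa_one /=.
rewrite /pa_mulr linear_sum (bigD1 (psrc p)) //= big1 ?addr0.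
  by rewrite path_mul_word eqxx cats0 word_path.
by move=> v vp; rewrite path_mul_word eq_sym (negbTE vp).
Qed.

Fact pa_mulDr : right_distributive pa_mul +%R.
Proof. by move=> x y z; rewrite linearD. Qed.

HB.instance Definition _ := GRing.Zmodule_isPzRing.Build KQ
  pa_mulA pa_mul1x pa_mulx1 pa_mulDl pa_mulDr.
End Structure.
End PathAlgebra.
Arguments word {K V} Q v w.
Arguments idem {K V} Q v.
Arguments pbasis {K V Q} p.
Arguments psupp {K V Q} x.

Section Potentials.
Variables (K : fieldType) (V : finType) (Q : quiver V).
Local Notation KQ := (path_algebra K Q).

(* A finite potential is represented by a linear combination of based oriented
   cycles; two representatives are identified when they are [rotation_equiv]. *)
Definition is_potential (W : KQ) : Prop :=
  forall p, p \in psupp W -> is_cycle p.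

Definition rotate (p : qpath Q) : KQ :=
  if pword p is a :: w then word Q (src a) (rcons w a) else pbasis p.

Definition rotation_equiv (W W' : KQ) : Prop :=
  exists2 s : seq (K * qpath Q),
    forall t, t \in s -> is_cycle t.2 &
    W - W' = \sum_(t <- s) t.1 *: (pbasis t.2 - rotate t.2).

Definition path_derivative (a : arrow Q) (p : qpath Q) : KQ :=
  \sum_(i < plength p | nth a (pword p) i == a)
     word Q (src a) (drop i.+1 (pword p) ++ take i (pword p)).

Definition cyclic_derivative (a : arrow Q) (W : KQ) : KQ :=
  lin_ext (path_derivative a) W.

Definition in_jacobian_ideal (W x : KQ) : Prop :=
  exists s : seq (KQ * arrow Q * KQ),
    x = \sum_(t <- s) t.1.1 * cyclic_derivative t.1.2 W * t.2.

(* The Jacobi algebra is the quotient of the path algebra by the ideal above,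
   so this says that it is spanned by the classes of the e_v. *)
Definition jacobi_spanned_by_idempotents (W : KQ) : Prop :=
  forall x : KQ, exists c : V -> K,
    in_jacobian_ideal W (x - \sum_v c v *: idem Q v).
End Potentials.

(* The linear map between path algebras sending each path e_v a_1 ... a_m to
   e_(fV v) (fA a_1) ... (fA a_m). *)
Definition pushforward (K : fieldType) (V V' : finType)
    (Q : quiver V) (Q' : quiver V') (fV : V -> V') (fA : arrow Q -> arrow Q')
    (x : path_algebra K Q) : path_algebra K Q' :=
  lin_ext (fun p => word Q' (fV (ptgt p)) [seq fA a | a <- pword p]) x.

Record qp (K : fieldType) (V : finType) := QP {
  qp_quiver : quiver V;
  qp_potential : path_algebra K qp_quiver
}.
Arguments QP {K V} qp_quiver qp_potential.

Definition framed_qp (K : fieldType) (I : finType) (Q : quiver I)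
    (W : path_algebra K Q) : qp K (I + I)%type :=
  QP (framed_quiver Q) (pushforward (Q' := framed_quiver Q) inl inl W).

Section QPs.
Variables (K : fieldType) (V : finType).
Implicit Types P : qp K V.

Definition right_f_equiv P P' : Prop :=
  exists phi : {linear path_algebra K (qp_quiver P) ->
                       path_algebra K (qp_quiver P')},
    [/\ bijective phi, monoid_morphism phi,
       forall v, phi (idem _ v) = idem _ v &
       rotation_equiv (phi (qp_potential P)) (qp_potential P')].

Definition quiver_sum (Q Q' : quiver V) : quiver V :=
  @Quiver V (arrow Q + arrow Q')%type
    (fun x => match x with inl a => src a | inr a => src a end)
    (fun x => match x with inl a => tgt a | inr a => tgt a end).

Definition qp_sum P P' : qp K V :=
  let Q := quiver_sum (qp_quiver P) (qp_quiver P') in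
  QP Q (pushforward (Q' := Q) id inl (qp_potential P)
        + pushforward (Q' := Q) id inr (qp_potential P')).

Definition reduced_qp P : Prop :=
  is_potential (qp_potential P) /\
  forall p, p \in psupp (qp_potential P) -> (3 <= plength p)%N.

Definition trivial_qp P : Prop :=
  is_potential (qp_potential P) /\
  jacobi_spanned_by_idempotents (qp_potential P).

(* P is f-reducible when it has such a reduced part. *)
Definition is_reduced_part P Pred : Prop :=
  reduced_qp Pred /\
  exists2 Ptriv, trivial_qp Ptriv & right_f_equiv P (qp_sum Pred Ptriv).

Section Premutation.
Variables (k : V) (Q : quiver V).
Local Notation Q' := (premutation k Q).

(* Replaces each pair of consecutive letters beta alpha through k by the
   letter [beta alpha]. *)
Fixpoint bracket_word (w : seq (arrow Q)) : seq (arrow Q') :=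
  match w with
  | b :: ((a :: w2) as w1) =>
      if insub (a, b) is Some c then inr c :: bracket_word w2
      else inl b :: bracket_word w1
  | [:: b] => [:: inl b]
  | [::] => [::]
  end.

(* A cycle based at k is first rotated, so that each of its passages through k
   is the passage between two consecutive letters. *)
Definition bracket_cycle (p : qpath Q) : path_algebra K Q' :=
  if pword p is a :: w then
    if tgt a == k then word Q' (src a) (bracket_word (rcons w a))
    else word Q' (tgt a) (bracket_word (a :: w))
  else 0.

Definition bracket (W : path_algebra K Q) : path_algebra K Q' :=
  lin_ext bracket_cycle W.

Definition triangles : path_algebra K Q' :=
  \sum_(c : {c : arrow Q * arrow Q | through k c})
     word Q' (tgt (val c).2) [:: inr c; inl (val c).1; inl (val c).2].
End Premutation.

Definition qp_premutation (k : V) P : qp K V :=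
  let: QP Q W := P in QP (premutation k Q) (bracket k W + triangles k Q).

(* P is f-mutatable at k when there is such a P', which is then the mutation of
   P at k. *)
Definition f_mutation (k : V) P P' : Prop :=
  is_reduced_part (qp_premutation k P) P' /\
  quiver_iso (qp_quiver P') (mutation k (qp_quiver P)).

Fixpoint successively_f_mutatable (ks : seq V) P : Prop :=
  if ks is k :: ks' then
    exists2 P', f_mutation k P P' & successively_f_mutatable ks' P'
  else True.
End QPs.

(* Main.v *)
(* The exchange relations turn the statement into a property of integer vectors.
   The F-polynomials satisfy F_k' F_k = y^[c]+ prod F_i^[b_ik]+ + y^[-c]+ prod F_i^[-b_ik]+,
   where c is obtained from the unit vectors by tropical mutation, and they are
   polynomials by the Laurent phenomenon. If the mutated entry of every such vector
   has the same sign at each step (sign-coherence), then all F_i keep constant term 1;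
   if this also holds starting from the negated unit vectors, then all F_i keep a
   monomial with coefficient 1 that is divisible by the other ones.

   Sign-coherence is proved with the quiver with potential. The vector is the index
   of a two-term complex Y -> X of projectives, given by a matrix of elements of the
   path algebra, which is rigid: every matrix of the same shape is null-homotopic
   modulo the Jacobian ideal. Initially X or Y is zero. Invertible entries can be
   cancelled, and then X and Y have no common summand, since the elementary matrix of
   a common summand would not be null-homotopic; this is sign-coherence at k. If
   Y has no summand at k, premutation replaces each summand X_k by the arrows leaving
   k, with X_k moved to Y, and dually; explicit homotopies show that the new complex is
   rigid. Right equivalences and the removal of the trivial part are surjective
   algebra maps that respect the Jacobian ideals, hence preserve rigidity.
   All this is done modulo paths of length at least N, where N is divided by 3 at each
   mutation. *)

From HB Require Import structures.
From Stdlib Require Import FunctionalExtensionality Classical.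
Require Import Defs.
From mathcomp Require Import all_boot all_order all_algebra.
From mathcomp Require Import complex reals.
From mathcomp Require Import mpoly.
From mathcomp Require Import zify ring.

Set Implicit Arguments.
Unset Strict Implicit.
Unset Printing Implicit Defensive.

Import Order.TTheory GRing.Theory Num.Theory.
Local Open Scope ring_scope.

(** * Exchange matrices *)

(** One complex serves all framing indices at once. Its summands carry labels, the differential
    respects them, but rigidity is demanded of the direct sum over all labels; this is what gives
    the indices of different labels a common sign at k. Sign-coherence also keeps the mutable
    columns of these vectors linearly independent, so the mutated column is never zero. Hence
    exactly one of the two exchange terms keeps constant term 1, and the two leading exponents
    differ, so the leading coefficient cannot become 2. The exchange relation only gives the new F
    as a quotient. By the Laurent phenomenon its denominator is a monomial in y, and that monomial
    cancels because the divisor has constant term 1. In the uncompleted path algebra an idempotent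
    plus longer paths need not be invertible; this is the obstacle that forces the truncation. The
    bracket at k at most halves lengths and stripping an arrow costs one more, so a bound N passes
    to any N' with 2N' < N, and 3^l suffices for l mutations. Arrows into k are treated by the
    argument for arrows out of k, read over the opposite ring. *)

Section ExchangeMatrix.
Variable V : finType.
Implicit Types (Q : quiver V) (i j k : V).

Definition exchange_matrix Q i j : int :=
  (num_arrows Q i j)%:Z - (num_arrows Q j i)%:Z.

Definition pos_part (x : int) : nat := `|Num.max x 0|%N.

Definition matrix_mutation (k : V) (B : V -> V -> int) (i j : V) : int :=
  if (i == k) || (j == k) then - B i j
  else B i j + (pos_part (B i k) * pos_part (B k j))%:Z
             - (pos_part (- B i k) * pos_part (- B k j))%:Z.

Lemma num_arrowsE Q i j :
  num_arrows Q i j = (\sum_(a : arrow Q) ((src a == i) && (tgt a == j)))%N.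
Proof. by rewrite /num_arrows -sum1dep_card big_mkcond. Qed.

Lemma num_arrows_loop Q i : loop_free Q -> num_arrows Q i i = 0%N.
Proof.
move=> lf; rewrite num_arrowsE big1 // => a _.
by case: eqP => //= si; case: eqP => // ti; case: (lf a); rewrite si ti.
Qed.

Lemma exchange_matrixN Q i j : exchange_matrix Q j i = - exchange_matrix Q i j.
Proof. by rewrite /exchange_matrix opprB. Qed.

Lemma num_arrows_pos_part Q i j :
  two_cycle_free Q -> num_arrows Q i j = pos_part (exchange_matrix Q i j).
Proof.
move=> tf; rewrite /pos_part /exchange_matrix.
have : num_arrows Q i j = 0%N \/ num_arrows Q j i = 0%N.
  case: (posnP (num_arrows Q i j)) => [->|]; first by left.
  case: (posnP (num_arrows Q j i)) => [->|]; first by right.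
  rewrite /num_arrows => /card_gt0P[a]; rewrite inE => /andP[/eqP sa /eqP ta].
  move=> /card_gt0P[b]; rewrite inE => /andP[/eqP sb /eqP tb].
  by case: (tf a b); rewrite sa ta sb tb.
by case=> ->; lia.
Qed.

(** A composite with an end at k would involve a loop at k, so at k only the reversed arrows
    count. *)
Lemma num_arrows_premutation Q k i j : loop_free Q ->
  num_arrows (premutation k Q) i j =
  (if (i == k) || (j == k) then num_arrows Q j i
   else num_arrows Q i j + num_arrows Q i k * num_arrows Q k j)%N.
Proof.
move=> lf; rewrite num_arrowsE big_sumType /=.
have inrE : (\sum_(c : {c : arrow Q * arrow Q | through k c})
    ((src (val c).1 == i) && (tgt (val c).2 == j)) =
    num_arrows Q i k * num_arrows Q k j)%N.
  rewrite !num_arrowsE big_distrl /=.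
  under [RHS]eq_bigr do rewrite big_distrr /=.
  rewrite pair_big /=.
  rewrite -(big_sub_cond (I := (arrow Q * arrow Q)%type) (through (Q:=Q) k)
     xpredT (fun c => nat_of_bool ((src c.1 == i) && (tgt c.2 == j)))) /=.
  rewrite [LHS]big_mkcond; apply: eq_bigr => c _ /=.
  rewrite unfold_in /through andbT.
  by do 4 case: (_ == _).
rewrite inrE !num_arrowsE.
case: ifP => [/orP ikj|ikj].
  rewrite -[RHS]addn0; congr addn; last first.
    apply/eqP; rewrite -!num_arrowsE muln_eq0.
    by case: ikj => /eqP ->; rewrite num_arrows_loop ?eqxx ?orbT.
  apply: eq_bigr => a _; rewrite /incident; congr nat_of_bool.
  have lfa := lf a.
  case: (eqVneq (src a) k) => sk; case: (eqVneq (tgt a) k) => tk /=.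
  - by case: lfa; rewrite sk tk.
  - by rewrite andbC.
  - by rewrite andbC.
  - by case: ikj => /eqP ->; rewrite (negbTE sk) (negbTE tk) ?andbF.
move/negbT: ikj; rewrite negb_or => /andP[ik jk].
congr addn; apply: eq_bigr => a _; rewrite /incident; congr nat_of_bool.
case: (eqVneq (src a) k) => sk /=.
  by rewrite sk ![k == _]eq_sym (negbTE jk) (negbTE ik) andbF.
case: (eqVneq (tgt a) k) => tk //=.
by rewrite tk ![k == _]eq_sym (negbTE ik) (negbTE jk) andbF.
Qed.

(** A composite that is a loop comes from an oriented 2-cycle through k. *)
Lemma premutation_loop_free Q k :
  loop_free Q -> two_cycle_free Q -> loop_free (premutation k Q).
Proof.
move=> lf tf [a|c] /=; first by case: ifP => _ /esym; [move/esym/esym/lf|move/esym/lf].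
move=> sc; case/andP: (valP c) => /eqP t1 /eqP s2.
by apply: (tf (val c).1 (val c).2); rewrite sc t1 s2.
Qed.

Section Cancel.
Variable Q : quiver V.
Let C := max_two_cycles Q.

Lemma max_two_cyclesP : maxset (disjoint_two_cycles (Q := Q)) C.
Proof. by rewrite /C /max_two_cycles; case: maxset_exists. Qed.

Lemma max_two_cycles_cycle c : c \in C ->
  [/\ c.1 != c.2, src c.1 = tgt c.2 & src c.2 = tgt c.1].
Proof.
case/maxsetP: max_two_cyclesP => /andP[/forallP + _] _.
by move=> /(_ c)/implyP h /h/and3P[? /eqP ? /eqP ?].
Qed.

Lemma max_two_cycles_disjoint c d a : c \in C -> d \in C ->
  a \in [set c.1; c.2] -> a \in [set d.1; d.2] -> c = d.
Proof.
move=> cC dC ac ad; apply/eqP; apply: contraT => cd.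
case/maxsetP: max_two_cyclesP => /andP[_ /forallP] /(_ c).
move=> /implyP/(_ cC)/forallP/(_ d)/implyP/(_ dC)/implyP/(_ cd) + _.
by rewrite disjoint_subset => /subsetP/(_ _ ac); rewrite inE /= ad.
Qed.

(** Each cancelled pair removes one arrow in either direction, so the difference of the two counts
    is unchanged. *)
Lemma exchange_matrix_cancel i j :
  exchange_matrix (cancel_two_cycles Q) i j = exchange_matrix Q i j.
Proof.
pose rem i j := #|[set a : arrow Q | [&& ~~ surviving a, src a == i & tgt a == j]]|.
pose cnt i j := (#|[set c in C | (src c.1 == i) && (tgt c.1 == j)]|
               + #|[set c in C | (src c.2 == i) && (tgt c.2 == j)]|)%N.
have numE i' j' : num_arrows Q i' j' = (num_arrows (cancel_two_cycles Q) i' j' + rem i' j')%N.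
  rewrite !num_arrowsE (bigID (fun a => surviving a)) /=; congr addn.
    rewrite -(big_sub_cond (I := arrow Q) (surviving (Q:=Q)) xpredT
      (fun a => nat_of_bool ((src a == i') && (tgt a == j')))) /=.
    by apply: eq_bigl => a; rewrite andbT unfold_in.
  rewrite /rem -sum1dep_card big_mkcond [RHS]big_mkcond; apply: eq_bigr => a _.
  by case: surviving; case: (_ == _); case: (_ == _).
have remE i' j' : rem i' j' = cnt i' j'.
  rewrite /cnt.
  have inj1 : {in [set c in C | (src c.1 == i') && (tgt c.1 == j')] &, injective fst}.
    move=> c d; rewrite !inE => /andP[cC _] /andP[dC _] e.
    by apply: (max_two_cycles_disjoint cC dC (a := c.1)); rewrite !inE ?e eqxx.
  have inj2 : {in [set c in C | (src c.2 == i') && (tgt c.2 == j')] &, injective snd}.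
    move=> c d; rewrite !inE => /andP[cC _] /andP[dC _] e.
    by apply: (max_two_cycles_disjoint cC dC (a := c.2)); rewrite !inE ?e eqxx ?orbT.
  rewrite -(card_in_imset inj1) -(card_in_imset inj2) /rem.
  (* No arrow is both a first and a second member: disjointness would identify the two cycles, and
     the members of one cycle differ. *)
  rewrite -cardsUI [X in (_ = _ + X)%N](_ : _ = 0%N) ?addn0.
    congr #|pred_of_set _|; apply/setP => a; rewrite !inE; apply/idP/idP.
      move=> /and3P[/forallPn/=[c]]; rewrite negb_imply negb_and !negbK.
      move=> /andP[cC /orP[]/eqP ->] s t; apply/orP; [left|right];
        by apply/imsetP; exists c; rewrite // inE cC s t.
    case/orP => /imsetP[c]; rewrite inE => /and3P[cC s t] ->; rewrite s t !andbT;
      by apply/forallPn; exists c; rewrite cC /= eqxx ?andbF.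
  apply/eqP; rewrite cards_eq0 -subset0; apply/subsetP => a; rewrite inE.
  case/andP => /imsetP[c + ac] /imsetP[d + ad]; rewrite !inE => /andP[cC _] /andP[dC _].
  have cd : c = d by apply: (max_two_cycles_disjoint cC dC (a := a)); rewrite !inE -?ac -?ad eqxx ?orbT.
  by case: (max_two_cycles_cycle cC) => + _ _; rewrite -ac cd -ad eqxx.
have cntC : cnt i j = cnt j i.
  rewrite /cnt addnC; congr addn; apply: eq_card => c; rewrite !inE;
  by case cC: (c \in C) => //=; case: (max_two_cycles_cycle cC) => _ -> ->; rewrite andbC.
by rewrite /exchange_matrix !numE !remE cntC; lia.
Qed.

(** By maximality: a surviving 2-cycle is disjoint from all chosen ones and could be added to the
    collection. *)
Lemma cancel_two_cycle_free : loop_free Q -> two_cycle_free (cancel_two_cycles Q).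
Proof.
move=> lf [a sa] [b sb] /= [ab ba].
have neq : a != b by apply/eqP => e; apply: (lf a); rewrite {2}e.
have surv x c : surviving x -> c \in C -> (x != c.1) && (x != c.2).
  by move=> /forallP/(_ c)/implyP; apply.
have abC : (a, b) \notin C.
  by apply/negP => /(surv _ _ sa); rewrite /= eqxx.
case/maxsetP: max_two_cyclesP => /andP[/forallP h1 /forallP h2] hmax.
suff /hmax/(_ (subsetUr _ _)) : disjoint_two_cycles ((a, b) |: C).
  by move/setP/(_ (a, b)); rewrite !inE eqxx /= (negbTE abC).
have dis c : c \in C -> [disjoint [set a; b] & [set c.1; c.2]].
  move=> cC; rewrite disjoint_subset; apply/subsetP => x; rewrite !inE negb_or.
  by case/orP => /eqP ->; [exact: (surv _ _ sa cC)|exact: (surv _ _ sb cC)].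
apply/andP; split.
  apply/forallP => c; apply/implyP; rewrite !inE => /orP[/eqP ->|cC].
    by rewrite /= neq ab ba !eqxx.
  by have := h1 c; rewrite cC.
apply/forallP => c; apply/implyP; rewrite !inE => cC.
apply/forallP => d; apply/implyP; rewrite !inE => dC; apply/implyP => cd.
case/orP: cC => [/eqP ec|cC]; case/orP: dC => [/eqP ed|dC].
- by rewrite ec ed eqxx in cd.
- by rewrite ec dis.
- by rewrite ed disjoint_sym dis.
- by have /implyP/(_ cC)/forallP/(_ d)/implyP/(_ dC)/implyP := h2 c; apply.
Qed.
End Cancel.

Lemma cancel_loop_free Q : loop_free Q -> loop_free (cancel_two_cycles Q).
Proof. by move=> lf [a sa]; apply: lf. Qed.

Lemma mutation_loop_free k Q :
  loop_free Q -> two_cycle_free Q -> loop_free (mutation k Q).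
Proof. by move=> lf tf; apply/cancel_loop_free/premutation_loop_free. Qed.

Lemma mutation_two_cycle_free k Q :
  loop_free Q -> two_cycle_free Q -> two_cycle_free (mutation k Q).
Proof. by move=> lf tf; apply/cancel_two_cycle_free/premutation_loop_free. Qed.

Lemma exchange_matrix_mutation k Q i j : loop_free Q -> two_cycle_free Q ->
  exchange_matrix (mutation k Q) i j = matrix_mutation k (exchange_matrix Q) i j.
Proof.
move=> lf tf; rewrite exchange_matrix_cancel /matrix_mutation.
rewrite -!exchange_matrixN -!num_arrows_pos_part //.
rewrite /exchange_matrix !num_arrows_premutation // [(j == k) || _]orbC.
by case: ifP => // _; lia.
Qed.

Lemma quiver_iso_loop_free Q Q' : quiver_iso Q Q' -> loop_free Q' -> loop_free Q.
Proof. by case=> f [_ fs ft] lf a; rewrite -fs -ft. Qed.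

Lemma quiver_iso_two_cycle_free Q Q' :
  quiver_iso Q Q' -> two_cycle_free Q' -> two_cycle_free Q.
Proof. by case=> f [_ fs ft] tf a b; rewrite -!fs -!ft; apply: tf. Qed.

Lemma quiver_iso_num_arrows Q Q' i j :
  quiver_iso Q Q' -> num_arrows Q i j = num_arrows Q' i j.
Proof.
case=> f [[g fK gK] fs ft]; rewrite !num_arrowsE [RHS](reindex f) /=; last first.
  by exists g => a _; [apply: fK|apply: gK].
by apply: eq_bigr => a _; rewrite fs ft.
Qed.
End ExchangeMatrix.

(** * The Laurent phenomenon *)

Section Weights.
Variables (F : fieldType) (N : nat) (lambda : 'I_N -> int).
Implicit Types (p f g h : {mpoly F[N]}) (m : 'X_{1..N}).

Definition weight m : int := \sum_i lambda i * (m i)%:Z.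

Lemma weightD m1 m2 : weight (m1 + m2)%MM = weight m1 + weight m2.
Proof.
rewrite /weight -big_split; apply: eq_bigr => i _ /=.
by rewrite mnmDE PoszD mulrDr.
Qed.

Definition weight_part (d : int) p : {mpoly F[N]} :=
  \sum_(m <- msupp p | weight m == d) p@_m *: 'X_[m].

Lemma mcoeff_weight_part d p m :
  (weight_part d p)@_m = if weight m == d then p@_m else 0.
Proof.
rewrite /weight_part raddf_sum /=.
under eq_bigr do rewrite mcoeffZ mcoeffX.
case: ifP => wm.
  have [ms|ms] := boolP (m \in msupp p).
    rewrite -big_filter (bigD1_seq m) ?filter_uniq ?msupp_uniq ?mem_filter ?wm //=.
    rewrite eqxx mulr1 big1_seq ?addr0 // => m' /andP[/negbTE -> _].
    by rewrite mulr0.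
  rewrite (memN_msupp_eq0 ms) big1_seq // => m' /andP[_ m's].
  by case: eqP ms => [<-|]; rewrite ?m's ?mulr0.
rewrite big1_seq // => m' /andP[/eqP w' _].
by case: eqP => [e|]; rewrite ?mulr0 //; rewrite -e w' eqxx in wm.
Qed.

Lemma weight_partD d p g :
  weight_part d (p + g) = weight_part d p + weight_part d g.
Proof.
apply/mpolyP => m; rewrite mcoeffD !mcoeff_weight_part mcoeffD.
by case: ifP => // _; rewrite addr0.
Qed.

Lemma weight_partMX d p M :
  weight_part d (p * 'X_[M]) = weight_part (d - weight M) p * 'X_[M].
Proof.
apply/mpolyP => m; rewrite mcoeff_weight_part.
have [Mm|Mm] := boolP (M <= m)%MM.
  rewrite -(submK Mm) addmC !mcoeffMX mcoeff_weight_part weightD.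
  by rewrite [in RHS]eq_sym subr_eq eq_sym [_ + weight M]addrC.
have z q : (q * 'X_[M])@_m = 0.
  apply: memN_msupp_eq0; rewrite (perm_mem (msuppMX _ _)).
  by apply/negP => /mapP[m' _ e]; move: Mm; rewrite e lem_addr.
by rewrite !z if_same.
Qed.

(* Compare the parts of least weight: as [N1 + N2] is homogeneous, the part of
   least weight of f is divisible by it up to the monomial [M1]. *)
Lemma weight_regular_lt (M1 M2 N1 N2 : 'X_{1..N}) f g :
  weight M1 < weight M2 -> weight N1 = weight N2 ->
  f * ('X_[M1] + 'X_[M2]) = g * ('X_[N1] + 'X_[N2]) ->
  exists (e : 'X_{1..N}) h, f * 'X_[e] = h * ('X_[N1] + 'X_[N2]).
Proof.
move=> ltM eqN.
have [n] := ubnP (size (msupp f)); elim: n f g => // n IHn f g sz fg.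
have [->|f0] := eqVneq f 0.
  by exists 0%MM, 0; rewrite !mul0r.
have [m0 m0f minm] : exists2 m0, m0 \in msupp f &
    forall m, m \in msupp f -> weight m0 <= weight m.
  have : msupp f != [::] by rewrite msupp_eq0.
  elim: (msupp f) => // m s IHs _.
  case: (eqVneq s [::]) => [->|/IHs[m1 m1s min1]].
    by exists m; rewrite ?inE // => m'; rewrite inE => /eqP ->.
  have [le|/ltW le] := leP (weight m) (weight m1).
    exists m; rewrite ?inE ?eqxx // => m'; rewrite inE => /orP[/eqP -> //|/min1].
    exact: le_trans.
  exists m1; rewrite ?inE ?m1s ?orbT // => m'; rewrite inE => /orP[/eqP -> //|/min1 //].
pose f0' := weight_part (weight m0) f.
pose g0 := weight_part (weight m0 + weight M1 - weight N1) g.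
have e0 : f0' * 'X_[M1] = g0 * ('X_[N1] + 'X_[N2]).
  have := congr1 (weight_part (weight m0 + weight M1)) fg.
  rewrite !mulrDr !weight_partD !weight_partMX -eqN addrK => e.
  rewrite /g0 -e /f0'.
  suff -> : weight_part (weight m0 + weight M1 - weight M2) f = 0.
    by rewrite mul0r addr0 ?addrK.
  apply/mpolyP => m.
  rewrite mcoeff_weight_part mcoeff0; case: eqP => // wm.
  apply: memN_msupp_eq0; apply/negP => /minm; lia.
(* Only [f0' * 'X_[M1]] is known to be a multiple of ['X_[N1] + 'X_[N2]]; the extra factor gives the
   remainder an equation of the same shape, with fewer monomials. *)
pose f1 := (f - f0') * 'X_[M1].
have e1 : f1 * ('X_[M1] + 'X_[M2]) =
    (g * 'X_[M1] - g0 * ('X_[M1] + 'X_[M2])) * ('X_[N1] + 'X_[N2]).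
  transitivity (f * ('X_[M1] + 'X_[M2]) * 'X_[M1] - f0' * 'X_[M1] * ('X_[M1] + 'X_[M2])).
    by rewrite /f1; ring.
  by rewrite fg e0; ring.
have sz1 : (size (msupp f1) < n)%N.
  rewrite (perm_size (msuppMX _ _)) size_map.
  have sub : {subset msupp (f - f0') <= rem m0 (msupp f)}.
    move=> m; rewrite mcoeff_msupp mcoeffB mcoeff_weight_part (rem_filter _ (msupp_uniq f)) mem_filter /=.
    have [->|nm] := eqVneq m m0; first by rewrite eqxx subrr eqxx.
    rewrite mcoeff_msupp; case: ifP => _; last by rewrite subr0.
    by rewrite subrr eqxx.
  apply: leq_ltn_trans (uniq_leq_size (msupp_uniq _) sub) _.
  by rewrite size_rem //; case: (msupp f : seq _) m0f sz.
have [e [h eh]] := IHn _ _ sz1 e1.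
exists (M1 + e)%MM, (h + g0 * 'X_[e]).
transitivity (f1 * 'X_[e] + f0' * 'X_[M1] * 'X_[e]).
  by rewrite /f1 mpolyXD; ring.
by rewrite eh e0; ring.
Qed.

Lemma weight_regular (M1 M2 N1 N2 : 'X_{1..N}) f g :
  weight M1 != weight M2 -> weight N1 = weight N2 ->
  f * ('X_[M1] + 'X_[M2]) = g * ('X_[N1] + 'X_[N2]) ->
  exists (e : 'X_{1..N}) h, f * 'X_[e] = h * ('X_[N1] + 'X_[N2]).
Proof.
rewrite neq_lt => /orP[|] ltM; first exact: weight_regular_lt.
by rewrite ['X_[M1] + _]addrC; apply: weight_regular_lt.
Qed.
End Weights.

(** * Clusters, exchange sums and algebraic independence *)

Section Cluster.
Variables (V : finType) (K : fieldType).
Implicit Types (B : V -> V -> int) (u : V -> K) (k : V).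

Definition exchange_sum k B u : K :=
  \prod_i u i ^+ pos_part (B i k) + \prod_i u i ^+ pos_part (- B i k).

Definition cluster_mutation k B u : V -> K :=
  fun i => if i == k then (u k)^-1 * exchange_sum k B u else u i.

Fixpoint cluster_mutations (ks : seq V) B u : V -> K :=
  if ks is k :: ks' then
    cluster_mutations ks' (matrix_mutation k B) (cluster_mutation k B u)
  else u.

Lemma eq_exchange_sum k B u B' u' :
  (forall i, B i k = B' i k) -> (forall i, B i k != 0 -> u i = u' i) ->
  exchange_sum k B u = exchange_sum k B' u'.
Proof.
move=> eB eu; rewrite /exchange_sum; congr (_ + _); apply: eq_bigr => i _;
  rewrite -eB; have := eu i; case: eqP => [->|_ -> //]; by rewrite ?oppr0 !expr0.
Qed.

Lemma exchange_sumN k B u : exchange_sum k (fun i j => - B i j) u = exchange_sum k B u.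
Proof.
by rewrite /exchange_sum addrC; under [X in X + _]eq_bigr do rewrite opprK.
Qed.
End Cluster.

Lemma matrix_mutationN (V : finType) k (B : V -> V -> int) i j :
  matrix_mutation k (fun i j => - B i j) i j = - matrix_mutation k B i j.
Proof.
rewrite /matrix_mutation; case: ifP => // _; rewrite !opprK !opprD !opprK.
by lia.
Qed.

Lemma pos_partB x : (pos_part x)%:Z - (pos_part (- x))%:Z = x.
Proof. by rewrite /pos_part; lia. Qed.

Definition skew_symmetric (V : finType) (B : V -> V -> int) := forall i j, B j i = - B i j.

Lemma skew_diag (V : finType) (B : V -> V -> int) i : skew_symmetric B -> B i i = 0.
Proof. by move=> /(_ i i); lia. Qed.

Lemma skew_mutation (V : finType) k (B : V -> V -> int) :
  skew_symmetric B -> skew_symmetric (matrix_mutation k B).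
Proof.
move=> sB i j; rewrite /matrix_mutation orbC (sB i j) (sB k i) (sB j k) !opprK.
by case: ifP => // _; lia.
Qed.

Lemma matrix_mutationK (V : finType) k (B : V -> V -> int) : skew_symmetric B ->
  forall i j, matrix_mutation k (matrix_mutation k B) i j = B i j.
Proof.
move=> sB i j; rewrite /matrix_mutation !eqxx !orbT /= !opprK.
by case: ifP => [->|->]; lia.
Qed.

Section Evaluation.
Variables (F K : fieldType) (iota : {rmorphism F -> K}) (N : nat).
Implicit Types (u w : 'I_N -> K) (p q : {mpoly F[N]}) (B : 'I_N -> 'I_N -> int).

Definition ev u p : K := mmap iota u p.

Lemma ev_is_zmod u : zmod_morphism (ev u).
Proof. exact: mmapB. Qed.
Lemma ev_is_monoid u : monoid_morphism (ev u).
Proof. by split; [rewrite /ev rmorph1|move=> p q; rewrite /ev rmorphM]. Qed.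
HB.instance Definition _ u := GRing.isZmodMorphism.Build _ _ (ev u) (ev_is_zmod u).
HB.instance Definition _ u := GRing.isMonoidMorphism.Build _ _ (ev u) (ev_is_monoid u).

Lemma evX u m : ev u 'X_[m] = \prod_i u i ^+ m i.
Proof. by rewrite /ev mmapX. Qed.

Lemma evZ u c p : ev u (c *: p) = iota c * ev u p.
Proof. exact: mmapZ. Qed.

Definition alg_indep u := forall p, ev u p = 0 -> p = 0.

Lemma alg_indep_neq0 u i : alg_indep u -> u i != 0.
Proof.
move=> iu; apply/eqP => ui; have /iu/eqP : ev u 'X_i = 0.
  by rewrite evX (bigD1 i) //= mnm1E eqxx ui mul0r.
by rewrite -msupp_eq0 msuppX.
Qed.

Definition exchange_poly k B : {mpoly F[N]} :=
  'X_[[multinom pos_part (B i k) | i < N]] + 'X_[[multinom pos_part (- B i k) | i < N]].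

Lemma ev_exchange_poly u k B : ev u (exchange_poly k B) = exchange_sum k B u.
Proof.
by rewrite rmorphD /= !evX; congr (_ + _); apply: eq_bigr => i _; rewrite mnmE.
Qed.

Lemma exchange_poly_neq0 k B : (exists i, B i k != 0) -> exchange_poly k B != 0.
Proof.
case=> i Bi; apply/eqP => /(congr1 (mcoeff [multinom pos_part (B i k) | i < N])).
rewrite mcoeffD !mcoeffX eqxx mcoeff0; case: eqP => [/mnmP/(_ i)|_].
  by rewrite !mnmE /pos_part; lia.
by rewrite addr0 => /eqP; rewrite oner_eq0.
Qed.

(* [homog_subst k B p] is X_k^D p(X') with D = msize p, for the cluster X' obtained from the
   indeterminates by mutation at k. *)
Definition homog_subst k B p : {mpoly F[N]} :=
  \sum_(m <- msupp p) p@_m *: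
    ('X_[[multinom (if i == k then msize p - m k else m i)%N | i < N]]
       * exchange_poly k B ^+ m k).

Lemma ev_homog_subst w k B p : w k != 0 ->
  ev w (homog_subst k B p) = w k ^+ msize p * ev (cluster_mutation k B w) p.
Proof.
move=> wk.
rewrite {2}/ev /mmap mulr_sumr /homog_subst raddf_sum /=; apply: eq_big_seq => m ms.
rewrite evZ mulrCA; congr (_ * _).
have le : (m k <= msize p)%N.
  rewrite (leq_trans _ (ltnW (msize_mdeg_lt ms))) // mdegE (bigD1 k) //=.
  exact: leq_addr.
rewrite rmorphM rmorphXn /= ev_exchange_poly evX /mmap1 (bigD1 k) //= mnmE eqxx.
rewrite [in RHS](bigD1 k) //= /cluster_mutation eqxx exprMn exprVn.
rewrite [in LHS](eq_bigr (fun i => w i ^+ m i)); last first.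
  by move=> i /negbTE ik; rewrite mnmE ik.
rewrite [in RHS](eq_bigr (fun i => w i ^+ m i)); last first.
  by move=> i /negbTE ->.
have -> : w k ^+ msize p = w k ^+ (msize p - m k) * w k ^+ m k.
  by rewrite -exprD subnK.
move: (w k ^+ m k) (expf_neq0 (m k) wk) (exchange_sum k B w ^+ m k) => a a0 b.
move: (\prod_(_ < _ | _) _) (w k ^+ _) => c d.
by rewrite !mulrA [d * a]mulrC; field.
Qed.
End Evaluation.

Lemma cluster_mutationK (V : finType) (K : fieldType) k (B : V -> V -> int) (u : V -> K) :
  B k k = 0 -> u k != 0 -> exchange_sum k B u != 0 ->
  cluster_mutation k B (cluster_mutation k B u) = u.
Proof.
move=> Bkk uk e0; apply: functional_extensionality => i.
rewrite {1}/cluster_mutation; case: eqP => [->|ik]; last first.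
  by rewrite /cluster_mutation; case: eqP.
rewrite (_ : exchange_sum k B _ = exchange_sum k B u); last first.
  apply: eq_exchange_sum => // j; rewrite /cluster_mutation.
  by have [->|//] := eqVneq j k; rewrite Bkk eqxx.
by rewrite /cluster_mutation eqxx invfM invrK -mulrA mulVf ?mulr1.
Qed.

Lemma cluster_mutationN (V : finType) (K : fieldType) k (B B' : V -> V -> int) (u : V -> K) :
  (forall i, B' i k = - B i k) -> cluster_mutation k B' u = cluster_mutation k B u.
Proof.
move=> BB'; apply: functional_extensionality => i; rewrite /cluster_mutation.
by rewrite -[in RHS]exchange_sumN (@eq_exchange_sum _ _ _ B' _ (fun i j => - B i j) u).
Qed.

Section Generic.
Variables (F : fieldType) (N : nat).

Definition generic_point (i : 'I_N) : {fraction {mpoly F[N]}} := tofrac 'X_i.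
Definition const_embedding : {rmorphism F -> {fraction {mpoly F[N]}}} := (@tofrac _) \o (@mpolyC N F).

Lemma ev_generic p : ev const_embedding generic_point p = tofrac p.
Proof.
rewrite [in RHS](mpolyE p) rmorph_sum /=; apply: eq_bigr => m _.
rewrite -mul_mpolyC rmorphM /= mpolyXE_id rmorph_prod; congr (_ * _).
by apply: eq_bigr => i _; rewrite rmorphXn.
Qed.

Lemma generic_indep : alg_indep const_embedding generic_point.
Proof. by move=> p /eqP; rewrite ev_generic tofrac_eq0 => /eqP. Qed.
End Generic.

Section LaurentRing.
Variables (F K : fieldType) (iota : {rmorphism F -> K}) (N : nat).
Implicit Types (u w : 'I_N -> K) (B : 'I_N -> 'I_N -> int).
Local Notation ev := (ev iota).

(** Evaluate at the mutated point [u']: mutation at k is an involution, so the value there is a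
    nonzero multiple of p at u. *)
Lemma homog_subst_eq0 k B u p : B k k = 0 -> u k != 0 -> exchange_sum k B u != 0 ->
  homog_subst k B p = 0 -> ev u p = 0.
Proof.
move=> Bkk uk e0 h0; pose u' := cluster_mutation k B u.
have u'k : u' k != 0 by rewrite /u' /cluster_mutation eqxx mulf_neq0 ?invr_eq0.
have := ev_homog_subst iota B p u'k.
rewrite h0 rmorph0 => /esym/eqP; rewrite mulf_eq0 expf_eq0 (negbTE u'k) andbF /=.
by rewrite cluster_mutationK // => /eqP.
Qed.
End LaurentRing.

Section Independence.
Variables (F K : fieldType) (iota : {rmorphism F -> K}) (N : nat).
Implicit Types (u w : 'I_N -> K) (B : 'I_N -> 'I_N -> int).

(** A relation p between the new variables becomes, after clearing denominators, the relation
    [homog_subst k B p] between the old ones, which is therefore the zero polynomial. Evaluating it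
    at the mutated generic point gives p = 0. *)
Lemma alg_indep_mutation k B u : skew_symmetric B -> (exists i, B i k != 0) ->
  alg_indep iota u -> alg_indep iota (cluster_mutation k B u).
Proof.
move=> sB Bk iu p pu.
have := ev_homog_subst iota B p (alg_indep_neq0 k iu).
rewrite pu mulr0 => /iu h0.
have iX : alg_indep (const_embedding F N) (@generic_point F N) by exact: generic_indep.
have e0 : exchange_sum k B (@generic_point F N) != 0.
  rewrite -(ev_exchange_poly (const_embedding F N)) ev_generic tofrac_eq0.
  exact: exchange_poly_neq0.
exact: (iX _ (homog_subst_eq0 _ (skew_diag _ sB) (alg_indep_neq0 k iX) e0 h0)).
Qed.
End Independence.

Lemma expr_pos_part (K : fieldType) (x : K) (a : int) : x != 0 ->
  x ^+ pos_part (- a) * x ^ a = x ^+ pos_part a.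
Proof.
by move=> x0; rewrite !exprnP -expfzDr //; congr (_ ^ _); rewrite -{2}[a]pos_partB addrC subrK.
Qed.

Section LaurentRing.
Variables (F K : fieldType) (iota : {rmorphism F -> K}) (N : nat).
Implicit Types (u w : 'I_N -> K) (f g h : K) (a b : 'I_N -> int).
Local Notation ev := (ev iota).

Definition is_laurent u f :=
  exists p (m : 'X_{1..N}), ev u 'X_[m] * f = ev u p.

Section Ring.
Variable u : 'I_N -> K.
Hypothesis u0 : forall i, u i != 0.

Lemma ev_monomial_neq0 (m : 'X_{1..N}) : ev u 'X_[m] != 0.
Proof. by rewrite evX; apply/prodf_neq0 => i _; rewrite expf_neq0. Qed.

Lemma is_laurent_ev p : is_laurent u (ev u p).
Proof. by exists p, 0%MM; rewrite mpolyX0 rmorph1 mul1r. Qed.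

Lemma is_laurent0 : is_laurent u 0.
Proof. by have := is_laurent_ev 0; rewrite rmorph0. Qed.

Lemma is_laurent1 : is_laurent u 1.
Proof. by have := is_laurent_ev 1; rewrite rmorph1. Qed.

Lemma is_laurentD f g : is_laurent u f -> is_laurent u g -> is_laurent u (f + g).
Proof.
case=> p [m e] [q [m' e']].
exists ('X_[m'] * p + 'X_[m] * q), (m + m')%MM.
by rewrite mpolyXD !rmorphD !rmorphM /= -e -e'; ring.
Qed.

Lemma is_laurentM f g : is_laurent u f -> is_laurent u g -> is_laurent u (f * g).
Proof.
case=> p [m e] [q [m' e']].
exists (p * q), (m + m')%MM.
by rewrite mpolyXD !rmorphM /= -e -e'; ring.
Qed.

Lemma is_laurentX f n : is_laurent u f -> is_laurent u (f ^+ n).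
Proof.
by move=> uf; elim: n => [|n IHn]; rewrite ?exprS; [apply: is_laurent1|apply: is_laurentM].
Qed.

Lemma is_laurentN f : is_laurent u f -> is_laurent u (- f).
Proof. by case=> p [m e]; exists (- p), m; rewrite rmorphN /= -e mulrN. Qed.

Lemma is_laurent_sum (I : Type) (r : seq I) (P : pred I) (f : I -> K) :
  (forall i, P i -> is_laurent u (f i)) -> is_laurent u (\sum_(i <- r | P i) f i).
Proof. by move=> uf; elim/big_ind: _ => //; [apply: is_laurent0|apply: is_laurentD]. Qed.

Definition monomial a : K := \prod_i u i ^ a i.

Lemma monomial_neq0 a : monomial a != 0.
Proof. by apply/prodf_neq0 => i _; rewrite expfz_neq0. Qed.

Lemma monomialD a b : monomial (fun i => a i + b i) = monomial a * monomial b.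
Proof. by rewrite -big_split; apply: eq_bigr => i _; rewrite expfzDr. Qed.

Lemma monomialN a : monomial (fun i => - a i) = (monomial a)^-1.
Proof. by rewrite -prodfV; apply: eq_bigr => i _; rewrite invr_expz. Qed.

Lemma monomialM a (n : nat) : monomial (fun i => a i * n%:Z) = monomial a ^+ n.
Proof. by rewrite -prodrXl; apply: eq_bigr => i _; rewrite exprnP exprz_exp. Qed.

Lemma eq_monomial a b : a =1 b -> monomial a = monomial b.
Proof. by move=> ab; apply: eq_bigr => i _; rewrite ab. Qed.

Lemma monomialU j : monomial (fun i => (i == j)%:Z) = u j.
Proof.
by rewrite /monomial (bigD1 j) //= eqxx big1 ?mulr1 // => i /negbTE ->.
Qed.

Lemma is_laurent_monomial a : is_laurent u (monomial a).
Proof.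
exists 'X_[[multinom pos_part (a i) | i < N]], [multinom pos_part (- a i) | i < N].
rewrite !evX -big_split; apply: eq_bigr => i _ /=; rewrite !mnmE.
exact: expr_pos_part.
Qed.
End Ring.

Definition laurent_dvd u z f := exists2 h, is_laurent u h & f = z * h.

(* Multiplication by w is injective modulo z in the ring of Laurent polynomials
   in u. *)
Definition laurent_coprime u (z w : K) :=
  forall f, is_laurent u f -> laurent_dvd u z (w * f) -> laurent_dvd u z f.

Lemma laurent_dvdDr u z f g : is_laurent u g ->
  laurent_dvd u z (f + z * g) -> laurent_dvd u z f.
Proof.
move=> ug [h uh e]; exists (h - g); last by rewrite mulrBr -e addrK.
by apply: is_laurentD => //; apply: is_laurentN.
Qed.

(** Modulo z the factor is a monomial, hence a unit of the Laurent ring. *)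
Lemma monomial_coprime u z a r : (forall i, u i != 0) -> is_laurent u r ->
  laurent_coprime u z (monomial u a + z * r).
Proof.
move=> u0 ur f uf; rewrite mulrDl -mulrA => /laurent_dvdDr [].
  exact: is_laurentM.
move=> h uh e; exists (monomial u (fun i => - a i) * h).
  by apply: is_laurentM => //; apply: is_laurent_monomial.
by rewrite mulrCA -e mulrA monomialN // mulVf ?mul1r ?monomial_neq0.
Qed.

(** The grading by [lambda] makes [1 + monomial u a] homogeneous and gives the two terms of
    [1 + monomial u b] different weights, which is the situation of [weight_regular]. The summand
    with r is a multiple of z. *)
Lemma binomial_coprime u a b c d r (lambda : 'I_N -> int) : alg_indep iota u ->
  is_laurent u r ->
  \sum_i lambda i * a i = 0 -> \sum_i lambda i * b i != 0 ->
  laurent_coprime u (monomial u c * (1 + monomial u a))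
    (monomial u d * (1 + monomial u b) + monomial u c * (1 + monomial u a) * r).
Proof.
move=> iu ur la lb f uf.
have u0 i : u i != 0 by apply: alg_indep_neq0 iu.
rewrite mulrDl -[_ * r * f]mulrA => /laurent_dvdDr [].
  exact: is_laurentM.
move=> h uh e.
have [p [m pm]] := uf; have [q [m' qm']] := is_laurentM uh (is_laurent_monomial u0 (fun i => c i - d i)).
pose neg a := [multinom pos_part (- a i) | i < N].
pose pos a := [multinom pos_part (a i) | i < N].
have bin a' : ev u ('X_[neg a'] + 'X_[pos a']) = ev u 'X_[neg a'] * (1 + monomial u a').
  rewrite rmorphD /= mulrDr mulr1; congr (_ + _).
  rewrite !evX -big_split; apply: eq_bigr => i _ /=; rewrite !mnmE.
  by rewrite expr_pos_part.
have wneg a' : weight lambda (pos a') - weight lambda (neg a') = \sum_i lambda i * a' i.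
  by rewrite -sumrB; apply: eq_bigr => i _; rewrite !mnmE -mulrBr pos_partB.
(* Denominators are cleared, and algebraic independence lifts the identity from K to polynomials. *)
have e1 : (p * 'X_[neg a] * 'X_[m']) * ('X_[neg b] + 'X_[pos b]) =
    (q * 'X_[neg b] * 'X_[m]) * ('X_[neg a] + 'X_[pos a]).
  apply/eqP; rewrite -subr_eq0; apply/eqP; apply: iu; rewrite rmorphB; apply/eqP.
  rewrite /= subr_eq0 ![ev u (_ * (_ + _))]rmorphM /= !bin !rmorphM /= -pm -qm'.
  have -> : monomial u (fun i => c i - d i) = monomial u c / monomial u d.
    by rewrite monomialD // monomialN.
  have d0 := monomial_neq0 u0 d.
  have f1 : (1 + monomial u b) * f = (monomial u c * (1 + monomial u a)) * h / monomial u d.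
    by rewrite -e; field.
  by apply/eqP; transitivity (ev u 'X_[m] * ev u 'X_[neg a] * ev u 'X_[m'] * ev u 'X_[neg b] * ((1 + monomial u b) * f)); [ring|rewrite f1; ring].
have [||E [h' e2]] := weight_regular (lambda := lambda) _ _ e1.
- by rewrite -subr_eq0 -oppr_eq0 opprB wneg.
- by apply/eqP; rewrite -subr_eq0 -oppr_eq0 opprB wneg la.
have := congr1 (ev u) e2; rewrite [in RHS]rmorphM /= bin !rmorphM /= -pm => e3.
pose s := ev u 'X_[m] * ev u 'X_[m'] * ev u 'X_[E].
have s0 : s != 0 by rewrite !mulf_neq0 ?ev_monomial_neq0.
exists (ev u h' * monomial u (fun i => - c i) / s).
  have -> : s^-1 = monomial u (fun i => - (m i + m' i + E i)%:Z).
    rewrite monomialN // /s !evX -!big_split /=; congr (_^-1).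
    by apply: eq_bigr => i _; rewrite -!exprD exprnP.
  apply: is_laurentM; last exact: is_laurent_monomial.
  by apply: is_laurentM; [exact: is_laurent_ev|exact: is_laurent_monomial].
have c0 := monomial_neq0 u0 c.
rewrite monomialN //.
have -> : f = (ev u h' * (1 + monomial u a)) / s.
  have n0 := ev_monomial_neq0 u0 (neg a).
  apply: (mulfI n0); rewrite /s.
  have [m0 m'0 E0] := And3 (ev_monomial_neq0 u0 m) (ev_monomial_neq0 u0 m') (ev_monomial_neq0 u0 E).
  transitivity (ev u 'X_[m] * f * ev u 'X_[neg a] * ev u 'X_[m'] * ev u 'X_[E]
     / (ev u 'X_[m] * ev u 'X_[m'] * ev u 'X_[E])); first by field; rewrite ?m0 ?m'0 ?E0.
  by rewrite e3; field; rewrite ?m0 ?m'0 ?E0.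
by field; rewrite ?c0 ?s0.
Qed.

(** Write f as a polynomial in w over a monomial of degree n in w; each inverse of some [w i] costs
    one factor d. *)
Lemma is_laurent_transfer u w d f :
  (forall i, is_laurent u (w i)) -> (forall i, w i != 0) ->
  (forall i, is_laurent u (d / w i)) ->
  is_laurent w f -> exists n, is_laurent u (d ^+ n * f).
Proof.
move=> uw w0 udw [p [m e]]; exists (mdeg m).
have uev q : is_laurent u (ev w q).
  rewrite /ev /mmap; apply: is_laurent_sum => m' _; apply: is_laurentM.
    by have := is_laurent_ev u (q@_m')%:MP; rewrite /ev mmapC.
  by rewrite /mmap1; elim/big_ind: _ => *;
    [apply: is_laurent1|apply: is_laurentM|apply: is_laurentX].
have -> : f = ev w p * (ev w 'X_[m])^-1.
  by rewrite -e mulrAC mulfV ?mul1r // ev_monomial_neq0.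
rewrite mulrCA; apply: is_laurentM => //.
rewrite evX mdegE -prodrXr -prodfV -big_split /=.
elim/big_ind: _ => [|? ?|i _]; [exact: is_laurent1|exact: is_laurentM|].
by rewrite -exprVn -exprMn; apply: is_laurentX.
Qed.

(** For m > 0, z divides [d ^+ n] times [z ^+ m * f]. Coprimality removes the factors d one by one,
    so z divides [z ^+ m * f] in the Laurent ring and m can be lowered. *)
Lemma laurent_coprime_descent u z d f (m n : nat) : z != 0 -> d != 0 ->
  laurent_coprime u z d ->
  is_laurent u (z ^+ m * f) -> is_laurent u d -> is_laurent u z -> is_laurent u (d ^+ n * f) -> is_laurent u f.
Proof.
move=> z0 d0 cop zf ud uz df.
have copn g : is_laurent u g -> laurent_dvd u z (d ^+ n * g) -> laurent_dvd u z g.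
  elim: {df} n g => [|n IHn] g ug; first by rewrite expr0 mul1r.
  rewrite exprSr -mulrA => /IHn h; apply: cop => //; apply: h; exact: is_laurentM.
elim: m zf => [|m IHm] zf; first by rewrite expr0 mul1r in zf.
apply: IHm; have [|h uh e] := copn _ zf.
  by exists (z ^+ m * (d ^+ n * f)); [apply: is_laurentM => //; apply: is_laurentX|rewrite exprS; ring].
by rewrite -[_ * f](mulKf z0) mulrA -exprS e mulKf.
Qed.

Lemma cluster_mutation_monomial u (B : 'I_N -> 'I_N -> int) k : (forall i, u i != 0) ->
  cluster_mutation k B u k =
  monomial u (fun i => (pos_part (- B i k))%:Z - (i == k)%:Z) * (1 + monomial u (fun i => B i k)).
Proof.
move=> u0; rewrite mulrDr mulr1 -monomialD // monomialD // monomialN // monomialU.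
rewrite /cluster_mutation eqxx /exchange_sum mulrDr addrC; congr (_ + _).
  by rewrite mulrC.
rewrite -[u k in LHS](monomialU u k) -monomialN // -/(monomial u (fun i => (pos_part (B i k))%:Z)).
rewrite -monomialD //; apply: eq_monomial => i.
by have := pos_partB (B i k); lia.
Qed.

Lemma is_laurent_binomial u a b : (forall i, u i != 0) ->
  is_laurent u (monomial u a * (1 + monomial u b)).
Proof.
move=> u0; apply: is_laurentM; first exact: is_laurent_monomial.
by apply: is_laurentD; [apply: is_laurent1|apply: is_laurent_monomial].
Qed.

Lemma laurent_coprimeM u (z x y : K) : is_laurent u y ->
  laurent_coprime u z x -> laurent_coprime u z y -> laurent_coprime u z (x * y).
Proof.
move=> uy cx cy f uf; rewrite -mulrA => /cx h; apply: cy => //; apply: h.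
exact: is_laurentM.
Qed.

Lemma prod_monomial u w j (e : 'I_N -> nat) : 
  (forall i, i != j -> e i != 0%N -> w i = u i) ->
  \prod_i w i ^+ e i = w j ^+ e j * monomial u (fun i => if i == j then 0 else (e i)%:Z).
Proof.
move=> wu; rewrite (bigD1 j) //= /monomial [in RHS](bigD1 j) //= eqxx mul1r; congr (_ * _).
apply: eq_bigr => i ij; rewrite (negbTE ij) -exprnP.
by case: (eqVneq (e i) 0%N) => [->|/wu -> //]; rewrite !expr0.
Qed.

(* u is the cluster at t0, and z, x, v are the new variables on the path
   t0 -j- t1 -k- t2 -j- t3. *)
Section Step.
Variables (B : 'I_N -> 'I_N -> int) (u : 'I_N -> K) (j k : 'I_N).
Hypotheses (skB : skew_symmetric B) (iu : alg_indep iota u) (jk : j != k).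
Hypotheses (lambda : 'I_N -> int) (lj : \sum_i lambda i * B i j = 0)
  (lk : \sum_i lambda i * B i k != 0).
Let u0 i : u i != 0. Proof. exact: alg_indep_neq0 iu. Qed.
Let B1 := matrix_mutation j B.
Let B2 := matrix_mutation k B1.
Let u1 := cluster_mutation j B u.
Let u2 := cluster_mutation k B1 u1.
Let u3 := cluster_mutation j B2 u2.
Let z := u1 j.
Let x := u2 k.
Let v := u3 j.
Let P := monomial u (fun i => (pos_part (B i j))%:Z).
Let M := monomial u (fun i => (pos_part (- B i j))%:Z).

Hypothesis z0 : z != 0.

Let zuj : z * u j = exchange_sum j B u.
Proof. by rewrite /z /u1 /cluster_mutation eqxx mulrAC mulVf ?mul1r. Qed.

Let uz : is_laurent u z.
Proof. by rewrite /z /u1 cluster_mutation_monomial //; apply: is_laurent_binomial. Qed.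

Lemma u1_neqj i : i != j -> u1 i = u i.
Proof. by rewrite /u1 /cluster_mutation => /negbTE ->. Qed.

Let B1kk : B1 k k = 0. Proof. by apply/skew_diag/skew_mutation. Qed.
Let B2jj : B2 j j = 0. Proof. by apply/skew_diag/skew_mutation/skew_mutation. Qed.

(** Without arrows between j and k the two mutations commute: the third step undoes the first, so v
    is the unit [u j], and x is the exchange binomial at k, which [lambda] separates from z. *)
Lemma laurent_step_zero : B j k = 0 ->
  [/\ is_laurent u z, is_laurent u x, is_laurent u v & laurent_coprime u z (x * v)].
Proof.
move=> b0.
have b0' : B k j = 0 by rewrite skB b0 oppr0.
have B1E i : i != j -> B1 i k = B i k.
  move=> /negbTE ij; rewrite /B1 /matrix_mutation ij eq_sym (negbTE jk) /= b0.
  by rewrite oppr0 /pos_part !muln0 addr0 subr0.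
have B1jk : B1 j k = 0 by rewrite /B1 /matrix_mutation eqxx b0 oppr0.
have B1kj : B1 k j = 0 by rewrite /B1 /matrix_mutation eqxx orbT b0' oppr0.
have xE : x = monomial u (fun i => (pos_part (- B i k))%:Z - (i == k)%:Z) * (1 + monomial u (fun i => B i k)).
  rewrite /x /u2 /cluster_mutation eqxx.
  rewrite (@eq_exchange_sum _ _ _ B1 u1 B u); first last.
  - by move=> i; have [->|ij _] := eqVneq i j; [rewrite B1jk|exact: u1_neqj].
  - by move=> i; have [->|] := eqVneq i j; [rewrite B1jk b0|exact: B1E].
  by rewrite -(cluster_mutation_monomial B k u0) /cluster_mutation eqxx u1_neqj // eq_sym.
have vE : v = u j.
  rewrite /v /u3 {1}/cluster_mutation eqxx.
  rewrite (@eq_exchange_sum _ _ _ B2 u2 (fun i j => - B i j) u).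
  - rewrite exchange_sumN -[u2 j]/(cluster_mutation k B1 u1 j) /cluster_mutation (negbTE jk).
    by rewrite -zuj mulKf //.
  - move=> i; rewrite /B2 /matrix_mutation (negbTE jk) orbF B1kj.
    case: eqP => [->|_]; first by rewrite B1kj b0' oppr0.
    by rewrite /pos_part oppr0 !muln0 addr0 subr0 /B1 /matrix_mutation eqxx orbT.
  move=> i; have [->|ij] := eqVneq i j; first by rewrite B2jj eqxx.
  have [->|ik _] := eqVneq i k; last by rewrite /u2 /cluster_mutation (negbTE ik) u1_neqj.
  by rewrite /B2 /matrix_mutation eqxx B1kj oppr0 eqxx.
have ux : is_laurent u x by rewrite xE; apply: is_laurent_binomial.
have uv : is_laurent u v by rewrite vE -monomialU; apply: is_laurent_monomial.
split=> //; apply: laurent_coprimeM => //.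
  have := @binomial_coprime u _ _ (fun i => (pos_part (- B i j))%:Z - (i == j)%:Z)
    (fun i => (pos_part (- B i k))%:Z - (i == k)%:Z) 0 lambda iu (is_laurent0 u) lj lk.
  by rewrite mulr0 addr0 -xE -cluster_mutation_monomial.
have := @monomial_coprime u z (fun i => (i == j)%:Z) 0 u0 (is_laurent0 u).
by rewrite mulr0 addr0 monomialU vE.
Qed.

(** x and v are expanded in powers of z. Modulo z, x is a monomial, and so is v when b >= 2. For b =
    1, v is a monomial times [1 + monomial u (fun i => B i k)], coprime to z through [lambda]. *)
Lemma laurent_step_pos : 0 < B j k ->
  [/\ is_laurent u z, is_laurent u x, is_laurent u v & laurent_coprime u z (x * v)].
Proof.
move=> b0; pose b := pos_part (B j k).
have bE : B j k = b%:Z by rewrite /b /pos_part; lia.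
have bE' : B k j = - b%:Z by rewrite skB bE.
have kj : k != j by rewrite eq_sym.
have B1jk : B1 j k = - b%:Z by rewrite /B1 /matrix_mutation eqxx bE.
have B1kj : B1 k j = b%:Z by rewrite /B1 /matrix_mutation eqxx orbT bE' opprK.
have B1ik i : i != j -> B1 i k = B i k + (pos_part (B i j) * b)%:Z.
  move=> /negbTE ij; rewrite /B1 /matrix_mutation ij (negbTE kj) /= bE /pos_part; lia.
have B2kj : B2 k j = - b%:Z by rewrite /B2 /matrix_mutation eqxx B1kj.
have B2ij i : i != k -> B2 i j = - B i j + (pos_part (B1 i k) * b)%:Z.
  move=> /negbTE ik; rewrite /B2 /matrix_mutation ik (negbTE jk) /= B1kj.
  by rewrite {1}/B1 /matrix_mutation eqxx orbT /pos_part; lia.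
have [pb pNb] : pos_part (- b%:Z) = 0%N /\ pos_part (- - b%:Z) = b.
  by rewrite /pos_part; lia.
(* R and S are the exchange monomials of the second mutation without the variable at j; G and H are
   those of the third without the variable at k. *)
pose R := monomial u (fun i => if i == j then 0 else (pos_part (B1 i k))%:Z).
pose S := monomial u (fun i => if i == j then 0 else (pos_part (- B1 i k))%:Z).
pose G := monomial u (fun i => if i == k then 0 else (pos_part (B2 i j))%:Z).
pose H := monomial u (fun i => if i == k then 0 else (pos_part (- B2 i j))%:Z).
have uk := u0 k; have uj := u0 j.
have xE : x = (u k)^-1 * (R + z ^+ b * S).
  rewrite /x /u2 {1}/cluster_mutation eqxx u1_neqj //; congr (_ * _).
  rewrite /exchange_sum !(@prod_monomial u _ j) ?B1jk ?pb ?pNb ?expr0 ?mul1r //;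
  by move=> i ij _; apply: u1_neqj.
have zvE : z * v = G + x ^+ b * H.
  rewrite /v /u3 {1}/cluster_mutation eqxx -[u2 j]/(cluster_mutation k B1 u1 j).
  rewrite {1}/cluster_mutation (negbTE jk) mulVKf //.
  have u2E i : i != k -> i != j -> u2 i = u i.
    by move=> ik ij; rewrite /u2 /cluster_mutation (negbTE ik) u1_neqj.
  rewrite /exchange_sum !(@prod_monomial u _ k) ?B2kj ?pb ?pNb ?expr0 ?mul1r //;
  move=> i ik e; apply: u2E => //; apply: contra_neq e => ->; by rewrite B2jj.
have P0 := monomial_neq0 u0 (fun i => (pos_part (B i j))%:Z).
(* With this relation the part of [zvE] outside [z ^+ b * S] is a multiple of P + M, that is of
   [z * u j], so the division by z in [vE] is exact. *)
have GE : G = H * R ^+ b / u k ^+ b * M / P.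
  rewrite /P -monomialN // /M /R -monomialM // /H -[u k in RHS](monomialU u k) -monomialM //.
  rewrite -monomialN // -!monomialD //; apply: eq_monomial => i.
  have := pos_partB (B i j); have := pos_partB (B2 i j).
  have [->|ik] := eqVneq i k.
    by rewrite (negbTE kj) B1kk bE' /pos_part; lia.
  rewrite B2ij //; have [->|ij] := eqVneq i j; last by lia.
  by rewrite skew_diag // B1jk /pos_part; lia.
have uR : is_laurent u R by apply: is_laurent_monomial.
have uS : is_laurent u S by apply: is_laurent_monomial.
have uH : is_laurent u H by apply: is_laurent_monomial.
have b1 : (0 < b)%N by move: b0; rewrite bE.
have zb : z ^+ b = z * z ^+ b.-1 by rewrite -exprS prednK.
(* The telescoping quotient of [(R + z ^+ b * S) ^+ b - R ^+ b] by [z ^+ b * S]. *)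
pose T := \sum_(i < b) (R + z ^+ b * S) ^+ (b.-1 - i) * R ^+ i.
have uT : is_laurent u T.
  apply: is_laurent_sum => i _; apply: is_laurentM; apply: is_laurentX => //.
  by apply: is_laurentD => //; apply: is_laurentM => //; apply: is_laurentX.
have TE : (R + z ^+ b * S) ^+ b = R ^+ b + z ^+ b * S * T.
  apply/eqP; rewrite [X in _ == X]addrC -subr_eq subrXX /T; apply/eqP; congr (_ * _).
  by rewrite addrC addKr.
have zuj' : z * u j = P + M by exact: zuj.
have vE : v = H / u k ^+ b * (R ^+ b * u j / P + z ^+ b.-1 * S * T).
  apply: (mulfI z0); rewrite zvE GE xE exprMn TE exprVn.
  have uk0 := expf_neq0 b uk.
  transitivity (H / u k ^+ b * (R ^+ b * (P + M) / P + z ^+ b * S * T)).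
    by field; rewrite ?P0 ?uk0.
  by rewrite -zuj' zb; field; rewrite ?P0 ?uk0.
have uuk n : is_laurent u (u k ^+ n)^-1.
  by rewrite -[u k]monomialU -monomialM // -monomialN //; apply: is_laurent_monomial.
have ux : is_laurent u x.
  rewrite xE; apply: is_laurentM; first exact: (uuk 1%N).
  by apply: is_laurentD => //; apply: is_laurentM => //; apply: is_laurentX.
have uP : is_laurent u P^-1.
  by rewrite /P -monomialN //; apply: is_laurent_monomial.
have uv : is_laurent u v.
  rewrite vE; apply: is_laurentM; first by apply: is_laurentM.
  apply: is_laurentD; do ?apply: is_laurentM => //; try exact: is_laurentX.
  by rewrite -monomialU; apply: is_laurent_monomial.
split=> //; apply: laurent_coprimeM => //.
  have -> : x = monomial u (fun i => - (i == k)%:Z + (if i == j then 0 else (pos_part (B1 i k))%:Z))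
      + z * ((u k)^-1 * z ^+ b.-1 * S).
    by rewrite monomialD // monomialN // monomialU xE zb -/R; ring.
  apply: monomial_coprime => //; apply: is_laurentM => //; apply: is_laurentM.
    exact: (uuk 1%N).
  exact: is_laurentX.
have [b2|b2] := leqP 2 b.
  pose a i := (if i == k then 0 else (pos_part (- B2 i j))%:Z) - (i == k)%:Z * b%:Z
    + (if i == j then 0 else (pos_part (B1 i k))%:Z) * b%:Z + (i == j)%:Z - (pos_part (B i j))%:Z.
  have -> : v = monomial u a + z * (H / u k ^+ b * (z ^+ b.-2 * S * T)).
    rewrite /a !monomialD // !monomialN // !monomialM // !monomialU -/H -/R -/P vE.
    have -> : z ^+ b.-1 = z * z ^+ b.-2 by rewrite -exprS; case: (b) b2 => [|[]].
    by ring.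
  apply: monomial_coprime => //; do ?apply: is_laurentM => //; exact: is_laurentX.
have {}b1 : b = 1%N by lia.
have T1 : T = 1 by rewrite /T b1 big_ord_recl big_ord0 !expr0 mulr1 addr0.
pose d i := (if i == k then 0 else (pos_part (- B2 i j))%:Z) - (i == k)%:Z
    + (if i == j then 0 else (pos_part (- B1 i k))%:Z).
have -> : v = monomial u d * (1 + monomial u (fun i => B i k)).
  have -> : monomial u d = H / u k * S.
    by rewrite /d !monomialD // !monomialN // !monomialU.
  have S0 : S != 0 by apply: monomial_neq0.
  have -> : monomial u (fun i => B i k) = R * u j / (P * S).
    rewrite /R -[u j](monomialU u j) -monomialD // /P /S -monomialD // -monomialN // -monomialD //.
    apply: eq_monomial => i; have := pos_partB (B1 i k); have := pos_partB (B i j).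
    have [->|ij] := eqVneq i j; first by rewrite skew_diag // bE b1 /pos_part; lia.
    by rewrite B1ik // b1; lia.
  by rewrite vE T1 b1 /= !expr1 expr0; field; rewrite ?P0 ?S0.
have := @binomial_coprime u _ _ (fun i => (pos_part (- B i j))%:Z - (i == j)%:Z)
    d 0 lambda iu (is_laurent0 u) lj lk.
by rewrite mulr0 addr0 -cluster_mutation_monomial.
Qed.
End Step.
End LaurentRing.

(** * Full rank of exchange matrices *)

Section FullRank.
Variables (V : finType) (mutable : pred V).

Definition full_rank (B : V -> V -> int) := forall r : V -> int,
  (forall i, \sum_(v | mutable v) r v * B i v = 0) -> forall v, mutable v -> r v = 0.

(** A relation r between the mutated columns is pulled back to a relation [r'] for B that differs
    only in the coefficient at k. Row k supplies [rk], which removes the terms with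
    [pos_part (B i k)]. *)
Lemma full_rank_mutation k B : mutable k -> skew_symmetric B ->
  full_rank B -> full_rank (matrix_mutation k B).
Proof.
move=> mk sB fB r rB.
pose B' := matrix_mutation k B.
have Bkk : B k k = 0 by exact: skew_diag.
have rk : \sum_(v | mutable v && (v != k)) r v * B k v = 0.
  have := rB k; rewrite (bigD1 k) //= {1}/matrix_mutation eqxx Bkk oppr0 mulr0 add0r.
  under eq_bigr do rewrite /matrix_mutation eqxx mulrN.
  by rewrite sumrN => /eqP; rewrite oppr_eq0 => /eqP.
pose r' v := if v == k then \sum_(v | mutable v && (v != k)) r v * (pos_part (- B k v))%:Z - r k
  else r v.
have r'0 : forall v, mutable v -> r' v = 0.
  apply: fB => i; rewrite (bigD1 k) //= /r' eqxx.
  rewrite [X in _ + X](eq_bigr (fun v => r v * B i v)); last first.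
    by move=> v /andP[_ /negbTE vk]; rewrite vk.
  have [->|ik] := eqVneq i k; first by rewrite Bkk mulr0 add0r.
  have := rB i; rewrite (bigD1 k) //= {1}/matrix_mutation eqxx orbT.
  rewrite [X in _ + X](eq_bigr (fun v => (r v * B i v + (pos_part (B i k))%:Z * (r v * B k v))
     + B i k * (r v * (pos_part (- B k v))%:Z))) => [|v /andP[_ vk]].
    by rewrite !big_split /= -!mulr_sumr rk mulr0 addr0 => e; rewrite -[RHS]e; ring.
  rewrite /matrix_mutation (negbTE ik) (negbTE vk) /=.
  have := pos_partB (B i k); have := pos_partB (B k v).
  move: (pos_part _) (pos_part (- B k v)) (pos_part (B i k)) (pos_part (- B i k)).
  move=> a b c d <- <-; rewrite !PoszM; ring.
have rv v : mutable v -> v != k -> r v = 0.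
  by move=> mv vk; have := r'0 v mv; rewrite /r' (negbTE vk).
move=> v mv; have [->|] := eqVneq v k; last exact: rv.
have := r'0 k mk; rewrite /r' eqxx big1 => [|w /andP[mw wk]]; last by rewrite rv // mul0r.
by rewrite add0r => /eqP; rewrite oppr_eq0 => /eqP.
Qed.

Lemma full_rank_column B j : full_rank B -> mutable j -> exists i, B i j != 0.
Proof.
move=> fB mj; apply/existsP; apply: contraT => /existsPn B0.
have := fB (fun v => (v == j)%:Z) _ j mj; rewrite eqxx => h.
suff /h : forall i, \sum_(v | mutable v) (v == j)%:Z * B i v = 0 by [].
move=> i; rewrite (bigD1 j) //= eqxx big1 ?addr0 ?mul1r.
  by have := B0 i; rewrite negbK => /eqP.
by move=> v /andP[_ /negbTE ->]; rewrite mul0r.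
Qed.

(** Two independent columns have a nonzero 2x2 minor, in rows p and q. The functional supported on
    these rows kills column j and takes the value of the minor on column k. *)
Lemma full_rank_separation B j k : full_rank B -> mutable j -> mutable k -> j != k ->
  exists lambda : V -> int,
    \sum_i lambda i * B i j = 0 /\ \sum_i lambda i * B i k != 0.
Proof.
move=> fB mj mk jk; have [p Bpj] := full_rank_column fB mj.
have [q Dq] : exists q, B p j * B q k - B q j * B p k != 0.
  apply/existsP; apply: contraT => /existsPn D0.
  pose r v := if v == k then B p j else if v == j then - B p k else 0.
  have := fB r _ k mk; rewrite {2}/r eqxx => h.
  suff /h e : forall i, \sum_(v | mutable v) r v * B i v = 0 by rewrite e eqxx in Bpj.
  move=> i; rewrite (bigD1 k) //= (bigD1 j) /= ?mj ?jk // big1 ?addr0.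
    rewrite /r eqxx (negbTE jk) eqxx; have := D0 i; rewrite negbK => /eqP; lia.
  by move=> v /andP[/andP[_ /negbTE vk] /negbTE vj]; rewrite /r vk vj mul0r.
pose lam i := (i == q)%:Z * B p j - (i == p)%:Z * B q j.
have lamE v : \sum_i lam i * B i v = B p j * B q v - B q j * B p v.
  have one c (w : V) : \sum_i ((i == w)%:Z * c) * B i v = c * B w v.
    by rewrite (bigD1 w) //= eqxx mul1r big1 ?addr0 // => i /negbTE ->; rewrite !mul0r.
  by rewrite -!one -sumrB; apply: eq_bigr => i _; rewrite mulrBl.
by exists lam; rewrite !lamE; split=> //; rewrite mulrC subrr.
Qed.
End FullRank.

Lemma matrix_mutationN_fun (V : finType) k (B : V -> V -> int) :
  matrix_mutation k (fun i j => - B i j) = (fun i j => - matrix_mutation k B i j).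
Proof.
by do 2 apply: functional_extensionality => ?; apply: matrix_mutationN.
Qed.

Section Laurent.
Variables (F K : fieldType) (iota : {rmorphism F -> K}) (N : nat).
Implicit Types (u : 'I_N -> K) (B : 'I_N -> 'I_N -> int).

(** Negating B leaves the clusters unchanged, so a negative [B j k] reduces to a positive one. *)
Lemma laurent_step B u (j k : 'I_N) (lambda : 'I_N -> int) :
  let B1 := matrix_mutation j B in let B2 := matrix_mutation k B1 in
  let u1 := cluster_mutation j B u in let u2 := cluster_mutation k B1 u1 in
  let u3 := cluster_mutation j B2 u2 in
  skew_symmetric B -> alg_indep iota u -> j != k ->
  \sum_i lambda i * B i j = 0 -> \sum_i lambda i * B i k != 0 -> u1 j != 0 ->
  [/\ is_laurent iota u (u1 j), is_laurent iota u (u2 k), is_laurent iota u (u3 j)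
    & laurent_coprime iota u (u1 j) (u2 k * u3 j)].
Proof.
move=> B1 B2 u1 u2 u3 sB iu jk lj lk z0.
case: (ltgtP 0 (B j k)) => b; first exact: (laurent_step_pos sB iu jk lj lk z0).
  pose nB i j := - B i j.
  have sN : skew_symmetric nB by move=> i i'; rewrite /nB sB.
  have e1 : cluster_mutation j nB u = u1 by apply: cluster_mutationN.
  have e2 : cluster_mutation k (matrix_mutation j nB) u1 = u2.
    by apply: cluster_mutationN => i; apply: matrix_mutationN.
  have e3 : cluster_mutation j (matrix_mutation k (matrix_mutation j nB)) u2 = u3.
    by apply: cluster_mutationN => i; rewrite matrix_mutationN_fun; apply: matrix_mutationN.
  have sumN v : \sum_i lambda i * nB i v = - \sum_i lambda i * B i v.
    by rewrite -sumrN; apply: eq_bigr => i _; rewrite mulrN.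
  have := @laurent_step_pos _ _ iota _ nB u j k sN iu jk lambda.
  rewrite !sumN lj oppr0 oppr_eq0 e1 e2 e3; apply=> //.
  by rewrite /nB oppr_gt0.
exact: (laurent_step_zero sB iu jk lj lk z0).
Qed.

(* Following Fomin, Williams and Zelevinsky: on a path t0 -j- t1 -k- t2 -j- t3
   the variable at the end of the path is a Laurent polynomial in the clusters
   at t1 and at t3, and the new variable at t1 is coprime to those at t3. *)
Theorem laurent_phenomenon (mutable : pred 'I_N) (ks : seq 'I_N) B u i :
  all mutable ks -> skew_symmetric B -> full_rank mutable B -> alg_indep iota u ->
  is_laurent iota u (cluster_mutations ks B u i).
Proof.
have [n] := ubnP (size ks); elim: n ks B u => // n IHn ks B u.
have laurent_u u' j : alg_indep iota u' -> is_laurent iota u' (u' j).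
  by move=> iu'; rewrite -monomialU; apply: is_laurent_monomial => ?; apply: alg_indep_neq0 iu'.
case: ks => [|j [|k ks]] /= sz mks sB fB iu; first exact: laurent_u.
  have u0 l : u l != 0 by apply: alg_indep_neq0 iu.
  have [->|ij] := eqVneq i j.
    by rewrite cluster_mutation_monomial //; apply: is_laurent_binomial.
  by rewrite /cluster_mutation (negbTE ij); apply: laurent_u.
case/and3P: mks => mj mk mks.
pose B1 := matrix_mutation j B; pose B2 := matrix_mutation k B1.
pose B3 := matrix_mutation j B2.
pose u1 := cluster_mutation j B u; pose u2 := cluster_mutation k B1 u1.
pose u3 := cluster_mutation j B2 u2; rewrite -/B1 -/u1 -/B2 -/u2.
have sB1 : skew_symmetric B1 by apply: skew_mutation.
have sB2 : skew_symmetric B2 by apply: skew_mutation.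
have sB3 : skew_symmetric B3 by apply: skew_mutation.
have fB1 : full_rank mutable B1 by apply: full_rank_mutation.
have fB2 : full_rank mutable B2 by apply: full_rank_mutation.
have fB3 : full_rank mutable B3 by apply: full_rank_mutation.
have iu1 : alg_indep iota u1 by apply: alg_indep_mutation => //; apply: full_rank_column fB mj.
have iu2 : alg_indep iota u2 by apply: alg_indep_mutation => //; apply: full_rank_column fB1 mk.
have iu3 : alg_indep iota u3 by apply: alg_indep_mutation => //; apply: full_rank_column fB2 mj.
have back l B' w : skew_symmetric B' -> full_rank mutable B' -> alg_indep iota w -> mutable l ->
    matrix_mutation l (matrix_mutation l B') = B' /\
    cluster_mutation l (matrix_mutation l B') (cluster_mutation l B' w) = w.
  move=> sB' fB' iw ml; split.
    by do 2 apply: functional_extensionality => ?; apply: matrix_mutationK.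
  rewrite (@cluster_mutationN _ _ l B'); last first.
    by move=> i'; rewrite /matrix_mutation eqxx orbT.
  apply: cluster_mutationK; [exact: skew_diag|exact: alg_indep_neq0 iw|].
  rewrite -(ev_exchange_poly iota); apply/eqP => /iw/eqP; apply/negP.
  by apply: exchange_poly_neq0; apply: full_rank_column fB' ml.
(* Two equal consecutive mutations cancel, which shortens the path by two. *)
have [ejk|jk] := eqVneq j k.
  have [e1 e2] := back j B u sB fB iu mj.
  by rewrite /B2 /u2 -ejk e1 e2; apply: IHn => //; lia.
have [lam [lj lk]] := full_rank_separation fB mj mk jk.
set f := cluster_mutations ks B2 u2 i.
have f1 : is_laurent iota u1 f.
  by by apply: (IHn (k :: ks) B1 u1) => //=; rewrite mk.
(* From t3 one returns to t2 by mutating at j again, so f also ends the path [j :: ks], which is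
   shorter by one. *)
have f3 : is_laurent iota u3 f.
  have [e1 e2] := back j B2 u2 sB2 fB2 iu2 mj.
  have := IHn (j :: ks) B3 u3; by rewrite /= e1 e2 mj; apply.
have z0 : u1 j != 0 by apply: alg_indep_neq0 iu1.
have [uz ux uv cop] := laurent_step sB iu jk lj lk z0.
have u0 l : u l != 0 by apply: alg_indep_neq0 iu.
have uV l : is_laurent iota u (u l)^-1.
  by rewrite -(monomialU u l) -monomialN //; apply: is_laurent_monomial.
have u1E l : l != j -> u1 l = u l by rewrite /u1 /cluster_mutation => /negbTE ->.
have u3k : u3 k = u2 k by rewrite /u3 /cluster_mutation eq_sym (negbTE jk).
have u3E l : l != j -> l != k -> u3 l = u l.
  move=> lj' lk'; rewrite /u3 /cluster_mutation (negbTE lj').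
  by rewrite /u2 /cluster_mutation (negbTE lk') u1E.
(* Seen from t1, f has only powers of [u1 j] as further denominators; seen from t3, only powers of
   [u2 k * u3 j]. Their coprimality removes both. *)
have [] := @is_laurent_transfer _ _ iota _ u u1 (u1 j) f _ _ _ f1.
- by move=> l; have [->|/u1E ->] := eqVneq l j; last exact: laurent_u.
- by move=> l; apply: alg_indep_neq0 iu1.
- move=> l; have [->|/u1E ->] := eqVneq l j; first by rewrite divff //; apply: is_laurent1.
  exact: is_laurentM.
move=> m zf.
have v0 : u3 j != 0 by apply: alg_indep_neq0 iu3.
have x0 : u2 k != 0 by apply: alg_indep_neq0 iu2.
have [] := @is_laurent_transfer _ _ iota _ u u3 (u2 k * u3 j) f _ _ _ f3.
- move=> l; have [->|lj'] := eqVneq l j; first by [].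
  by have [->|/(u3E _ lj') ->] := eqVneq l k; [rewrite u3k|apply: laurent_u].
- by move=> l; apply: alg_indep_neq0 iu3.
- move=> l; have [->|lj'] := eqVneq l j; first by rewrite mulfK.
  have [->|/(u3E _ lj') ->] := eqVneq l k; first by rewrite u3k mulrAC divff // mul1r.
  by apply: is_laurentM => //; apply: is_laurentM.
move=> n' df; apply: laurent_coprime_descent z0 _ cop zf _ uz df.
  by rewrite mulf_neq0.
exact: is_laurentM.
Qed.
End Laurent.

(** * F-polynomials *)

Section Corner.
Variables (F : fieldType) (n : nat).
Implicit Types (P Q R : {mpoly F[n]}) (f g m : 'X_{1..n}).

(** Only the top parts of the two factors can reach weight d + e. *)
Lemma weight_partM lambda d e P Q :
  (forall m, m \in msupp P -> weight lambda m <= d) ->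
  (forall m, m \in msupp Q -> weight lambda m <= e) ->
  weight_part lambda (d + e) (P * Q) = weight_part lambda d P * weight_part lambda e Q.
Proof.
move=> Pd Qe.
have split R c : R = weight_part lambda c R + (R - weight_part lambda c R) by rewrite addrCA subrr addr0.
have low R c m : (forall m, m \in msupp R -> weight lambda m <= c) ->
    m \in msupp (R - weight_part lambda c R) -> weight lambda m < c.
  move=> Rc; rewrite mcoeff_msupp mcoeffB mcoeff_weight_part lt_neqAle.
  case: ifP => wm; first by rewrite subrr eqxx.
  by rewrite subr0 -mcoeff_msupp => /Rc.
have part R c m : m \in msupp (weight_part lambda c R) -> weight lambda m = c.
  by rewrite mcoeff_msupp mcoeff_weight_part; case: ifP => [/eqP //|_]; rewrite eqxx.
have zero R c : (forall m, m \in msupp R -> weight lambda m < c) -> weight_part lambda c R = 0.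
  move=> Rc; apply/mpolyP => m; rewrite mcoeff_weight_part mcoeff0.
  case: eqP => // wm; apply: memN_msupp_eq0; apply/negP => /Rc; by rewrite wm ltxx.
set P0 := weight_part _ d P; set Q0 := weight_part _ e Q.
have lowP := low P d; have lowQ := low Q e; have := split Q e; have := split P d.
move: lowP lowQ; rewrite -/P0 -/Q0; move: (P - P0) (Q - Q0) => P1 Q1 lowP lowQ {1}-> {1}->.
rewrite mulrDl !mulrDr !weight_partD.
have -> : weight_part lambda (d + e) (P0 * Q0) = P0 * Q0.
  apply/mpolyP => m; rewrite mcoeff_weight_part; case: eqP => // wm.
  apply/esym/memN_msupp_eq0/negP => /msuppM_le/allpairsP[[a b] /= [aP bQ e']].
  by apply: wm; rewrite e' weightD (part _ _ _ aP) (part _ _ _ bQ).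
rewrite -addrA -[RHS]addr0; congr (_ + _).
rewrite !zero ?addr0 // => m /msuppM_le/allpairsP[[a b] /= [aP bQ ->]]; rewrite weightD.
- by rewrite ltrD ?(lowP _ Pd aP) ?(lowQ _ Qe bQ).
- by rewrite (part _ _ _ bQ) ltrD2r (lowP _ Pd aP).
- by rewrite (part _ _ _ aP) ltrD2l (lowQ _ Qe bQ).
Qed.

Lemma max_weight lambda P : P != 0 ->
  exists2 m, m \in msupp P & forall m', m' \in msupp P -> weight lambda m' <= weight lambda m.
Proof.
rewrite -msupp_eq0; elim: (msupp P) => // m s IHs _.
case: (eqVneq s [::]) => [->|/IHs[m1 m1s min1]].
  by exists m; rewrite ?inE // => m'; rewrite inE => /eqP ->.
have [le|/ltW le] := leP (weight lambda m1) (weight lambda m).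
  exists m; rewrite ?inE ?eqxx // => m'; rewrite inE => /orP[/eqP -> //|/min1 h].
  exact: le_trans h le.
by exists m1; rewrite ?inE ?m1s ?orbT // => m'; rewrite inE => /orP[/eqP ->|/min1].
Qed.

(* There are no zero divisors, so the parts of greatest weight have a nonzero
   product. *)
Lemma msuppM_weight lambda P Q a b : a \in msupp P -> b \in msupp Q ->
  exists2 m, m \in msupp (P * Q) & weight lambda a + weight lambda b <= weight lambda m.
Proof.
move=> aP bQ.
have P0 : P != 0 by apply/eqP => e; rewrite e msupp0 in aP.
have Q0 : Q != 0 by apply/eqP => e; rewrite e msupp0 in bQ.
have [a' a'P maxP] := max_weight lambda P0; have [b' b'Q maxQ] := max_weight lambda Q0.
have : weight_part lambda (weight lambda a' + weight lambda b') (P * Q) != 0.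
  rewrite weight_partM // mulf_neq0 //.
    apply/eqP => /(congr1 (mcoeff a')); rewrite mcoeff_weight_part eqxx mcoeff0 => /eqP.
    by apply/negP; rewrite -mcoeff_msupp.
  apply/eqP => /(congr1 (mcoeff b')); rewrite mcoeff_weight_part eqxx mcoeff0 => /eqP.
  by apply/negP; rewrite -mcoeff_msupp.
case/(max_weight lambda) => m + _; rewrite mcoeff_msupp mcoeff_weight_part.
case: ifP => [/eqP wm mPQ|_]; last by rewrite eqxx.
by exists m; rewrite ?mcoeff_msupp // wm lerD ?maxP ?maxQ.
Qed.

Lemma weightU j m : weight (fun i => (i == j)%:Z) m = m j.
Proof. by rewrite /weight (bigD1 j) //= eqxx mul1r big1 ?addr0 // => i /negbTE ->; rewrite mul0r. Qed.

Lemma weightUN j m : weight (fun i => - (i == j)%:Z) m = - (m j)%:Z.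
Proof. by rewrite -weightU -sumrN; apply: eq_bigr => i _; rewrite mulNr. Qed.

Definition bounded P f := forall m, m \in msupp P -> (m <= f)%MM.

Definition cornered P f := bounded P f /\ P@_f = 1.

(** The exponent f + g is reached by the pair of corners alone, since any other pair is smaller in
    some coordinate. *)
Lemma mcoeffM_corner P Q f g : bounded P f -> bounded Q g ->
  (P * Q)@_(f + g)%MM = P@_f * Q@_g.
Proof.
move=> Pf Qg.
have bin : P = P@_f *: 'X_[f] + (P - P@_f *: 'X_[f]) by rewrite addrCA subrr addr0.
rewrite {1}bin mulrDl mcoeffD -scalerAl mcoeffZ ['X_[f] * Q]mulrC mcoeffMX.
rewrite -[RHS]addr0; congr (_ + _); apply: memN_msupp_eq0; apply/negP.
move=> /msuppM_le/allpairsP[[a b] /= [aP bQ e]].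
have {aP} : a \in msupp P /\ a != f.
  move: aP; rewrite !mcoeff_msupp mcoeffB mcoeffZ mcoeffX.
  by have [->|_] := eqVneq f a; rewrite ?mulr1 ?subrr ?eqxx // mulr0 subr0.
case=> /Pf/mnm_lepP aP /eqP; apply; apply/mnmP => i.
have := aP i; have /mnm_lepP/(_ i) := Qg _ bQ; have := congr1 (fun m : 'X_{1..n} => m i) e.
by rewrite /= !mnmDE; lia.
Qed.

Lemma bounded_le P f g : (f <= g)%MM -> bounded P f -> bounded P g.
Proof.
move=> /mnm_lepP fg Pf m /Pf/mnm_lepP mf; apply/mnm_lepP => i.
exact: leq_trans (mf i) (fg i).
Qed.

Lemma boundedM P Q f g : bounded P f -> bounded Q g -> bounded (P * Q) (f + g).
Proof.
move=> Pf Qg m /msuppM_le/allpairsP[[a b] /= [/Pf/mnm_lepP aP /Qg/mnm_lepP bQ ->]].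
by apply/mnm_lepP => i; rewrite !mnmDE leq_add.
Qed.

Lemma boundedD P Q f : bounded P f -> bounded Q f -> bounded (P + Q) f.
Proof.
by move=> Pf Qf m /msuppD_le; rewrite mem_cat => /orP[/Pf|/Qf].
Qed.

Lemma corneredM P Q f g : cornered P f -> cornered Q g -> cornered (P * Q) (f + g).
Proof.
case=> Pf P1 [Qg Q1]; split; first exact: boundedM.
by rewrite mcoeffM_corner // P1 Q1 mulr1.
Qed.

Lemma corneredX_monomial f : cornered 'X_[f] f.
Proof. by split=> [m|]; rewrite ?msuppX ?inE ?mcoeffX ?eqxx // => /eqP ->; rewrite lepm_refl. Qed.

Lemma cornered1 : cornered 1 0.
Proof. by rewrite -mpolyX0; apply: corneredX_monomial. Qed.

Lemma corneredX P f d : cornered P f -> cornered (P ^+ d) (f *+ d).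
Proof.
move=> Pf; elim: d => [|d IHd]; first by rewrite mulm0n expr0; apply: cornered1.
by rewrite exprS mulmS; apply: corneredM.
Qed.

Lemma cornered_prod (I : Type) (r : seq I) (P : I -> {mpoly F[n]}) (f : I -> 'X_{1..n}) :
  (forall i, cornered (P i) (f i)) ->
  cornered (\prod_(i <- r) P i) (\sum_(i <- r) f i)%MM.
Proof.
move=> Pf; elim: r => [|i r IHr]; first by rewrite !big_nil; apply: cornered1.
by rewrite !big_cons; apply: corneredM.
Qed.

(** Comparable corners let one of them dominate both supports; distinct ones keep the coefficient at
    1 instead of 2. *)
Lemma corneredD P Q f g : (g <= f)%MM -> g != f -> cornered P f -> cornered Q g ->
  cornered (P + Q) f.
Proof.
move=> gf ngf [Pf P1] [Qg _]; split; first by apply: boundedD => //; apply: bounded_le gf Qg.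
rewrite mcoeffD P1 memN_msupp_eq0 ?addr0 //; apply/negP => /Qg/mnm_lepP fg.
move/mnm_lepP: gf => gf.
by case/eqP: ngf; apply/mnmP => i; apply/eqP; rewrite eqn_leq gf fg.
Qed.

Lemma cornered_neq0 P f : cornered P f -> P != 0.
Proof.
by case=> _ P1; apply/eqP => P0; move/eqP: P1; rewrite P0 mcoeff0 eq_sym oner_eq0.
Qed.

(** Each coordinate of an exponent is a weight, so [msuppM_weight] forbids cancellation at the top
    and bounds the exponents of P by r - f. *)
Lemma cornered_factor P Q r f : cornered (P * Q) r -> cornered Q f ->
  (f <= r)%MM /\ cornered P (r - f)%MM.
Proof.
move=> PQ Qf; have PQ0 := cornered_neq0 PQ; case: PQ => PQr PQ1; case: (Qf) => Qb Q1.
have fQ : f \in msupp Q by rewrite mcoeff_msupp Q1 oner_neq0.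
have Pm m i : m \in msupp P -> (m i + f i <= r i)%N.
  move=> mP; have [m' /PQr/mnm_lepP/(_ i)] := msuppM_weight (fun l => (l == i)%:Z) mP fQ.
  by rewrite !weightU; lia.
have P0 : P != 0 by apply: contraNneq PQ0 => ->; rewrite mul0r.
have [m0 m0P _] := max_weight (fun=> 0) P0.
have fr : (f <= r)%MM.
  by apply/mnm_lepP => i; have := Pm _ i m0P; lia.
have Pb : bounded P (r - f)%MM.
  by move=> m mP; apply/mnm_lepP => i; rewrite mnmBE; have := Pm _ i mP; lia.
split=> //; split=> //.
by have := mcoeffM_corner Pb Qb; rewrite submK // PQ1 Q1 mulr1.
Qed.

(** No variable divides Q, whose constant term is 1. The lower bound on the exponents of P comes
    from [msuppM_weight] for the negated coordinates. *)
Lemma monomial_factor P Q R e : Q@_0 = 1 -> P * Q = 'X_[e] * R -> exists P', P = 'X_[e] * P'.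
Proof.
move=> Q1 PQ.
have Q0 : 0%MM \in msupp Q by rewrite mcoeff_msupp Q1 oner_neq0.
have Pe m : m \in msupp P -> (e <= m)%MM.
  move=> mP; apply/mnm_lepP => i.
  have [m' + le] := msuppM_weight (fun l => - (l == i)%:Z) mP Q0.
  rewrite PQ => /msuppM_le/allpairsP[[a b] /=]; rewrite msuppX inE => -[/eqP -> _ e'].
  by move: le; rewrite !weightUN e' mnmDE mnm0E; lia.
exists (\sum_(m <- msupp P) P@_m *: 'X_[m - e]).
rewrite [LHS]mpolyE mulr_sumr; apply: eq_big_seq => m mP.
by rewrite -scalerAr -mpolyXD addmC submK // Pe.
Qed.
End Corner.

Lemma pos_part_eq0 x : (pos_part x == 0%N) = (x <= 0).
Proof. by rewrite /pos_part; lia. Qed.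

Section SignCoherence.
Variables (L V : finType).
Implicit Types (B : V -> V -> int) (g : L -> V -> int).

(** The rule of [matrix_mutation] for an additional row [g l] of the matrix, as for c-vectors. *)
Definition tropical_mutation k B g (l : L) (v : V) : int :=
  if v == k then - g l k
  else g l v + (pos_part (g l k) * pos_part (B k v))%:Z
             - (pos_part (- g l k) * pos_part (- B k v))%:Z.

Definition column_coherent g k : Prop :=
  (forall l, 0 <= g l k) \/ (forall l, g l k <= 0).

Fixpoint sign_coherent (ks : seq V) B g : Prop :=
  if ks is k :: ks' then
    column_coherent g k /\
    sign_coherent ks' (matrix_mutation k B) (tropical_mutation k B g)
  else True.

Definition independent_columns (M : pred V) g := forall r : V -> int,
  (forall l, \sum_(v | M v) r v * g l v = 0) -> forall v, M v -> r v = 0.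

(** When column k has one sign, mutation adds fixed multiples of it to the other columns and negates
    it, an invertible column operation. *)
Lemma independent_columns_tropical (M : pred V) k B g : M k -> column_coherent g k ->
  independent_columns M g -> independent_columns M (tropical_mutation k B g).
Proof.
move=> Mk coh ig r rg.
have [c cE] : exists c : V -> int, forall l v, v != k ->
    tropical_mutation k B g l v = g l v + c v * g l k.
  case: coh => h; [exists (fun v => (pos_part (B k v))%:Z)|exists (fun v => (pos_part (- B k v))%:Z)];
    by move=> l v /negbTE vk; rewrite /tropical_mutation vk /pos_part; have := h l; nia.
pose r' v := if v == k then \sum_(v | M v && (v != k)) r v * c v - r k else r v.
have r'0 : forall v, M v -> r' v = 0.
  apply: ig => l; have := rg l; rewrite !(bigD1 k Mk) /= /r' eqxx {1}/tropical_mutation eqxx.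
  rewrite [X in _ + X = 0 -> _](eq_bigr (fun v => r v * g l v + r v * c v * g l k)); last first.
    by move=> v /andP[_ vk]; rewrite cE // mulrDr mulrA.
  rewrite [X in _ -> _ + X = 0](eq_bigr (fun v => r v * g l v)); last first.
    by move=> v /andP[_ /negbTE vk]; rewrite vk.
  by rewrite big_split -mulr_suml /= => e; rewrite -[RHS]e; ring.
have rv v : M v -> v != k -> r v = 0.
  by move=> mv vk; have := r'0 v mv; rewrite /r' (negbTE vk).
move=> v mv; have [->|] := eqVneq v k; last exact: rv.
have := r'0 k Mk; rewrite /r' eqxx big1 => [|w /andP[mw wk]]; last by rewrite rv // mul0r.
by rewrite add0r => /eqP; rewrite oppr_eq0 => /eqP.
Qed.

Lemma independent_columns_neq0 (M : pred V) k g : M k -> independent_columns M g ->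
  exists l, g l k != 0.
Proof.
move=> Mk ig; apply/existsP; apply: contraT => /existsPn g0.
have := ig (fun v => (v == k)%:Z) _ k Mk; rewrite eqxx => h.
suff /h : forall l, \sum_(v | M v) (v == k)%:Z * g l v = 0 by [].
move=> l; rewrite (bigD1 k) //= eqxx big1 ?addr0 ?mul1r.
  by have := g0 l; rewrite negbK => /eqP.
by move=> v /andP[_ /negbTE ->]; rewrite mul0r.
Qed.
End SignCoherence.

Section FPolynomials.
Variables (F : fieldType) (n : nat).
Local Notation V := ('I_n + 'I_n)%type.
Local Notation K := {fraction {mpoly F[n]}}.
Implicit Types (B : V -> V -> int) (u : V -> K) (k : 'I_n).
Implicit Types (P : 'I_n -> {mpoly F[n]}) (f : 'I_n -> 'X_{1..n}).

Definition is_mutable (v : V) : bool := if v is inl _ then true else false.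

(** Minus the exponent of y_l in the product of all variables with exponents [B _ v], each F_i being
    replaced by its leading monomial. [bottom_tropical] is the exponent itself when each F_i is
    replaced by its constant term 1. *)
Definition top_tropical B f (l : 'I_n) (v : V) : int :=
  - (B (inr l) v + \sum_i B (inl i) v * (f i l)%:Z).

Definition bottom_tropical B (l : 'I_n) (v : V) : int := B (inr l) v.

Definition fraction_laurent (x : K) :=
  exists (e : 'X_{1..n}) (p : {mpoly F[n]}), tofrac 'X_[e] * x = tofrac p.

Definition frozen_monomial B k : 'X_{1..n} := [multinom pos_part (B (inr j) (inl k)) | j < n].

Definition exchange_term B P k : {mpoly F[n]} :=
  'X_[frozen_monomial B k] * \prod_i P i ^+ pos_part (B (inl i) (inl k)).

Definition exchange_corner B f k : 'X_{1..n} :=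
  (frozen_monomial B k + \sum_i f i *+ pos_part (B (inl i) (inl k)))%MM.

Lemma exchange_sum_fraction B u P k :
  (forall i, u (inl i) = tofrac (P i)) -> (forall j, u (inr j) = tofrac 'X_j) ->
  exchange_sum (inl k) B u =
  tofrac (exchange_term B P k + exchange_term (fun i j => - B i j) P k).
Proof.
move=> uP uX; rewrite /exchange_sum !big_sumType /= rmorphD /=.
rewrite /exchange_term !rmorphM /= mpolyXE_id mpolyXE_id !rmorph_prod /=.
congr (_ + _); rewrite mulrC; congr (_ * _); apply: eq_bigr => i _;
  by rewrite ?uP ?uX ?mnmE rmorphXn.
Qed.

Lemma cornered_exchange_term B P f k : (forall i, cornered (P i) (f i)) ->
  cornered (exchange_term B P k) (exchange_corner B f k).
Proof.
move=> Pf; apply: corneredM; first exact: corneredX_monomial.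
by apply: cornered_prod => i; apply: corneredX.
Qed.

Lemma mcoeff0M (p q : {mpoly F[n]}) : (p * q)@_0 = p@_0 * q@_0.
Proof. exact: (rmorphM (mcoeff 0%MM)). Qed.

Lemma mcoeff0_exchange_term B P k : (forall i, (P i)@_0 = 1) ->
  (exchange_term B P k)@_0 = (frozen_monomial B k == 0%MM)%:R.
Proof.
move=> P1; rewrite mcoeff0M mcoeffX.
suff -> : (\prod_i P i ^+ pos_part (B (inl i) (inl k)))@_0 = 1 by rewrite mulr1.
elim/big_ind: _ => [|p q p1 q1|i _]; first by rewrite mcoeff1 eqxx.
  by rewrite mcoeff0M p1 q1 mulr1.
elim: (pos_part _) => [|d IHd]; first by rewrite expr0 mcoeff1 eqxx.
by rewrite exprS mcoeff0M P1 IHd mulr1.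
Qed.

Lemma exchange_cornerE B f k j :
  (exchange_corner B f k j = pos_part (B (inr j) (inl k))
     + \sum_i pos_part (B (inl i) (inl k)) * f i j)%N.
Proof.
rewrite mnmDE mnmE mnm_sumE; congr addn; apply: eq_bigr => i _.
by rewrite mulmnE mulnC.
Qed.

Lemma exchange_cornerB B f k j :
  (exchange_corner B f k j)%:Z - (exchange_corner (fun i j => - B i j) f k j)%:Z =
  - top_tropical B f j (inl k).
Proof.
rewrite !exchange_cornerE /top_tropical opprK !PoszD.
rewrite -!natz !natr_sum opprD addrACA -sumrB; congr (_ + _).
  by rewrite !natz pos_partB.
by apply: eq_bigr => i _; rewrite !natz !PoszM -mulrBl pos_partB.
Qed.

Lemma bottom_tropical_mutation B k :
  bottom_tropical (matrix_mutation (inl k) B) = tropical_mutation (inl k) B (bottom_tropical B).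
Proof.
apply: functional_extensionality => l; apply: functional_extensionality => v.
by rewrite /bottom_tropical /tropical_mutation /matrix_mutation; have [->|_] := eqVneq v (inl k).
Qed.

(** Leading exponents obey the max-plus form of the exchange relation. By [exchange_cornerB] the
    entry at k is the difference of the two corners, so its positive parts are their distances to
    the maximum D. *)
Lemma top_tropical_mutation B f (f' : 'I_n -> 'X_{1..n}) D k : skew_symmetric B ->
  (forall l, (D l)%:Z = Num.max (exchange_corner B f k l)%:Z
                          (exchange_corner (fun i j => - B i j) f k l)%:Z) ->
  (forall l, (f' k l)%:Z = (D l)%:Z - (f k l)%:Z) -> (forall i, i != k -> f' i = f i) ->
  top_tropical (matrix_mutation (inl k) B) f' = tropical_mutation (inl k) B (top_tropical B f).
Proof.
move=> sB DE fk fi; apply: functional_extensionality => l; apply: functional_extensionality => v.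
have Bkk : B (inl k) (inl k) = 0 by exact: skew_diag.
have sumE (h h' : 'I_n -> int) : (forall i, i != k -> h i = h' i) ->
    \sum_i h i = h k - h' k + \sum_i h' i.
  move=> hh'; rewrite (bigD1 k) //= [in RHS](bigD1 k) //= (eq_bigr h') //; lia.
rewrite /tropical_mutation; have [->|vk] := eqVneq v (inl k).
  rewrite /top_tropical {1}/matrix_mutation eqxx orbT opprK opprD opprK.
  rewrite (sumE _ (fun i => - B (inl i) (inl k) * (f i l)%:Z)); last first.
    by move=> i /fi ->; rewrite /matrix_mutation eqxx orbT.
  rewrite /matrix_mutation eqxx orbT Bkk; under eq_bigr do rewrite mulNr.
  by rewrite sumrN oppr0 !mul0r subrr sub0r opprK.
have Bv x : x != inl k -> matrix_mutation (inl k) B x v =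
    B x v + (pos_part (B x (inl k)))%:Z * (pos_part (B (inl k) v))%:Z
      - (pos_part (- B x (inl k)))%:Z * (pos_part (- B (inl k) v))%:Z.
  by move=> /negbTE xk; rewrite /matrix_mutation xk (negbTE vk) /= !PoszM.
have Bkv : matrix_mutation (inl k) B (inl k) v = - B (inl k) v.
  by rewrite /matrix_mutation eqxx.
have := exchange_cornerB B f k l; have := DE l.
have TE : top_tropical (matrix_mutation (inl k) B) f' l v = top_tropical B f l v
   - (pos_part (B (inl k) v))%:Z * (exchange_corner B f k l)%:Z
   + (pos_part (- B (inl k) v))%:Z * (exchange_corner (fun i j => - B i j) f k l)%:Z
   + B (inl k) v * (D l)%:Z.
  rewrite /top_tropical Bv //.
  rewrite (sumE _ (fun i => B (inl i) v * (f i l)%:Z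
     + (pos_part (B (inl k) v))%:Z * ((pos_part (B (inl i) (inl k)))%:Z * (f i l)%:Z)
     - (pos_part (- B (inl k) v))%:Z * ((pos_part (- B (inl i) (inl k)))%:Z * (f i l)%:Z))); last first.
    move=> i ik; rewrite fi // Bv; last by apply: contra_neq ik => -[].
    by ring.
  rewrite Bkv fk Bkk /= !exchange_cornerE !PoszD !sumrB !big_split /= -!mulr_sumr.
  have nE (B' : V -> V -> int) : (\sum_i pos_part (B' (inl i) (inl k)) * f i l)%N%:Z =
      \sum_i (pos_part (B' (inl i) (inl k)))%:Z * (f i l)%:Z.
    by rewrite -!natz natr_sum; apply: eq_bigr => i _; rewrite !natz PoszM.
  have p0 : pos_part 0 = 0%N by [].
  rewrite !(nE B) (nE (fun i j => - B i j)) oppr0 p0; ring.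
rewrite TE PoszM PoszM => {TE} DlE dE.
move: (top_tropical B f l (inl k)) (top_tropical B f l v) (B (inl k) v) dE DlE => g t b.
move: (exchange_corner B f k l) (exchange_corner (fun i j => - B i j) f k l) (D l) => s s' d.
(* For either sign of b only one exchange corner remains; d minus that corner is the positive part
   of g or of -g. *)
have [b0|b0] := leP 0 b.
  have -> : pos_part (- b) = 0%N by rewrite /pos_part; lia.
  have -> : (pos_part b)%:Z = b by rewrite /pos_part; lia.
  move=> gE dE; rewrite mulr0 mul0r subr0 addr0 -addrA; congr (_ + _).
  have -> : (pos_part g)%:Z = - s%:Z + d%:Z by rewrite /pos_part; lia.
  by ring.
have -> : (pos_part b)%:Z = 0 by rewrite /pos_part; lia.
have -> : (pos_part (- b))%:Z = - b by rewrite /pos_part; lia.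
move=> gE dE; have -> : (pos_part (- g))%:Z = d%:Z - s'%:Z by rewrite /pos_part; lia.
by ring.
Qed.

(** The Laurent property makes the division in the exchange relation exact. The bottom column at k
    then governs the constant term, and the top column the leading monomial. *)
Lemma F_polynomial_step B u P f k : skew_symmetric B ->
  (forall i, u (inl i) = tofrac (P i)) -> (forall j, u (inr j) = tofrac 'X_j) ->
  (forall i, (P i)@_0 = 1) -> (forall i, cornered (P i) (f i)) ->
  column_coherent (bottom_tropical B) (inl k) -> (exists l, bottom_tropical B l (inl k) != 0) ->
  column_coherent (top_tropical B f) (inl k) -> (exists l, top_tropical B f l (inl k) != 0) ->
  fraction_laurent (cluster_mutation (inl k) B u (inl k)) ->
  exists P' (f' : 'I_n -> 'X_{1..n}),
    [/\ forall i, cluster_mutation (inl k) B u (inl i) = tofrac (P' i),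
        forall i, (P' i)@_0 = 1, forall i, cornered (P' i) (f' i)
      & top_tropical (matrix_mutation (inl k) B) f' = tropical_mutation (inl k) B (top_tropical B f)].
Proof.
move=> sB uP uX P1 Pf bcoh [l0 bl0] tcoh [l1 tl1] [e [G GE]].
pose Bn i j := - B i j.
pose R := exchange_term B P k + exchange_term Bn P k.
have Pk0 : tofrac (P k) != 0 by rewrite tofrac_eq0; apply: cornered_neq0 (Pf k).
have ukE : tofrac (P k) * cluster_mutation (inl k) B u (inl k) = tofrac R.
  by rewrite /cluster_mutation eqxx uP mulVKf // (@exchange_sum_fraction B u P k uP uX).
have GP : G * P k = 'X_[e] * R.
  by apply/eqP; rewrite -tofrac_eq !rmorphM /= -GE -ukE; apply/eqP; ring.
(* The monomial denominator cancels because [P k] has constant term 1. *)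
have [p pE] := monomial_factor (P1 k) GP.
have X0 : tofrac 'X_[e] != 0 :> K by rewrite tofrac_eq0 -msupp_eq0 msuppX.
have up : cluster_mutation (inl k) B u (inl k) = tofrac p.
  by apply: (mulfI X0); rewrite GE pE rmorphM.
have pP : p * P k = R.
  by apply/eqP; rewrite -tofrac_eq -ukE up rmorphM mulrC.
(* The bottom column at k is nonzero and of one sign, so exactly one of the two frozen monomials is
   1. *)
have R1 : R@_0 = 1.
  rewrite mcoeffD !mcoeff0_exchange_term //.
  have z B' : (frozen_monomial B' k == 0%MM) = [forall j, pos_part (B' (inr j) (inl k)) == 0%N].
    apply/eqP/forallP => [/mnmP h j|h]; first by have := h j; rewrite mnmE mnm0E => ->.
    by apply/mnmP => j; rewrite mnmE mnm0E; apply/eqP.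
  have : (frozen_monomial B k == 0%MM) != (frozen_monomial Bn k == 0%MM).
    rewrite !z; case: bcoh => h.
      have -> : [forall j, pos_part (Bn (inr j) (inl k)) == 0%N].
        by apply/forallP => j; rewrite pos_part_eq0 oppr_le0; exact: h.
      rewrite eqb_id; apply/forallPn; exists l0.
      by rewrite pos_part_eq0 -ltNge lt_neqAle eq_sym bl0; exact: h.
    have -> : [forall j, pos_part (B (inr j) (inl k)) == 0%N].
      by apply/forallP => j; rewrite pos_part_eq0; exact: h.
    rewrite eq_sym eqb_id; apply/forallPn; exists l0.
    by rewrite pos_part_eq0 -ltNge oppr_gt0 lt_neqAle bl0; exact: h.
  by do 2 case: (_ == 0%MM) => //; rewrite /= ?addr0 ?add0r.
pose s := exchange_corner B f k; pose s' := exchange_corner Bn f k.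
have cs := cornered_exchange_term B k Pf; have cs' := cornered_exchange_term Bn k Pf.
have dif l : (s l)%:Z - (s' l)%:Z = - top_tropical B f l (inl k) by exact: exchange_cornerB.
have nss' : s != s'.
  by apply: contra_neq tl1 => e'; have := dif l1; rewrite e'; lia.
(* A top column of one sign makes one exchange corner dominate the other in every coordinate. *)
have [D RD DE] : exists2 D, cornered R D & forall l, (D l)%:Z = Num.max (s l)%:Z (s' l)%:Z.
  case: tcoh => h.
    have le l : (s l)%:Z <= (s' l)%:Z by rewrite -subr_le0 dif oppr_le0; exact: h.
    exists s'; last by move=> l; rewrite max_r.
    by rewrite /R addrC; apply: corneredD cs' cs => //; apply/mnm_lepP.
  have le l : (s' l)%:Z <= (s l)%:Z by rewrite -subr_ge0 dif oppr_ge0; exact: h.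
  exists s; last by move=> l; rewrite max_l.
  by rewrite /R; apply: corneredD cs cs'; [apply/mnm_lepP|rewrite eq_sym].
have [fD pc] : (f k <= D)%MM /\ cornered p (D - f k)%MM.
  by apply: cornered_factor (Pf k); rewrite pP.
exists (fun i => if i == k then p else P i), (fun i => if i == k then (D - f k)%MM else f i).
split=> [i|i|i|].
- have [->|ik] := eqVneq i k; first by rewrite up.
  by rewrite /cluster_mutation -uP; case: eqP => // -[/eqP]; rewrite (negbTE ik).
- case: eqP => // _; have := congr1 (mcoeff 0%MM) pP.
  by rewrite mcoeff0M P1 R1 mulr1.
- by case: eqP.
apply: (top_tropical_mutation (D := D)) => // [l|i /negbTE -> //].
rewrite eqxx mnmBE; move/mnm_lepP: fD => /(_ l); lia.
Qed.

Lemma F_polynomials ks B u P f : skew_symmetric B ->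
  (forall i, u (inl i) = tofrac (P i)) -> (forall j, u (inr j) = tofrac 'X_j) ->
  (forall i, (P i)@_0 = 1) -> (forall i, cornered (P i) (f i)) ->
  independent_columns is_mutable (bottom_tropical B) ->
  independent_columns is_mutable (top_tropical B f) ->
  sign_coherent (map inl ks) B (bottom_tropical B) ->
  sign_coherent (map inl ks) B (top_tropical B f) ->
  (forall s i, fraction_laurent (cluster_mutations (map inl (take s ks)) B u (inl i))) ->
  forall i, exists p (e : 'X_{1..n}),
    cluster_mutations (map inl ks) B u (inl i) = tofrac p /\ cornered p e.
Proof.
elim: ks B u P f => [|k ks IHks] B u P f sB uP uX P1 Pf ib it /=.
  by move=> _ _ _ i; exists (P i), (f i); rewrite uP.
case=> bk bks [tk tks] lau.
have lk : fraction_laurent (cluster_mutation (inl k) B u (inl k)).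
  by have := lau 1%N k; rewrite /= take0.
have [P' [f' [uP' P'1 P'f' tE]]] := F_polynomial_step sB uP uX P1 Pf bk
  (independent_columns_neq0 (M := is_mutable) (k := inl k) isT ib) tk (independent_columns_neq0 (M := is_mutable) (k := inl k) isT it) lk.
apply: (IHks _ _ P' f') => //.
- exact: skew_mutation.
- by rewrite bottom_tropical_mutation; apply: independent_columns_tropical.
- by rewrite tE; apply: independent_columns_tropical.
- by rewrite bottom_tropical_mutation.
- by rewrite tE.
- by move=> s; have := lau s.+1.
Qed.
End FPolynomials.

(** * Seeds, the framed quiver and specialization *)

Lemma eq_cluster_mutations (V : finType) (K : fieldType) ks (B B' : V -> V -> int) (u : V -> K) :
  (forall i j, B i j = B' i j) -> cluster_mutations ks B u = cluster_mutations ks B' u.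
Proof.
by move=> BB'; congr cluster_mutations; do 2 apply: functional_extensionality => ?.
Qed.

Lemma seed_mutations_cluster (V : finType) (K : fieldType) ks (Q : quiver V) (u : V -> K) :
  loop_free Q -> two_cycle_free Q ->
  seed_var (seed_mutations ks (Seed Q u)) = cluster_mutations ks (exchange_matrix Q) u.
Proof.
elim: ks Q u => //= k ks IHks Q u lf tf.
rewrite IHks; [|exact: mutation_loop_free|exact: mutation_two_cycle_free].
rewrite (@eq_cluster_mutations _ _ _ _ (matrix_mutation k (exchange_matrix Q))); last first.
  by move=> i j; apply: exchange_matrix_mutation.
congr cluster_mutations; apply: functional_extensionality => j.
rewrite /cluster_mutation; case: eqP => // _; congr (_ * (_ + _));
  by apply: eq_bigr => i _; rewrite num_arrows_pos_part // exchange_matrixN.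
Qed.

(** Links the Laurent phenomenon, stated for vertices in ['I_N], to the vertex set ['I_n + 'I_n] of
    the framed quiver. *)
Lemma cluster_mutations_reindex (V V' : finType) (K : fieldType) (h : V' -> V) (g : V -> V')
    ks (B : V -> V -> int) (u : V -> K) : cancel h g -> cancel g h -> forall i,
  cluster_mutations (map g ks) (fun i j => B (h i) (h j)) (fun i => u (h i)) (g i) =
  cluster_mutations ks B u i.
Proof.
move=> hK gK; elim: ks B u => [|k ks IHks] B u i /=; first by rewrite gK.
rewrite -IHks; congr (cluster_mutations _ _ _ (g i)).
  do 2 apply: functional_extensionality => ?; rewrite /matrix_mutation gK.
  by rewrite -!(can2_eq hK gK).
apply: functional_extensionality => j; rewrite /cluster_mutation (can2_eq hK gK).
case: eqP => // _; rewrite gK; congr (_ * (_ + _)); rewrite [RHS](reindex h) ?gK //;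
  by exists g => ? _; [apply: hK|apply: gK].
Qed.

Section FramedQuiver.
Variables (n : nat) (Q : quiver 'I_n).
Hypotheses (lf : loop_free Q) (tf : two_cycle_free Q).
Local Notation Qpf := (framed_quiver Q).

Lemma framed_loop_free : loop_free Qpf.
Proof. by case=> [a|i] //= [/lf]. Qed.

Lemma framed_two_cycle_free : two_cycle_free Qpf.
Proof. by case=> [a|i] [b|j] //= [] // [? ] [?]; apply: (tf (a := a) (b := b)). Qed.

Lemma exchange_matrix_framing l v :
  exchange_matrix Qpf (inr l) v = (v == inl l)%:Z.
Proof.
rewrite /exchange_matrix (_ : num_arrows _ v _ = 0%N); last first.
  by rewrite num_arrowsE big1 // => -[a|i] _ /=; rewrite andbF.
rewrite subr0 num_arrowsE big_sumType /= big1 // add0n (bigD1 l) //= big1.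
  by rewrite addn0 eqxx eq_sym.
by move=> i /negbTE il; rewrite -[inr i == inr l]/(i == l) il.
Qed.
End FramedQuiver.

Section Specialization.
Variable n : nat.
Local Notation A := {mpoly rat[n + n]}.
Local Notation A' := {mpoly rat[n]}.
Implicit Types (p q : A) (x : {fraction A}) (y : {fraction A'}).

Let sp : A -> A' := comp_mpoly [tuple match split v with inl _ => 1 | inr j => 'X_j end | v < n + n].

Let spD p q : sp (p + q) = sp p + sp q. Proof. exact: rmorphD. Qed.
Let spM p q : sp (p * q) = sp p * sp q. Proof. exact: rmorphM. Qed.
Let sp1 : sp 1 = 1. Proof. exact: rmorph1. Qed.

Lemma meval_specialize p : (sp p).@[fun=> 1] = p.@[fun=> 1].
Proof.
rewrite comp_mpoly_meval; apply: meval_eq => v; rewrite tnth_mktuple.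
by case: (split v) => j; rewrite ?meval1 ?mevalXU.
Qed.

(* Evaluation at (1, ..., 1) certifies that the denominators occurring in
   subtraction-free expressions do not vanish. *)
Definition specializes x y := exists p q,
  [/\ 0 < p.@[fun=> 1], 0 < q.@[fun=> 1], x = tofrac p / tofrac q
    & y = tofrac (sp p) / tofrac (sp q)].

Lemma specialize_neq0 p : 0 < p.@[fun=> 1] -> sp p != 0.
Proof. by rewrite -meval_specialize; apply: contraTneq => ->; rewrite meval0 ltxx. Qed.

Let pos_neq0 p : 0 < p.@[fun=> 1] -> p != 0.
Proof. by apply: contraTneq => ->; rewrite meval0 ltxx. Qed.

Lemma specializes_poly p : 0 < p.@[fun=> 1] -> specializes (tofrac p) (tofrac (sp p)).
Proof.
by exists p, 1; rewrite meval1 sp1 !tofrac1 !divr1.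
Qed.

Lemma specializesD x x' y y' : specializes x y -> specializes x' y' ->
  specializes (x + x') (y + y').
Proof.
case=> p [q [p0 q0 -> ->]] [p' [q' [p'0 q'0 -> ->]]].
exists (p * q' + p' * q), (q * q'); split.
- by rewrite mevalD !mevalM addr_gt0 ?mulr_gt0.
- by rewrite mevalM mulr_gt0.
- by rewrite tofracD !tofracM addf_div ?tofrac_eq0 ?pos_neq0.
by rewrite spD !spM tofracD !tofracM addf_div ?tofrac_eq0 ?specialize_neq0.
Qed.

Lemma specializesM x x' y y' : specializes x y -> specializes x' y' ->
  specializes (x * x') (y * y').
Proof.
case=> p [q [p0 q0 -> ->]] [p' [q' [p'0 q'0 -> ->]]].
exists (p * p'), (q * q'); rewrite !mevalM !mulr_gt0 //; split=> //.
  by rewrite !tofracM mulf_div.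
by rewrite !spM !tofracM mulf_div.
Qed.

Lemma specializesV x y : specializes x y -> specializes x^-1 y^-1.
Proof. by case=> p [q [p0 q0 -> ->]]; exists q, p; rewrite !invf_div. Qed.

Lemma specializesX x y d : specializes x y -> specializes (x ^+ d) (y ^+ d).
Proof.
move=> xy; elim: d => [|d IHd]; last by rewrite !exprS; apply: specializesM.
by have := @specializes_poly 1; rewrite sp1 meval1 !tofrac1; apply.
Qed.

Lemma specializes_cluster (V : finType) ks (B : V -> V -> int) u u' :
  (forall i, specializes (u i) (u' i)) ->
  forall i, specializes (cluster_mutations ks B u i) (cluster_mutations ks B u' i).
Proof.
elim: ks B u u' => //= k ks IHks B u u' uu'; apply: IHks => i.
rewrite /cluster_mutation; case: eqP => // _; apply: specializesM; first exact: specializesV.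
have one : specializes 1 1.
  by have := @specializes_poly 1; rewrite sp1 meval1 !tofrac1; apply.
by apply: specializesD; apply: (big_rec2 specializes) => // j x y _; apply: specializesM;
  apply: specializesX.
Qed.

(** The variables X_j in the denominator specialize to 1, so only its frozen exponents survive. *)
Lemma specializes_laurent x y p m : specializes x y ->
  tofrac 'X_[m] * x = tofrac p -> fraction_laurent y.
Proof.
case=> a [b [a0 b0 -> ->]] e.
exists [multinom m (rshift n j) | j < n], (sp p).
have -> : 'X_[[multinom m (rshift n j) | j < n]] = sp 'X_[m].
  rewrite /sp comp_mpolyX big_split_ord /= mpolyXE_id [X in _ = X * _]big1 ?mul1r; last first.
    by move=> i _; rewrite tnth_mktuple -[lshift n i]/(unsplit (inl i)) unsplitK expr1n.
  apply: eq_bigr => j _.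
  by rewrite mnmE tnth_mktuple -[rshift n j]/(unsplit (inr j)) unsplitK.
have b0' : tofrac b != 0 :> {fraction A} by rewrite tofrac_eq0 pos_neq0.
have : 'X_[m] * a = p * b.
  by apply/eqP; rewrite -tofrac_eq !tofracM -e -mulrA divfK.
move/(congr1 sp); rewrite !spM => /(congr1 (@tofrac _)).
rewrite !tofracM mulrA => ->; rewrite mulfK // tofrac_eq0; exact: specialize_neq0.
Qed.
End Specialization.

(** Clusters are computed in two fields: with initial variables X, which are independent, so that
    the Laurent phenomenon applies, and with initial variables [u0], where the exchange relations
    are those of the F-polynomials. [specializes] connects the two. *)
Theorem corner_of_sign_coherent (n : nat) (Q : quiver 'I_n) (ks : seq 'I_n) :
  loop_free Q -> two_cycle_free Q ->
  let B := exchange_matrix (framed_quiver Q) in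
  sign_coherent (map inl ks) B (fun l v => (v == inl l :> 'I_n + 'I_n)%:Z) ->
  sign_coherent (map inl ks) B (fun l v => - (v == inl l :> 'I_n + 'I_n)%:Z) ->
  forall i, exists2 F : {mpoly rat[n]}, is_F_polynomial Q ks i F &
    exists m : 'X_{1..n},
      [/\ m \in msupp F,
          forall m' : 'X_{1..n},
            m' \in msupp F -> m' <> m -> (mdeg m' < mdeg m)%N,
          F@_m = 1
        & forall m' : 'X_{1..n}, m' \in msupp F -> (m' <= m)%MM].
Proof.
move=> lf tf B cb ct.
pose u0 (v : 'I_n + 'I_n) : {fraction {mpoly rat[n]}} := match v with inl _ => 1 | inr j => tofrac 'X_j end.
pose X := @initial_var n.
have sB : skew_symmetric B by move=> i j; apply: exchange_matrixN.
have BE l v : B (inr l) v = (v == inl l)%:Z by exact: exchange_matrix_framing.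
have bE : bottom_tropical B = (fun l v => (v == inl l)%:Z).
  by do 2 apply: functional_extensionality => ?; apply: BE.
have tE : top_tropical B (fun=> 0%MM) = (fun l v => - (v == inl l)%:Z).
  apply: functional_extensionality => l; apply: functional_extensionality => v.
  by rewrite /top_tropical BE big1 ?addr0 // => i _; rewrite mnm0E mulr0.
have sumU r (l : 'I_n) : \sum_(v : 'I_n + 'I_n | is_mutable v) r v * (v == inl l)%:Z = r (inl l) :> int.
  rewrite (bigD1 (inl l)) //= eqxx mulr1 big1 ?addr0 //.
  by move=> v /andP[_ /negbTE ->]; rewrite mulr0.
have fullB : full_rank (@is_mutable n) B.
  move=> r rB [v|//] _; rewrite -(sumU r v) -[RHS](rB (inr v)).
  by apply: eq_bigr => w _; rewrite BE.
have Xsp v : specializes (X v) (u0 v).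
  rewrite /X /initial_var; have := @specializes_poly n 'X_(unsplit v).
  rewrite mevalXU ltr01 comp_mpolyXU -tnth_nth tnth_mktuple unsplitK => /(_ isT).
  by case: v => //= _; rewrite rmorph1.
have FZE ks' i : cluster_mutations (map inl ks') B X (inl i) = FZ_pf Q ks' i.
  rewrite /FZ_pf seed_mutations_cluster //; [exact: framed_loop_free|exact: framed_two_cycle_free].
have sp ks' i := specializes_cluster (map inl ks') B Xsp (inl i).
have lau ks' i : fraction_laurent (cluster_mutations (map inl ks') B u0 (inl i)).
  have := sp ks' i; rewrite -(cluster_mutations_reindex _ _ _ (@splitK n n) (@unsplitK n n)).
  set B' := fun _ _ => _; set X' := fun _ => _.
  have [||||p [m e]] := @laurent_phenomenon _ _ (const_embedding rat (n + n)) (n + n)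
    (fun v => is_mutable (split v)) (map (@unsplit n n) (map inl ks')) B' X' (unsplit (inl i)).
  - by rewrite -map_comp all_map; apply/allP => k _; rewrite /= -[lshift n k]/(unsplit (inl k)) unsplitK.
  - by move=> v w; apply: sB.
  - move=> r rB v mv; rewrite -(splitK v).
    apply: (fullB (fun v => r (unsplit v))) => // w.
    rewrite -[RHS](rB (unsplit w)) [RHS](reindex (@unsplit n n)) /=; last first.
      by exists (@split n n) => ? _; [apply: unsplitK|apply: splitK].
    by apply: eq_big => [x|x _]; rewrite /B' ?unsplitK.
  - rewrite (_ : X' = @generic_point rat (n + n)); first exact: generic_indep.
    by apply: functional_extensionality => v; rewrite /X' /X /initial_var splitK.
  move=> h; apply: (specializes_laurent (p := p) (m := m) h).
  rewrite -[RHS]ev_generic -ev_generic.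
  rewrite (_ : X' = @generic_point rat (n + n)) in e *; first exact: e.
  by apply: functional_extensionality => v; rewrite /X' /X /initial_var splitK.
move=> i.
have [|||||||||F [m [FE [Fb F1]]]] := @F_polynomials rat n ks B u0 (fun=> 1) (fun=> 0%MM) sB _ _ _ _ _ _ _ _ _ i.
- by move=> j; rewrite rmorph1.
- by [].
- by move=> j; rewrite mcoeff1 eqxx.
- by move=> j; apply: cornered1.
- by rewrite bE => r rg [v|//] _; have := rg v; rewrite sumU.
- rewrite tE => r rg [v|//] _; have := rg v.
  under eq_bigr do rewrite mulrN.
  by rewrite sumrN sumU => /eqP; rewrite oppr_eq0 => /eqP.
- by rewrite bE.
- by rewrite tE.
- by move=> s j; apply: lau.
exists F.
  have [p [q [p0 q0 e1 e2]]] := sp ks i.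
  exists p, q; split; [by rewrite -FZE e1|exact: specialize_neq0|].
  apply/eqP; rewrite -tofrac_eq rmorphM /= -FE e2 divfK // tofrac_eq0.
  exact: specialize_neq0.
exists m; split=> //; first by rewrite mcoeff_msupp F1 oner_neq0.
(* An exponent below m with the same total degree equals m. *)
move=> m' m'F ne; have /mnm_lepP le := Fb _ m'F.
rewrite ltn_neqAle !mdegE leq_sum ?andbT => [|j _]; last exact: le.
apply: contra_not_neq ne => /eqP e; apply/mnmP => j; apply/eqP; rewrite eqn_leq le /=.
move: e; rewrite eqn_leq => /andP[_]; rewrite (bigD1 j) //= [in X in (_ <= X)%N](bigD1 j) //=.
move=> h; rewrite -(leq_add2r (\sum_(i < n | i != j) m i)).
by apply: leq_trans h _; rewrite leq_add2l; apply: leq_sum.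
Qed.

(** * Path algebras and Jacobian ideals *)

Section PathEnd.
Variables (V : finType) (Q : quiver V).
Definition path_end (v : V) (w : seq (arrow Q)) : V := last v [seq src a | a <- w].
End PathEnd.

(* [wd v w] is the element e_v w, which is 0 when w is not a path with target v;
   [wd_lift] says that the paths are linearly independent. *)
Record path_ring (K : fieldType) (V : finType) (Q : quiver V) := PathRing {
  path_ring_sort :> algType K;
  wd : V -> seq (arrow Q) -> path_ring_sort;
  wd_mul : forall v w v' w', wd v w * wd v' w' = if path_end v w == v' then wd v (w ++ w') else 0;
  wd0 : forall v w, ~~ is_path v w -> wd v w = 0;
  sum_wd : \sum_v wd v [::] = 1;
  wd_span : forall x, exists2 s : seq (K * (V * seq (arrow Q))),
    (forall t, t \in s -> is_path t.2.1 t.2.2) & x = \sum_(t <- s) t.1 *: wd t.2.1 t.2.2;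
  wd_lift : forall M : lmodType K, (V -> seq (arrow Q) -> M) -> {linear path_ring_sort -> M};
  wd_liftE : forall (M : lmodType K) (h : V -> seq (arrow Q) -> M) v w,
    is_path v w -> wd_lift h (wd v w) = h v w
}.

Section Concrete.
Variables (K : fieldType) (V : finType) (Q : quiver V).
Local Notation KQ := (path_algebra K Q).
Lemma pa_scalerAl c (x y : KQ) : c *: (x * y) = (c *: x) * y.
Proof. exact: (esym (linearZ_LR (pa_mulr y) c x)). Qed.
Lemma pa_scalerAr c (x y : KQ) : c *: (x * y) = x * (c *: y).
Proof. exact: (esym (linearZ_LR (pa_mul x) c y)). Qed.

Lemma word_mul_word v w v' w' : (word Q v w : KQ) * word Q v' w' =
  if path_end v w == v' then word Q v (w ++ w') else 0.
Proof.
have [wP|wF] := boolP (is_path v w); last first.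
  by rewrite (word0 K wF) mul0r word0 ?if_same // is_path_cat (negbTE wF).
have -> := word_path K (QPath (qpath_val := (v, w)) wP).
exact: path_mul_word.
Qed.

Lemma word_span (x : KQ) : exists2 s : seq (K * (V * seq (arrow Q))),
  (forall t, t \in s -> is_path t.2.1 t.2.2) & x = \sum_(t <- s) t.1 *: word Q t.2.1 t.2.2.
Proof.
exists [seq (pcoeff x p, qpath_val p) | p <- psupp x].
  by move=> t /mapP[p _ ->]; case: p.
rewrite big_map [LHS]pa_decomp /lin_ext; apply: eq_bigr => p _.
by rewrite -word_path.
Qed.

Definition word_lift (M : lmodType K) (h : V -> seq (arrow Q) -> M) : {linear KQ -> M} :=
  lin_ext (fun p => h (ptgt p) (pword p)).

Lemma word_lift_word (M : lmodType K) (h : V -> seq (arrow Q) -> M) v w :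
  is_path v w -> word_lift h (word Q v w) = h v w.
Proof.
move=> wP; have -> := word_path K (QPath (qpath_val := (v, w)) wP).
exact: lin_ext_basis.
Qed.

Variable v0 : V.
Lemma pa_one_neq0 : (1 : KQ) != 0.
Proof.
apply/eqP => e1; have : word Q v0 [::] = 0 :> KQ by rewrite -[LHS]mul1r e1 mul0r.
have := word_lift_word (M := K^o) (fun _ _ => 1) (v := v0) (w := [::]) isT.
by move=> + e0; rewrite e0 linear0 => /eqP; rewrite eq_sym oner_eq0.
Qed.

End Concrete.

(* The path algebra is a nontrivial ring only if there is a vertex. *)
Definition pa_pointed (K : fieldType) (V : finType) (Q : quiver V) (v0 : V) : Type :=
  path_algebra K Q.

Section Pointed.
Variables (K : fieldType) (V : finType) (Q : quiver V) (v0 : V).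
Local Notation A := (pa_pointed K Q v0).
HB.instance Definition _ := GRing.PzRing.copy A (path_algebra K Q).
HB.instance Definition _ := GRing.Lmodule.copy A (path_algebra K Q).
HB.instance Definition _ := GRing.PzSemiRing_isNonZero.Build A (pa_one_neq0 K Q v0).
HB.instance Definition _ := GRing.LSemiModule_isLSemiAlgebra.Build K A (@pa_scalerAl K V Q).
HB.instance Definition _ := GRing.LSemiAlgebra_isSemiAlgebra.Build K A (@pa_scalerAr K V Q).

Definition pa_path_ring : path_ring K Q :=
  @PathRing K V Q A (fun v w => word Q v w) (@word_mul_word K V Q)
    (fun v w => @word0 K V Q v w) erefl (@word_span K V Q) (@word_lift K V Q) (@word_lift_word K V Q).
End Pointed.

Section PathRing.
Variables (K : fieldType) (V : finType) (Q : quiver V) (R : path_ring K Q).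
Implicit Types (x y z : R) (v : V) (w : seq (arrow Q)) (a b : arrow Q).
Local Notation wd := (@wd K V Q R).

Definition vx v : R := wd v [::].
Definition arrow_elt a : R := wd (tgt a) [:: a].
Local Notation e v := (vx v).

Lemma vx_wd v v' w : e v * wd v' w = if v == v' then wd v' w else 0.
Proof. by rewrite wd_mul /path_end /=; case: eqP => [->|]. Qed.

Lemma wd_vx v w v' : wd v w * e v' = if path_end v w == v' then wd v w else 0.
Proof. by rewrite wd_mul cats0. Qed.

Lemma vxM v v' : e v * e v' = if v == v' then e v else 0.
Proof. by rewrite vx_wd; case: eqP => [->|]. Qed.

Lemma vxK v : e v * e v = e v.
Proof. by rewrite vxM eqxx. Qed.

Lemma vxM0 v v' : v != v' -> e v * e v' = 0.
Proof. by rewrite vxM => /negbTE ->. Qed.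

Lemma wd_cons v a w : wd v (a :: w) = if tgt a == v then arrow_elt a * wd (src a) w else 0.
Proof.
rewrite wd_mul /path_end /= eqxx; case: eqP => [<- //|nv].
by rewrite wd0 //= negb_and; case: eqP nv.
Qed.

Lemma vx_arr v a : e v * arrow_elt a = if v == tgt a then arrow_elt a else 0.
Proof. by rewrite vx_wd. Qed.

Lemma arr_vx v a : arrow_elt a * e v = if src a == v then arrow_elt a else 0.
Proof. by rewrite wd_vx. Qed.

Lemma vx_wdK v w : e v * wd v w = wd v w. Proof. by rewrite vx_wd eqxx. Qed.
Lemma wd_vxK v w : wd v w * e (path_end v w) = wd v w. Proof. by rewrite wd_vx eqxx. Qed.
Lemma vx_arrK a : e (tgt a) * arrow_elt a = arrow_elt a. Proof. by rewrite vx_arr eqxx. Qed.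
Lemma arr_vxK a : arrow_elt a * e (src a) = arrow_elt a. Proof. by rewrite arr_vx eqxx. Qed.

Lemma sum_vx : \sum_v e v = 1. Proof. exact: sum_wd. Qed.

Definition is_lin (P : R -> Prop) :=
  [/\ P 0, forall y z, P y -> P z -> P (y + z) & forall c y, P y -> P (c *: y)].

(** The N-th power of the arrow ideal, written as a span of paths. *)
Definition ord_ge (N : nat) x := exists2 s : seq (K * (V * seq (arrow Q))),
  (forall t, t \in s -> is_path t.2.1 t.2.2 /\ (N <= size t.2.2)%N) &
  x = \sum_(t <- s) t.1 *: wd t.2.1 t.2.2.

Lemma ord_ge_ind N (P : R -> Prop) : is_lin P ->
  (forall v w, is_path v w -> (N <= size w)%N -> P (wd v w)) -> forall x, ord_ge N x -> P x.
Proof.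
case=> P0 PD PZ Pw x [s sP ->]; elim: s sP => [|t s IHs] sP; first by rewrite big_nil.
rewrite big_cons; apply: PD; last by apply: IHs => t' t's; apply: sP; rewrite inE t's orbT.
by have [] := sP t (mem_head _ _) => tP tN; apply: PZ; apply: Pw.
Qed.

Lemma ord_ge_lin N : is_lin (ord_ge N).
Proof.
split=> [|y z [s sP ->] [s' s'P ->]|c y [s sP ->]].
- by exists [::]; rewrite ?big_nil.
- by exists (s ++ s'); rewrite ?big_cat // => t; rewrite mem_cat => /orP[/sP|/s'P].
exists [seq (c * t.1, t.2) | t <- s]; first by move=> t /mapP[t' /sP ? ->].
by rewrite big_map scaler_sumr; apply: eq_bigr => t _; rewrite scalerA.
Qed.

Lemma ord_ge0 N : ord_ge N 0. Proof. by case: (ord_ge_lin N). Qed.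
Lemma ord_geD N x y : ord_ge N x -> ord_ge N y -> ord_ge N (x + y).
Proof. by case: (ord_ge_lin N) => _ h _; apply: h. Qed.
Lemma ord_geZ N c x : ord_ge N x -> ord_ge N (c *: x).
Proof. by case: (ord_ge_lin N) => _ _; apply. Qed.
Lemma ord_geN N x : ord_ge N x -> ord_ge N (- x).
Proof. by rewrite -scaleN1r; apply: ord_geZ. Qed.

Lemma ord_ge_sum N (I : Type) (r : seq I) (P : pred I) (F : I -> R) :
  (forall i, P i -> ord_ge N (F i)) -> ord_ge N (\sum_(i <- r | P i) F i).
Proof. by move=> h; elim/big_ind: _ => //; [apply: ord_ge0|apply: ord_geD]. Qed.

Lemma ord_ge_wd N v w : (N <= size w)%N -> ord_ge N (wd v w).
Proof.
move=> wN; have [wP|/wd0 ->] := boolP (is_path v w); last exact: ord_ge0.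
exists [:: (1, (v, w))]; last by rewrite big_seq1 scale1r.
by move=> t; rewrite inE => /eqP ->.
Qed.

Lemma ord_ge_all x : ord_ge 0 x.
Proof. by have [s sP ->] := wd_span x; exists s => // t /sP. Qed.

Lemma wd_ind (P : R -> Prop) : is_lin P -> (forall v w, is_path v w -> P (wd v w)) ->
  forall x, P x.
Proof. by move=> lP Pw x; apply: (ord_ge_ind (N := 0)) (ord_ge_all x) => // ? ? /Pw. Qed.

Lemma ord_ge_le M N x : (M <= N)%N -> ord_ge N x -> ord_ge M x.
Proof.
move=> MN; move: x; apply: ord_ge_ind; first exact: ord_ge_lin.
by move=> v w _ wN; apply: ord_ge_wd; apply: leq_trans wN.
Qed.

Lemma is_lin_eq (M : lmodType K) (f g : {linear R -> M}) : is_lin (fun x => f x = g x).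
Proof.
by split=> [|y z|c y]; rewrite ?linear0 // ?linearD ?linearZ /= => ->; [move=> ->|].
Qed.

Lemma wd_ext (M : lmodType K) (f g : {linear R -> M}) :
  (forall v w, is_path v w -> f (wd v w) = g (wd v w)) -> f =1 g.
Proof. by move=> fg; apply: wd_ind => //; apply: is_lin_eq. Qed.

Lemma ord_geM M N x y : ord_ge M x -> ord_ge N y -> ord_ge (M + N) (x * y).
Proof.
move=> xM yN; move: x xM; apply: ord_ge_ind.
  split=> [|x x'|c x]; rewrite ?mul0r ?mulrDl -?scalerAl.
  - exact: ord_ge0.
  - exact: ord_geD.
  - exact: ord_geZ.
move=> v w _ wM; move: y yN; apply: ord_ge_ind.
  split=> [|y y'|c y]; rewrite ?mulr0 ?mulrDr -?scalerAr.
  - exact: ord_ge0.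
  - exact: ord_geD.
  - exact: ord_geZ.
move=> v' w' _ wN; rewrite wd_mul; case: ifP => _; last exact: ord_ge0.
by apply: ord_ge_wd; rewrite size_cat leq_add.
Qed.

Lemma ord_geMl N x y : ord_ge N y -> ord_ge N (x * y).
Proof. exact: (ord_geM (ord_ge_all x)). Qed.

Lemma ord_geMr N x y : ord_ge N x -> ord_ge N (x * y).
Proof. by move=> xN; have := ord_geM xN (ord_ge_all y); rewrite addn0. Qed.

Lemma ord_geX N x n : ord_ge N x -> ord_ge (N * n) (x ^+ n).
Proof.
move=> xN; elim: n => [|n IHn]; first by rewrite muln0; apply: ord_ge_all.
by rewrite exprS mulnS; apply: ord_geM.
Qed.

(** Among the closed paths at u only the stationary one has length 0. *)
Lemma typed_const u x : x = e u * x * e u ->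
  exists c, exists2 y, ord_ge 1 y & x = c *: e u + y.
Proof.
move=> ->; move: x; apply: (wd_ind (P := fun x => exists c, exists2 y, ord_ge 1 y & e u * x * e u = c *: e u + y)).
  split=> [|x x' [c [y y1 e1]] [c' [y' y'1 e2]]|d x [c [y y1 e1]]].
  - by exists 0, 0; rewrite ?mulr0 ?mul0r ?scale0r ?add0r //; apply: ord_ge0.
  - exists (c + c'), (y + y'); first exact: ord_geD.
    by rewrite mulrDr mulrDl e1 e2 scalerDl addrACA.
  - exists (d * c), (d *: y); first exact: ord_geZ.
    by rewrite -scalerAr -scalerAl e1 scalerDr scalerA.
move=> v [|a w] _.
  exists (u == v)%:R, 0; first exact: ord_ge0.
  rewrite addr0 -/(vx v) vxM; case: eqP => [->|_]; last by rewrite mul0r scale0r.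
  by rewrite vxK scale1r.
exists 0, (e u * wd v (a :: w) * e u); last by rewrite scale0r add0r.
by apply/ord_geMr/ord_geMl/ord_ge_wd.
Qed.

Lemma typed_ord_ge1 u v x : u != v -> x = e u * x * e v -> ord_ge 1 x.
Proof.
move=> uv ->; move: x; apply: wd_ind.
  split=> [|x x'|c x]; rewrite ?mulr0 ?mul0r ?mulrDr ?mulrDl -?scalerAr -?scalerAl.
  - exact: ord_ge0.
  - exact: ord_geD.
  - exact: ord_geZ.
move=> v' [|a w] _; last by apply/ord_geMr/ord_geMl/ord_ge_wd.
rewrite -/(vx v') vxM; case: ifP => _; last by rewrite mul0r; apply: ord_ge0.
by rewrite vxM0 //; apply: ord_ge0.
Qed.

(** The coefficient of the stationary path at v is a linear form that vanishes on all paths of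
    positive length. *)
Lemma vx_not_ord_ge1 v : ~ ord_ge 1 (e v).
Proof.
pose f := @wd_lift K V Q R K^o (fun v' w => ((v' == v) && nilp w)%:R).
have f0 : forall x, ord_ge 1 x -> f x = 0.
  apply: ord_ge_ind.
    by split=> [|x1 x2|c x1]; rewrite ?linear0 ?linearD ?linearZ //= => ->; [move=> ->; rewrite addr0|rewrite scaler0].
  by move=> v' [|a w] // wP _; rewrite /f wd_liftE //= andbF.
by move/f0; rewrite /f wd_liftE //= eqxx => /eqP; rewrite oner_eq0.
Qed.

(* [cyc_der a x y] is the sum of x2 y x1 over the factorizations x1 a x2 of the
   paths occurring in x. *)
Fixpoint wd_der a (u y : R) w : R :=
  if w is b :: w' then
    (if b == a then wd (src a) w' * y * u else 0) + wd_der a (u * arrow_elt b) y w'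
  else 0.

Definition cyc_der a x y : R := wd_lift R (fun v w => wd_der a (e v) y w) x.

Lemma cyc_der_wd a v w y : is_path v w -> cyc_der a (wd v w) y = wd_der a (e v) y w.
Proof. by move=> wP; rewrite /cyc_der wd_liftE. Qed.

Lemma cyc_der_is_linear a y : linear (fun x => cyc_der a x y).
Proof. by move=> c x x'; rewrite /cyc_der linearP. Qed.

Lemma cyc_derDl a x x' y : cyc_der a (x + x') y = cyc_der a x y + cyc_der a x' y.
Proof. exact: linearD. Qed.
Lemma cyc_derZl a c x y : cyc_der a (c *: x) y = c *: cyc_der a x y.
Proof. exact: linearZ. Qed.
Lemma cyc_der0l a y : cyc_der a 0 y = 0.
Proof. exact: linear0. Qed.

Lemma wd_der_linear a u w c y y' :
  wd_der a u (c *: y + y') w = c *: wd_der a u y w + wd_der a u y' w.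
Proof.
elim: w u => [|b w IHw] u /=; first by rewrite scaler0 addr0.
rewrite IHw scalerDr addrACA; congr (_ + _); case: ifP => _; last by rewrite scaler0 addr0.
by rewrite mulrDr mulrDl -scalerAr -scalerAl.
Qed.

Lemma cyc_der_linear a x : linear (cyc_der a x).
Proof.
move=> c y y'; move: x; apply: wd_ind.
  split=> [|x x' e1 e2|d x e1]; first by rewrite !cyc_der0l scaler0 addr0.
  - by rewrite !cyc_derDl e1 e2 scalerDr addrACA.
  - by rewrite !cyc_derZl e1 scalerDr !scalerA mulrC.
by move=> v w wP; rewrite !cyc_der_wd // wd_der_linear.
Qed.
HB.instance Definition _ a x := GRing.isLinear.Build K R R *:%R (cyc_der a x) (cyc_der_linear a x).

Lemma wd_der_cat a u y v w w' : is_path v (w ++ w') -> u = u * e v ->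
  wd_der a u y (w ++ w') =
  wd_der a u (wd (path_end v w) w' * y) w + wd_der a (u * wd v w) y w'.
Proof.
elim: w u v => [|b w IHw] u v /= pw uv; first by rewrite add0r -uv.
case/andP: pw => /eqP tb pw; rewrite (IHw _ (src b)) //; last by rewrite -mulrA arr_vxK.
rewrite wd_cons tb eqxx !mulrA addrA; congr (_ + _ + _).
case: eqP => // <-.
by rewrite wd_mul /path_end /= eqxx.
Qed.

Lemma wd_der_mulu a z u y w : wd_der a (z * u) y w = wd_der a u (y * z) w.
Proof.
elim: w u => //= b w IHw u; rewrite -[z * u * arrow_elt b]mulrA IHw; congr (_ + _).
by case: ifP => _ //; rewrite !mulrA.
Qed.

Lemma wd_der0 a y w : wd_der a 0 y w = 0.
Proof. by elim: w => //= b w IHw; rewrite mul0r mulr0 IHw addr0 if_same. Qed.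

Lemma wd_der_end a u y v w : is_path v w -> wd_der a u y w = wd_der a u (e (path_end v w) * y) w.
Proof.
elim: w u v => //= b w IHw u v /andP[_ wP]; rewrite (IHw _ _ wP); congr (_ + _).
case: eqP => // <-; rewrite mulrA /path_end /=.
by rewrite -/(path_end (src b) w) wd_vxK.
Qed.

(** A cyclic Leibniz rule: the marked arrow lies in x or in x', and the other factor joins y on the
    side given by the cyclic order. *)
Lemma cyc_derM a x x' y :
  cyc_der a (x * x') y = cyc_der a x (x' * y) + cyc_der a x' (y * x).
Proof.
move: x; apply: wd_ind.
  split=> [|x1 x2 e1 e2|c x1 e1].
  - by rewrite mul0r mulr0 linear0 !cyc_der0l addr0.
  - by rewrite mulrDl mulrDr linearD !cyc_derDl e1 e2 addrACA.
  - by rewrite -scalerAl -scalerAr linearZ !cyc_derZl e1 scalerDr.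
move=> v w wP; move: x'; apply: wd_ind.
  split=> [|x1 x2 e1 e2|c x1 e1].
  - by rewrite mul0r mulr0 linear0 !cyc_der0l addr0.
  - by rewrite mulrDl mulrDr linearD !cyc_derDl e1 e2 addrACA.
  - by rewrite -scalerAl -scalerAr linearZ !cyc_derZl e1 scalerDr.
move=> v' w' w'P; rewrite wd_mul; case: eqP => [ve|/eqP nve].
  have wwP : is_path v (w ++ w') by rewrite is_path_cat wP -/(path_end v w) ve.
  rewrite !cyc_der_wd // (wd_der_cat _ _ wwP) ?vxK // ve; congr (_ + _).
  rewrite vx_wdK.
  by rewrite -[wd v w in LHS](wd_vxK v w) ve wd_der_mulu.
rewrite cyc_der0l !cyc_der_wd // (wd_der_end _ _ _ wP) mulrA vx_wd (negbTE nve) mul0r.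
rewrite -wd_der_mulu wd_vx (negbTE nve) wd_der0 addr0.
by elim: w (e v) {wP nve} => //= b w IHw u; rewrite mulr0 mul0r if_same -IHw addr0.
Qed.

Lemma cyc_der_arr a b y : cyc_der a (arrow_elt b) y = if a == b then e (src a) * y * e (tgt a) else 0.
Proof.
rewrite cyc_der_wd /= ?eqxx // addr0 eq_sym.
by case: eqP => // <-.
Qed.

Lemma cyc_der_vx a v y : cyc_der a (e v) y = 0.
Proof. by rewrite cyc_der_wd. Qed.

Lemma wd_der_typed a u y v w : is_path v w ->
  wd_der a (u * e v) y w = e (src a) * wd_der a (u * e v) y w * e (tgt a).
Proof.
elim: w v u => [|b w IHw] v u /= wP; first by rewrite mulr0 mul0r.
case/andP: wP => /eqP tb wP.
have ue : u * e v * arrow_elt b = u * arrow_elt b * e (src b) by rewrite -tb -!mulrA vx_arrK arr_vxK.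
rewrite ue mulrDr mulrDl -(IHw _ _ wP); congr (_ + _).
case: eqP => [ba|_]; last by rewrite mulr0 mul0r.
by rewrite -tb ba !mulrA vx_wdK -!mulrA vxK.
Qed.

Lemma cyc_der_typed a x y : cyc_der a x y = e (src a) * cyc_der a x y * e (tgt a).
Proof.
move: x; apply: wd_ind.
  split=> [|x x' e1 e2|c x e1]; rewrite ?cyc_der0l ?cyc_derDl ?cyc_derZl.
  - by rewrite mulr0 mul0r.
  - by rewrite {1}e1 {1}e2 mulrDr mulrDl.
  - by rewrite {1}e1 -scalerAr -scalerAl.
move=> v w wP; rewrite cyc_der_wd //.
by have := wd_der_typed a (e v) y wP; rewrite vxK.
Qed.

Definition typed u v x := x = e u * x * e v.

Lemma typed_lin u v : is_lin (typed u v).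
Proof.
split=> [|y z|c y]; rewrite /typed; first by rewrite mulr0 mul0r.
  by move=> {1}-> {1}->; rewrite mulrDr mulrDl.
by move=> {1}->; rewrite -scalerAr -scalerAl.
Qed.

Lemma typed0 u v : typed u v 0. Proof. by case: (typed_lin u v). Qed.
Lemma typedD u v x y : typed u v x -> typed u v y -> typed u v (x + y).
Proof. by case: (typed_lin u v) => _ h _; apply: h. Qed.
Lemma typedZ u v c x : typed u v x -> typed u v (c *: x).
Proof. by case: (typed_lin u v) => _ _; apply. Qed.
Lemma typedN u v x : typed u v x -> typed u v (- x).
Proof. by rewrite -scaleN1r; apply: typedZ. Qed.
Lemma typedl u v x : typed u v x -> e u * x = x.
Proof. by move=> ->; rewrite !mulrA vxK. Qed.
Lemma typedr u v x : typed u v x -> x * e v = x.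
Proof. by move=> ->; rewrite -!mulrA vxK. Qed.
Lemma typedP u v x : e u * x = x -> x * e v = x -> typed u v x.
Proof. by rewrite /typed => -> ->. Qed.
Lemma typedM u v t x y : typed u v x -> typed v t y -> typed u t (x * y).
Proof.
move=> ux vy; apply: typedP; first by rewrite mulrA (typedl ux).
by rewrite -mulrA (typedr vy).
Qed.
Lemma typed_proj u v x : typed u v (e u * x * e v).
Proof. by apply: typedP; [rewrite !mulrA vxK|rewrite -!mulrA vxK]. Qed.
Lemma typed_arr a : typed (tgt a) (src a) (arrow_elt a).
Proof. by apply: typedP; [rewrite vx_arrK|rewrite arr_vxK]. Qed.
Lemma typed_vx v : typed v v (e v).
Proof. by apply: typedP; rewrite vxK. Qed.
Lemma typed_wd v w : typed v (path_end v w) (wd v w).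
Proof. by apply: typedP; [rewrite vx_wdK|rewrite wd_vxK]. Qed.
Lemma typed_cyc_der a x y : typed (src a) (tgt a) (cyc_der a x y).
Proof. exact: cyc_der_typed. Qed.
Lemma typed_neq u v u' x : u != u' -> typed u v x -> e u' * x = 0.
Proof. by move=> nu ->; rewrite !mulrA vxM0 ?mul0r // eq_sym. Qed.
Lemma typed_neqr u v v' x : v != v' -> typed u v x -> x * e v' = 0.
Proof. by move=> nv ->; rewrite -!mulrA vxM0 ?mulr0. Qed.

Lemma cyc_der_ideal (P : R -> Prop) a x y : P 0 -> (forall y z, P y -> P z -> P (y + z)) ->
  (forall z z', P (z * y * z')) -> P (cyc_der a x y).
Proof.
move=> P0 PD Pm.
suff [s ->] : exists s : seq (R * R), cyc_der a x y = \sum_(t <- s) t.1 * y * t.2.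
  by elim/big_ind: _.
move: x; apply: wd_ind.
  split=> [|x x' [s e1] [s' e2]|c x [s e1]].
  - by exists [::]; rewrite big_nil cyc_der0l.
  - by exists (s ++ s'); rewrite big_cat cyc_derDl e1 e2.
  - exists [seq (c *: t.1, t.2) | t <- s]; rewrite cyc_derZl e1 big_map scaler_sumr.
    by apply: eq_bigr => t _; rewrite -!scalerAl.
move=> v w wP; rewrite cyc_der_wd //; elim: w (e v) {wP} => [|b w IHw] u /=.
  by exists [::]; rewrite big_nil.
have [s ->] := IHw (u * arrow_elt b).
case: eqP => _; last by exists s; rewrite add0r.
by exists ((wd (src a) w, u) :: s); rewrite big_cons.
Qed.

Lemma cyc_der_ord N a x y : ord_ge N.+1 x -> ord_ge N (cyc_der a x y).
Proof.
move: x; apply: ord_ge_ind.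
  split=> [|x x'|c x]; rewrite ?cyc_der0l ?cyc_derDl ?cyc_derZl.
  - exact: ord_ge0.
  - exact: ord_geD.
  - exact: ord_geZ.
move=> v w wP wN; rewrite cyc_der_wd //.
have : (ord_ge 0 (e v)) by apply: ord_ge_all.
have : (N.+1 <= 0 + size w)%N by [].
elim: w (e v) 0%N {wP wN} => [|b w IHw] u m /= le um; first exact: ord_ge0.
apply: ord_geD; last first.
  apply: (IHw _ m.+1); first by rewrite addSnnS.
  by rewrite -addn1; apply: ord_geM => //; apply: ord_ge_wd.
case: eqP => _; last exact: ord_ge0.
apply: (@ord_ge_le _ (size w + m)%N); first by rewrite addnC; rewrite addnS in le.
by apply: ord_geM => //; apply/ord_geMr/ord_ge_wd.
Qed.
End PathRing.

Record ideal (A : pzRingType) (P : A -> Prop) : Prop := Ideal {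
  ideal_zero : P 0;
  ideal_add : forall x y, P x -> P y -> P (x + y);
  ideal_mull : forall x y, P y -> P (x * y);
  ideal_mulr : forall x y, P x -> P (x * y)
}.

Section IdealTheory.
Variables (A : pzRingType) (P : A -> Prop) (idP : ideal P).

Lemma idealN x : P x -> P (- x).
Proof. by rewrite -mulN1r; apply: ideal_mull. Qed.
Lemma idealB x y : P x -> P y -> P (x - y).
Proof. by move=> Px Py; apply: ideal_add => //; apply: idealN. Qed.
Lemma ideal_sum (I : Type) (r : seq I) (Q : pred I) (F : I -> A) :
  (forall i, Q i -> P (F i)) -> P (\sum_(i <- r | Q i) F i).
Proof. by move=> PF; elim/big_ind: _ => //; [apply: ideal_zero|apply: ideal_add]. Qed.
Lemma ideal_eq x y : P (x - y) -> P y -> P x.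
Proof. by move=> Pxy Py; rewrite -[x](subrK y); apply: ideal_add. Qed.
End IdealTheory.

Section Jacobian.
Variables (K : fieldType) (V : finType) (Q : quiver V) (R : path_ring K Q).
Implicit Types (x y z : R) (v : V) (w : seq (arrow Q)) (a b : arrow Q).
Local Notation wd := (@wd K V Q R).
Local Notation e v := (@vx K V Q R v).

Definition jac (W x : R) := exists s : seq (R * arrow Q * R),
  x = \sum_(t <- s) t.1.1 * cyc_der t.1.2 W 1 * t.2.

Lemma jac_ideal W : ideal (jac W).
Proof.
split=> [|x y [s ->] [s' ->]|x y [s ->]|x y [s ->]].
- by exists [::]; rewrite big_nil.
- by exists (s ++ s'); rewrite big_cat.
- exists [seq (x * t.1.1, t.1.2, t.2) | t <- s]; rewrite big_map mulr_sumr.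
  by apply: eq_bigr => t _; rewrite !mulrA.
exists [seq (t.1.1, t.1.2, t.2 * y) | t <- s]; rewrite big_map mulr_suml.
by apply: eq_bigr => t _; rewrite !mulrA.
Qed.

Lemma jac_der W a : jac W (cyc_der a W 1).
Proof. by exists [:: (1, a, 1)]; rewrite big_seq1 mul1r mulr1. Qed.

Lemma jac_min W (P : R -> Prop) : ideal P -> (forall a, P (cyc_der a W 1)) ->
  forall x, jac W x -> P x.
Proof.
move=> idP Pa x [s ->]; apply: (ideal_sum idP) => t _.
by apply: (ideal_mulr idP); apply: (ideal_mull idP).
Qed.

Lemma ord_ge_ideal N : ideal (ord_ge (R := R) N).
Proof.
split; [exact: ord_ge0|exact: ord_geD|move=> ? ?; exact: ord_geMl|].
by move=> ? ?; apply: ord_geMr.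
Qed.

(* Truncating at length N replaces completing the path algebra: an element with
   nonzero constant term is invertible up to long paths. *)
Definition near_jac N (W x : R) := exists2 y, jac W y & ord_ge N (x - y).

Lemma near_jac_ideal N W : ideal (near_jac N W).
Proof.
have [j0 jD jl jr] := jac_ideal W.
split=> [|x y [x' jx ox] [y' jy oy]|x y [y' jy oy]|x y [x' jx ox]].
- by exists 0; rewrite ?subr0; [|apply: ord_ge0].
- by exists (x' + y'); [apply: jD|rewrite opprD addrACA; apply: ord_geD].
- by exists (x * y'); [apply: jl|rewrite -mulrBr; apply: ord_geMl].
- by exists (x' * y); [apply: jr|rewrite -mulrBl; apply: ord_geMr].
Qed.

Lemma near_jac_jac N W x : jac W x -> near_jac N W x.
Proof. by move=> jx; exists x => //; rewrite subrr; apply: ord_ge0. Qed.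

Lemma near_jac_ord N W x : ord_ge N x -> near_jac N W x.
Proof. by move=> ox; exists 0; rewrite ?subr0 //; apply: ideal_zero (jac_ideal W). Qed.

Lemma near_jac_min N W (P : R -> Prop) : ideal P -> (forall a, P (cyc_der a W 1)) ->
  (forall x, ord_ge N x -> P x) -> forall x, near_jac N W x -> P x.
Proof.
move=> idP Pa PN x [y jy oy]; apply: (ideal_eq idP (PN _ oy)).
exact: jac_min jy.
Qed.

(** Only the component of y that closes x to a cycle contributes. *)
Lemma cyc_der_close a u v x y : typed u v x -> cyc_der a x y = cyc_der a x (e v * y * e u).
Proof.
move=> ux; rewrite -mulrA -[x in LHS](typedr ux) cyc_derM cyc_der_vx addr0.
by rewrite -[x in LHS](typedl ux) cyc_derM cyc_der_vx add0r -mulrA.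
Qed.

Lemma cyc_derC a x y : cyc_der a (x * y) 1 = cyc_der a (y * x) 1.
Proof. by rewrite !cyc_derM !mul1r !mulr1 addrC. Qed.
End Jacobian.

Section ChainRule.
Variables (K : fieldType) (V : finType) (Q Q' : quiver V).
Variables (R : path_ring K Q) (S : path_ring K Q') (psi : {linear R -> S}).
Hypothesis psiM : forall x y, psi (x * y) = psi x * psi y.
Hypothesis psi_vx : forall v, psi (vx R v) = vx S v.

Lemma psi1 : psi 1 = 1.
Proof. by rewrite -(sum_vx R) linear_sum /= -(sum_vx S); apply: eq_bigr. Qed.

Lemma psi_typed u v x : typed u v x -> typed u v (psi x).
Proof. by move=> e; rewrite /typed -!psi_vx -!psiM -e. Qed.

Lemma psi_scale_typed a : typed (tgt a) (src a) (psi (arrow_elt R a)).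
Proof. exact/psi_typed/typed_arr. Qed.

(** An occurrence of b in the image of a path lies in the image of one of its arrows a; the images
    of the other arrows, together with that of z, form [psi (cyc_der a x z)]. *)
Lemma cyc_der_chain b x z : cyc_der b (psi x) (psi z) =
  \sum_a cyc_der b (psi (arrow_elt R a)) (psi (cyc_der a x z)).
Proof.
move: x z.
have lin (P : R -> R -> Prop) : (forall z, is_lin (fun x => P x z)) ->
  (forall v w, is_path v w -> forall z, P (wd R v w) z) -> forall x z, P x z.
  by move=> lP Pw x z; move: x; apply: wd_ind => // v w wP; apply: Pw.
apply: lin => [z|v w wP].
  split=> [|x y e1 e2|c x e1].
  - rewrite linear0 cyc_der0l big1 // => a _.
    by rewrite cyc_der0l !linear0.
  - rewrite linearD /= cyc_derDl e1 e2 -big_split; apply: eq_bigr => a _ /=.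
    by rewrite cyc_derDl !linearD.
  - rewrite linearZ /= cyc_derZl e1 scaler_sumr; apply: eq_bigr => a _ /=.
    by rewrite cyc_derZl !linearZ.
elim: w v wP => [|a w IHw] v /=.
  move=> _ z; rewrite -/(vx R v) psi_vx cyc_der_vx big1 // => a _.
  by rewrite cyc_der_vx !linear0.
case/andP => /eqP tv wP z.
rewrite wd_cons tv eqxx psiM cyc_derM -psiM -psiM IHw //.
rewrite [in RHS](eq_bigr (fun a' => cyc_der b (psi (arrow_elt R a')) (psi (cyc_der a' (arrow_elt R a) (wd R (src a) w * z)))
   + cyc_der b (psi (arrow_elt R a')) (psi (cyc_der a' (wd R (src a) w) (z * arrow_elt R a))))); last first.
  by move=> a' _; rewrite cyc_derM !linearD.
rewrite big_split /=; congr (_ + _).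
rewrite (bigD1 a) //= big1 ?addr0 => [|a' /negbTE na]; last first.
  by rewrite cyc_der_arr na !linear0.
rewrite cyc_der_arr eqxx !psiM !psi_vx.
by rewrite (cyc_der_close _ _ (psi_scale_typed a)).
Qed.

Lemma cyc_der_chain_ideal (P : S -> Prop) W b : ideal P ->
  (forall a, P (psi (cyc_der a W 1))) -> P (cyc_der b (psi W) 1).
Proof.
move=> idP Pa; rewrite -psi1 cyc_der_chain; apply: (ideal_sum idP) => a _.
apply: cyc_der_ideal; [exact: ideal_zero idP|exact: ideal_add idP|].
by move=> z z'; apply: (ideal_mulr idP); apply: (ideal_mull idP).
Qed.

(** An arrow joins different vertices, so its image has no stationary part; thus an algebra map that
    fixes the vertices cannot shorten paths. *)
Lemma psi_ord N x : loop_free Q -> ord_ge N x -> ord_ge N (psi x).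
Proof.
move=> lf; move: x; apply: ord_ge_ind.
  split=> [|x y|c x]; rewrite ?linear0 ?linearD ?linearZ /=.
  - exact: ord_ge0.
  - exact: ord_geD.
  - exact: ord_geZ.
suff h : forall w v, is_path v w -> ord_ge (size w) (psi (wd R v w)).
  by move=> v w wP wN; apply: ord_ge_le wN _; apply: h.
elim=> [|a w IHw] v /=; first by move=> _; apply: ord_ge_all.
case/andP => /eqP tv wP; rewrite wd_cons tv eqxx psiM -add1n.
apply: ord_geM; last exact: IHw.
apply: typed_ord_ge1 (psi_scale_typed a).
by apply/eqP => e; apply: (lf a).
Qed.
End ChainRule.

(** * Rigid two-term complexes *)

Lemma sum_sub (A : zmodType) (I : finType) (p : pred I) (F : I -> A) :
  \sum_(x : {x : I | p x}) F (val x) = \sum_(x | p x) F x.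
Proof.
rewrite -(big_sub_cond (I := I) p xpredT F) /=.
by apply: eq_bigl => a; rewrite andbT unfold_in.
Qed.

Section Rigid.
Variables (A : pzRingType) (V : finType) (eps : V -> A) (J : A -> Prop).
Hypotheses (epsK : forall v, eps v * eps v = eps v) (idJ : ideal J).

Definition btyped u v (x : A) := x = eps u * x * eps v.

Lemma btypedl u v x : btyped u v x -> eps u * x = x.
Proof. by move=> ->; rewrite !mulrA epsK. Qed.
Lemma btypedr u v x : btyped u v x -> x * eps v = x.
Proof. by move=> ->; rewrite -!mulrA epsK. Qed.
Lemma btypedP u v x : eps u * x = x -> x * eps v = x -> btyped u v x.
Proof. by rewrite /btyped => -> ->. Qed.
Lemma btypedM u v t x y : btyped u v x -> btyped v t y -> btyped u t (x * y).
Proof.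
move=> ux vy; apply: btypedP; first by rewrite mulrA (btypedl ux).
by rewrite -mulrA (btypedr vy).
Qed.
Lemma btyped0 u v : btyped u v 0.
Proof. by rewrite /btyped mulr0 mul0r. Qed.
Lemma btypedD u v x y : btyped u v x -> btyped u v y -> btyped u v (x + y).
Proof. by rewrite /btyped => {1}-> {1}->; rewrite mulrDr mulrDl. Qed.
Lemma btypedN u v x : btyped u v x -> btyped u v (- x).
Proof. by rewrite /btyped => {1}->; rewrite mulrN mulNr. Qed.
Lemma btyped_sum u v (I : Type) (r : seq I) (Q : pred I) (F : I -> A) :
  (forall i, Q i -> btyped u v (F i)) -> btyped u v (\sum_(i <- r | Q i) F i).
Proof. by move=> h; elim/big_ind: _ => //; [apply: btyped0|apply: btypedD]. Qed.

Section Span.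
Variables (X Y : finType) (xv : X -> V) (yv : Y -> V) (P : Y -> X -> A).
Hypothesis tP : forall y x, btyped (yv y) (xv x) (P y x).

(* Homotopies of the two-term complex with differential P. *)
Definition homotopic (M : Y -> X -> A) := exists (U : Y -> Y -> A) (T : X -> X -> A),
  [/\ forall y y', btyped (yv y) (yv y') (U y y'), forall x x', btyped (xv x) (xv x') (T x x')
   & forall y x, J (M y x - (\sum_y' U y y' * P y' x + \sum_x' P y x' * T x' x))].

Definition rigid := forall M, (forall y x, btyped (yv y) (xv x) (M y x)) -> homotopic M.

Lemma homotopic0 : homotopic (fun _ _ => 0).
Proof.
exists (fun _ _ => 0), (fun _ _ => 0); split=> [*|*|y x]; try exact: btyped0.
by rewrite !big1 ?addr0 ?subrr; [exact: ideal_zero idJ|move=> *; rewrite mulr0|move=> *; rewrite mul0r].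
Qed.

Lemma homotopicD M M' : homotopic M -> homotopic M' -> homotopic (fun y x => M y x + M' y x).
Proof.
case=> U [T [tU tT h]] [U' [T' [tU' tT' h']]].
exists (fun y y' => U y y' + U' y y'), (fun x x' => T x x' + T' x x'); split=> [*|*|y x].
- exact: btypedD.
- exact: btypedD.
have -> : \sum_y' (U y y' + U' y y') * P y' x = \sum_y' U y y' * P y' x + \sum_y' U' y y' * P y' x.
  by rewrite -big_split; apply: eq_bigr => y' _; rewrite mulrDl.
have -> : \sum_x' P y x' * (T x' x + T' x' x) = \sum_x' P y x' * T x' x + \sum_x' P y x' * T' x' x.
  by rewrite -big_split; apply: eq_bigr => y' _; rewrite mulrDr.
by rewrite addrACA opprD addrACA; apply: (ideal_add idJ).
Qed.

Lemma homotopic_eq M M' : (forall y x, J (M y x - M' y x)) -> homotopic M' -> homotopic M.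
Proof.
move=> MM' [U [T [tU tT h]]]; exists U, T; split=> // y x.
by have := ideal_add idJ (MM' y x) (h y x); rewrite addrA subrK.
Qed.

Lemma homotopic_sum (I : Type) (r : seq I) (F : I -> Y -> X -> A) :
  (forall i, homotopic (F i)) -> homotopic (fun y x => \sum_(i <- r) F i y x).
Proof.
move=> h; elim: r => [|i r IHr].
  by apply: homotopic_eq homotopic0 => y x; rewrite big_nil subrr; apply: ideal_zero.
apply: homotopic_eq (homotopicD (h i) IHr) => y x.
by rewrite big_cons subrr; apply: ideal_zero.
Qed.

Definition elementary (y0 : Y) (x0 : X) (z : A) (y : Y) (x : X) : A :=
  if (y == y0) && (x == x0) then z else 0.

Lemma rigid_elementary :
  (forall y0 x0 z, btyped (yv y0) (xv x0) z -> homotopic (elementary y0 x0 z)) -> rigid.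
Proof.
move=> h M tM.
apply: (@homotopic_eq _ (fun y x => \sum_(p : Y * X) elementary p.1 p.2 (M p.1 p.2) y x)).
  move=> y x; rewrite (bigD1 (y, x)) //= big1 => [|[y' x'] ne].
    by rewrite /elementary !eqxx addr0 subrr; apply: ideal_zero.
  by rewrite /elementary /=; case: eqP => [ey|//]; case: eqP => // ex; rewrite ey ex eqxx in ne.
by apply: homotopic_sum => -[y x]; apply: h.
Qed.

Lemma homotopic_col x0 x1 z : btyped (xv x1) (xv x0) z ->
  homotopic (fun y x => if x == x0 then P y x1 * z else 0).
Proof.
move=> tz; exists (fun _ _ => 0), (fun x x' => if (x == x1) && (x' == x0) then z else 0).
split=> [*|x x'|y x]; last first.
- rewrite [X in _ - (X + _)]big1 => [|x' _]; last by rewrite mul0r.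
  rewrite add0r (bigD1 x1) //= eqxx /= big1 => [|y' /negbTE ->]; last by rewrite mulr0.
  by rewrite addr0; case: ifP => _; rewrite ?mulr0 subrr; apply: ideal_zero.
- by case: ifP => [/andP[/eqP -> /eqP ->] //|_]; apply: btyped0.
exact: btyped0.
Qed.
End Span.

(** A row operation is an isomorphism of complexes. With C the matrix having c as its column [y0],
    one has C^2 = 0 since [c y0 = 0], and the homotopy U becomes (1 - C) U (1 + C). *)
Lemma rigid_transvection (X Y : finType) (xv : X -> V) (yv : Y -> V) (P : Y -> X -> A)
    (y0 : Y) (c : Y -> A) : c y0 = 0 -> (forall y, btyped (yv y) (yv y0) (c y)) ->
  rigid xv yv P -> rigid xv yv (fun y x => P y x - c y * P y0 x).
Proof.
move=> c0 tc rP M tM.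
have [|U [T [tU tT h]]] := rP (fun y x => M y x + c y * M y0 x).
  by move=> y x; apply: btypedD => //; apply: btypedM (tc y) (tM y0 x).
(* [U1] is (1 - C) U; the factor 1 + C is added in the next witness as a correction of column
   [y0]. *)
pose U1 y y' := U y y' - c y * U y0 y'.
have tU1 y y' : btyped (yv y) (yv y') (U1 y y').
  by apply: btypedD => //; apply: btypedN; apply: btypedM (tc y) (tU _ _).
exists (fun y y' => U1 y y' + (if y' == y0 then \sum_y'' U1 y y'' * c y'' else 0)), T.
split=> // [y y'|y x].
  apply: btypedD => //; case: eqP => [->|_]; last exact: btyped0.
  by apply: btyped_sum => y'' _; apply: btypedM (tU1 _ _) (tc _).
have P'0 x' : P y0 x' - c y0 * P y0 x' = P y0 x' by rewrite c0 mul0r subr0.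
have -> : \sum_y' (U1 y y' + (if y' == y0 then \sum_y'' U1 y y'' * c y'' else 0)) *
    (P y' x - c y' * P y0 x) = \sum_y' U1 y y' * P y' x.
  under eq_bigr do rewrite mulrDl.
  rewrite big_split /= [X in _ + X](bigD1 y0) //= eqxx P'0 [X in _ + (_ + X)]big1; last first.
    by move=> y' /negbTE ->; rewrite mul0r.
  rewrite addr0 mulr_suml -big_split; apply: eq_bigr => y' _ /=.
  by rewrite mulrBr mulrA subrK.
have := idealB idJ (h y x) (ideal_mull idJ (c y) (h y0 x)).
congr J; rewrite c0 mul0r addr0 mulrBr mulrDr !mulr_sumr.
have -> : \sum_y' U1 y y' * P y' x = \sum_y' U y y' * P y' x - \sum_y' c y * (U y0 y' * P y' x).
  by rewrite -sumrB; apply: eq_bigr => y' _; rewrite mulrBl !mulrA.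
have -> : \sum_x' (P y x' - c y * P y0 x') * T x' x = \sum_x' P y x' * T x' x - \sum_x' c y * (P y0 x' * T x' x).
  by rewrite -sumrB; apply: eq_bigr => y' _; rewrite mulrBl !mulrA.
rewrite [X in _ = _ - X]addrACA -opprD.
have alg (p q r s : A) : p + q - r - (q - s) = p - (r - s).
  by rewrite !opprB [p + q - r]addrAC addrACA subrr addr0 addrA addrAC.
exact: alg.
Qed.

(** Modulo J the differential is block diagonal, and a homotopy restricts to the complement because
    its terms through [x0] or [y0] lie in J. *)
Lemma rigid_restrict (X Y : finType) (xv : X -> V) (yv : Y -> V) (P : Y -> X -> A) x0 y0 :
  (forall y, y != y0 -> J (P y x0)) -> (forall x, x != x0 -> J (P y0 x)) ->
  rigid xv yv P ->
  rigid (fun x : {x | x != x0} => xv (val x)) (fun y : {y | y != y0} => yv (val y))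
    (fun y x => P (val y) (val x)).
Proof.
move=> Px0 Py0 rP M tM.
pose M' y x := if insub y is Some y' then if insub x is Some x' then M y' x' else 0 else 0.
have [|U [T [tU tT h]]] := rP M'.
  move=> y x; rewrite /M'; case: insubP => [y' _ <-|_]; last exact: btyped0.
  by case: insubP => [x' _ <-|_]; [apply: tM|apply: btyped0].
exists (fun y y' => U (val y) (val y')), (fun x x' => T (val x) (val x')); split=> // y x.
have := h (val y) (val x); rewrite {1}/M' !valK.
rewrite (sum_sub (fun y' => y' != y0) (fun y' => U (val y) y' * P y' (val x))).
rewrite (sum_sub (fun x' => x' != x0) (fun x' => P (val y) x' * T x' (val x))).
rewrite (bigD1 y0) //= (bigD1 x0) //= addrACA opprD addrCA => h'.
have hy := ideal_mull idJ (U (val y) y0) (Py0 _ (valP x)).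
have hx := ideal_mulr idJ (T x0 (val x)) (Px0 _ (valP y)).
have := ideal_add idJ h' (ideal_add idJ hy hx); congr J.
by rewrite addrC; apply: subrK.
Qed.
End Rigid.

Lemma ideal_conv (A : pzRingType) (J : A -> Prop) : ideal J -> ideal (J : A^c -> Prop).
Proof.
by case=> J0 JD Jl Jr; split=> // x y; [apply: Jr|apply: Jl].
Qed.

Lemma btyped_conv (A : pzRingType) (V : finType) (eps : V -> A) u v x :
  btyped eps u v x <-> btyped (eps : V -> A^c) v u x.
Proof. by rewrite /btyped -mulrA. Qed.

(** Over the opposite ring the transposed matrix interchanges X with Y and U with T, so each
    statement about rows yields one about columns. *)
Lemma rigid_conv (A : pzRingType) (V : finType) (eps : V -> A) (J : A -> Prop) (X Y : finType)
    (xv : X -> V) (yv : Y -> V) (P : Y -> X -> A) :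
  rigid eps J xv yv P -> rigid (eps : V -> A^c) J yv xv (fun x y => P y x : A^c).
Proof.
move=> rP M tM; have [|U [T [tU tT h]]] := rP (fun y x => M x y).
  by move=> y x; apply/btyped_conv; apply: tM.
exists (fun x x' => T x' x), (fun y y' => U y' y); split=> [*|*|x y].
- by apply/btyped_conv; apply: tT.
- by apply/btyped_conv; apply: tU.
by have := h y x; rewrite [X in _ - X]addrC.
Qed.

(* A two-term complex of projectives: the elements of [pX] and [pY] are its
   indecomposable summands in the two degrees, labelled by L. *)
Record presentation (A : Type) (V L : finType) := Presentation {
  pX : finType; pY : finType;
  xv : pX -> V; yv : pY -> V; xl : pX -> L; yl : pY -> L;
  pP : pY -> pX -> A
}.

Definition pres_index (A : Type) (V L : finType) (D : presentation A V L) (l : L) (v : V) : int :=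
  \sum_(x : pX D) ((xl x == l) && (xv x == v))%:Z
  - \sum_(y : pY D) ((yl y == l) && (yv y == v))%:Z.

(** * Cancellation of invertible entries *)

Section Cancel.
Variables (K : fieldType) (V : finType) (Q : quiver V) (R : path_ring K Q) (L : finType).
Implicit Types (D : presentation R V L).
Local Notation e v := (vx R v).

(** The second condition makes the complex a direct sum over the labels, whereas [rigid_pres] tests
    matrices between arbitrary labels. *)
Definition wf_pres D := (forall y x, typed (@yv _ _ _ D y) (@xv _ _ _ D x) (pP y x)) /\
  (forall y x, @yl _ _ _ D y != @xl _ _ _ D x -> pP y x = 0).

Definition rigid_pres N W D :=
  rigid (vx R) (near_jac N W) (@xv _ _ _ D) (@yv _ _ _ D) (@pP _ _ _ D).

(** Geometric series: the entry is c times [e u - n], and the sum of the first N powers of n inverts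
    [1 - n] up to [n ^+ N]. *)
Lemma approx_inverse N u c m : c != 0 -> typed u u m -> ord_ge 1 m ->
  exists t, [/\ typed u u t, ord_ge N (t * (c *: e u + m) - e u)
    & ord_ge N ((c *: e u + m) * t - e u)].
Proof.
move=> c0 um m1; pose n := - (c^-1 *: m); pose s := \sum_(i < N) n ^+ i.
have un : typed u u n.
  exact/typedN/typedZ.
have eE : c *: e u + m = c *: (e u - n).
  by rewrite /n opprK scalerDr scalerA mulfV // scale1r.
have nN : ord_ge N (n ^+ N).
  have := @ord_geX _ _ _ R 1 n N; rewrite mul1n; apply.
  by apply: ord_geN; apply: ord_geZ.
have ns : (1 - n) * s = 1 - n ^+ N.
  by have := subrX1 n N; rewrite -/s -(opprB n) mulNr => <-; rewrite opprB.
have sn : s * (1 - n) = 1 - n ^+ N.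
  rewrite -ns mulrBl mulrBr mul1r mulr1; congr (_ - _).
  rewrite /s mulr_suml mulr_sumr; apply: eq_bigr => i _.
  by rewrite -exprS -exprSr.
have e1 : e u * (1 - n) = e u - n by rewrite mulrBr mulr1 (typedl un).
have e2 : (1 - n) * e u = e u - n by rewrite mulrBl mul1r (typedr un).
exists (c^-1 *: (e u * s * e u)); rewrite eE; split.
- exact/typedZ/typed_proj.
- rewrite -scalerAl -scalerAr scalerA mulVf // scale1r.
  have -> : e u * s * e u * (e u - n) = e u - e u * n ^+ N * e u.
    have ee : e u * (e u - n) = (1 - n) * e u by rewrite e2 -e1 mulrA vxK.
    by rewrite -mulrA ee mulrA -(mulrA _ s) sn mulrBr mulr1 mulrBl vxK.
  by rewrite addrAC subrr add0r; apply/ord_geN/ord_geMr/ord_geMl.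
rewrite -scalerAl -scalerAr scalerA mulfV // scale1r.
have -> : (e u - n) * (e u * s * e u) = e u - e u * n ^+ N * e u.
  have ee : (e u - n) * e u = e u * (1 - n) by rewrite mulrBl vxK (typedr un) e1.
  by rewrite !mulrA ee -(mulrA _ _ s) ns mulrBr mulr1 mulrBl vxK.
by rewrite addrAC subrr add0r; apply/ord_geN/ord_geMr/ord_geMl.
Qed.

(** Gaussian elimination with the pivot [pP y0 x0]. The pivot is inverted only up to length N, so
    the cleared entries need not be zero but lie in [near_jac N W], which is enough for
    [rigid_restrict]. *)
Lemma cancel_one N W D y0 x0 c m : wf_pres D -> rigid_pres N W D ->
  @yv _ _ _ D y0 = @xv _ _ _ D x0 -> c != 0 -> ord_ge 1 m ->
  pP y0 x0 = c *: e (xv x0) + m ->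
  exists D1, [/\ wf_pres D1, rigid_pres N W D1, (#|pX D1| < #|pX D|)%N & pres_index D1 =2 pres_index D].
Proof.
move=> [tP lP] rD yx c0 m1 PE; set u := xv x0 in yx PE.
pose J := near_jac N W; have idJ : ideal J by apply: near_jac_ideal.
have tm : typed u u m.
  have -> : m = pP y0 x0 - c *: e u by rewrite PE addrAC subrr add0r.
  apply: typedD; first by have := tP y0 x0; rewrite yx.
  by apply/typedN/typedZ/typed_vx.
have [t [tt tJ Jt]] := approx_inverse N c0 tm m1; rewrite -PE in tJ Jt.
pose cc y := if y == y0 then 0 else pP y x0 * t.
pose P1 y x := pP y x - cc y * pP y0 x.
have tcc y : typed (yv y) (yv y0) (cc y).
  by rewrite /cc; case: eqP => _; [exact: typed0|]; rewrite yx; apply: typedM (tP y x0) tt.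
have vK := @vxK _ _ _ R.
have r1 : rigid (vx R) J (@xv _ _ _ D) (@yv _ _ _ D) P1.
  by apply: rigid_transvection => //; rewrite /cc eqxx.
pose dd x := if x == x0 then 0 else t * pP y0 x.
pose P2 y x := P1 y x - P1 y x0 * dd x.
have tdd x : typed (xv x0) (xv x) (dd x).
  by rewrite /dd; case: eqP => _; [exact: typed0|]; apply: typedM tt _; rewrite -yx.
have r2 : rigid (vx R) J (@xv _ _ _ D) (@yv _ _ _ D) P2.
  (* The column operation is a row operation over the opposite ring. *)
  apply: (@rigid_conv R^c V (vx R) J _ _ (@yv _ _ _ D) (@xv _ _ _ D) (fun x y => P2 y x)).
  apply: (@rigid_transvection R^c V (vx R) J vK (ideal_conv idJ) _ _ _ _ (fun x y => P1 y x) x0 dd).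
  - by rewrite /dd eqxx.
  - by move=> x; apply/btyped_conv; apply: tdd.
  exact: rigid_conv.
have P1x0 y : y != y0 -> J (P1 y x0).
  move=> /negbTE ny; rewrite /P1 /cc ny -mulrA -[X in X - _](typedr (tP y x0)) -mulrBr.
  apply: (ideal_mull idJ); rewrite -(opprB _ (e _)); apply: (idealN idJ).
  exact: near_jac_ord.
have P2x0 y : y != y0 -> J (P2 y x0).
  by move=> ny; rewrite /P2 /dd eqxx mulr0 subr0; apply: P1x0.
have P2y0 x : x != x0 -> J (P2 y0 x).
  move=> /negbTE nx; rewrite /P2 /dd nx /P1 /cc eqxx !mul0r !subr0 mulrA.
  rewrite -[X in X - _](typedl (tP y0 x)) yx -mulrBl.
  apply: (ideal_mulr idJ); rewrite -(opprB _ (e _)); apply: (idealN idJ).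
  exact: near_jac_ord.
exists (@Presentation R V L {x : pX D | x != x0} {y : pY D | y != y0}
  (fun x => xv (val x)) (fun y => yv (val y)) (fun x => xl (val x)) (fun y => yl (val y))
  (fun y x => P2 (val y) (val x))).
(* A pivot between different labels would vanish, and then [e u] would lie in the arrow ideal
   because c is invertible. *)
have l0 : yl y0 = xl x0.
  apply/eqP; apply: contraT => /lP P0; move: PE; rewrite P0 => /esym/eqP.
  rewrite addr_eq0 => /eqP ce; case: (@vx_not_ord_ge1 _ _ _ R u).
  have -> : e u = c^-1 *: (- m) by rewrite -ce scalerA mulVf // scale1r.
  by apply: ord_geZ; apply: ord_geN.
split.
- split=> /= y x.
    have tP1 x' : typed (yv (val y)) (xv x') (P1 (val y) x').
      by apply: typedD => //; apply: typedN; apply: typedM (tcc _) (tP _ _).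
    by apply: typedD; [exact: tP1|apply: typedN; apply: typedM (tP1 x0) (tdd _)].
  move=> nl; rewrite /P2 /P1 (lP _ _ nl) sub0r.
  have [yx0|nyx0] := eqVneq (yl (val y)) (xl x0).
    have z : pP y0 (val x) = 0 by apply: lP; rewrite l0 -yx0.
    by rewrite /dd z !(mulr0, if_same, oppr0, subr0).
  have z : pP (val y) x0 = 0 by apply: lP.
  have cz : cc (val y) = 0 by rewrite /cc z mul0r if_same.
  by rewrite cz z !(mul0r, oppr0, subr0).
- exact: rigid_restrict.
- by rewrite /= card_sig; apply: proper_card; apply/properP; split;
    [apply/subsetP|exists x0; rewrite // unfold_in eqxx].
move=> l v; rewrite /pres_index /=.
rewrite (sum_sub (fun x => x != x0) (fun x => ((xl x == l) && (xv x == v))%:Z)).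
rewrite (sum_sub (fun y => y != y0) (fun y => ((yl y == l) && (yv y == v))%:Z)).
rewrite [in RHS](bigD1 x0) //= [X in _ = _ - X](bigD1 y0) //= l0 yx -/u.
by rewrite opprD addrACA subrr add0r.
Qed.

Lemma minimal_presentation N W D : wf_pres D -> rigid_pres N W D ->
  exists D1, [/\ wf_pres D1, rigid_pres N W D1, pres_index D1 =2 pres_index D
    & forall y x, ord_ge 1 (@pP _ _ _ D1 y x)].
Proof.
have [n] := ubnP #|pX D|; elim: n D => // n IHn D lt wD rD.
case: (classic (forall y x, ord_ge 1 (@pP _ _ _ D y x))) => [h|]; first by exists D.
case/not_all_ex_not => y0 /not_all_ex_not[x0 nP].
have [yx|/eqP nyx] := eqVneq (yv y0) (xv x0); last first.
  by case: nP; apply: typed_ord_ge1 (wD.1 y0 x0); apply/eqP.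
have [c [m m1 PE]] : exists c, exists2 m, ord_ge 1 m & pP y0 x0 = c *: e (xv x0) + m.
  by apply: typed_const; have := wD.1 y0 x0; rewrite yx.
have [c0|c0] := eqVneq c 0.
  by case: nP; rewrite PE c0 scale0r add0r.
have [D1 [w1 r1 lt1 i1]] := cancel_one wD rD yx c0 m1 PE.
have [|D2 [w2 r2 i2 o2]] := IHn D1 _ w1 r1; first by apply: leq_trans lt1 _.
by exists D2; split=> // l v; rewrite i2 i1.
Qed.

Lemma near_jac_ord1 N (W x : R) : (0 < N)%N -> ord_ge 2 W -> near_jac N W x -> ord_ge 1 x.
Proof.
move=> N0 W2; move: x; apply: near_jac_min; first exact: ord_ge_ideal.
  by move=> a; apply: cyc_der_ord.
by move=> y; apply: ord_ge_le.
Qed.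

(** All entries of the differential and the whole Jacobian ideal lie in the arrow ideal, hence so do
    the entries of every null-homotopic matrix; an idempotent does not. *)
Lemma rigid_disjoint N (W : R) D : (0 < N)%N -> ord_ge 2 W -> rigid_pres N W D ->
  (forall y x, ord_ge 1 (@pP _ _ _ D y x)) -> forall y x, @yv _ _ _ D y <> @xv _ _ _ D x.
Proof.
move=> N0 W2 rD P1 y0 x0 yx.
have [|U [T [_ _ h]]] := rD (elementary y0 x0 (e (xv x0))).
  move=> y x; rewrite /elementary; case: ifP => [/andP[/eqP -> /eqP ->]|_].
    by rewrite yx; apply: typed_vx.
  exact: typed0.
have := near_jac_ord1 N0 W2 (h y0 x0); rewrite /elementary !eqxx /=.
set s := (X in _ - X) => o1; apply: (@vx_not_ord_ge1 _ _ _ R (xv x0)).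
rewrite -[e _](subrK s); apply: ord_geD => //; rewrite /s.
by apply: ord_geD; apply: ord_ge_sum => ? _; [apply: ord_geMl|apply: ord_geMr].
Qed.
End Cancel.

(** * Premutation *)

Section Strip.
Variables (K : fieldType) (V : finType) (Q : quiver V) (R : path_ring K Q).
Implicit Types (x y z : R) (u v : V) (w : seq (arrow Q)) (a b : arrow Q).
Local Notation wd := (@wd K V Q R).
Local Notation e v := (@vx K V Q R v).
Local Notation arr := (@arrow_elt K V Q R).

Definition strip_first a : {linear R -> R} :=
  wd_lift R (fun v w => if w is b :: w' then if a == b then wd (src b) w' else 0 else 0).
Definition strip_last a : {linear R -> R} :=
  wd_lift R (fun v w => if w is b :: w' then
                          if a == last b w' then wd v (belast b w') else 0 else 0).

Lemma wd_rcons v w b : path_end v w = tgt b -> wd v (rcons w b) = wd v w * arr b.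
Proof. by move=> h; rewrite wd_mul h eqxx cats1. Qed.

Lemma strip_first_wd a v w : is_path v w ->
  strip_first a (wd v w) = if w is b :: w' then if a == b then wd (src b) w' else 0 else 0.
Proof. by move=> wP; rewrite wd_liftE. Qed.

Lemma strip_last_wd a v w : is_path v w -> strip_last a (wd v w) =
  if w is b :: w' then if a == last b w' then wd v (belast b w') else 0 else 0.
Proof. by move=> wP; rewrite wd_liftE. Qed.

Lemma strip_last_rcons a v w b : is_path v (rcons w b) ->
  strip_last a (wd v (rcons w b)) = if a == b then wd v w else 0.
Proof.
move=> wP; rewrite strip_last_wd //; case: w wP => [|c w] _ //=.
by rewrite last_rcons belast_rcons.
Qed.

Lemma strip_first_vx a v : strip_first a (e v) = 0.
Proof. by rewrite strip_first_wd. Qed.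
Lemma strip_last_vx a v : strip_last a (e v) = 0.
Proof. by rewrite strip_last_wd. Qed.

Lemma strip_first_arr a b x : strip_first a (arr b * x) = if a == b then e (src b) * x else 0.
Proof.
move: x; apply: wd_ind.
  split=> [|x y e1 e2|c x e1].
  - by rewrite !mulr0 linear0 if_same.
  - by rewrite !mulrDr linearD /= e1 e2; case: ifP; rewrite ?addr0.
  - by rewrite -!scalerAr linearZ /= e1; case: ifP; rewrite ?scaler0.
move=> v w wP; rewrite vx_wd wd_mul /path_end /=; case: eqP => [bv|_]; last by rewrite linear0 if_same.
by rewrite strip_first_wd /= ?eqxx bv.
Qed.

Lemma strip_last_arr a b x : strip_last a (x * arr b) = if a == b then x * e (tgt b) else 0.
Proof.
move: x; apply: wd_ind.
  split=> [|x y e1 e2|c x e1].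
  - by rewrite !mul0r linear0 if_same.
  - by rewrite !mulrDl linearD /= e1 e2; case: ifP; rewrite ?addr0.
  - by rewrite -!scalerAl linearZ /= e1; case: ifP; rewrite ?scaler0.
move=> v w wP; rewrite wd_vx wd_mul; case: eqP => [we|_]; last by rewrite linear0 if_same.
by rewrite cats1 strip_last_rcons // -cats1 is_path_cat wP /= -/(path_end v w) we eqxx.
Qed.

(** The arrow ideal is the direct sum of the right ideals generated by the arrows, and
    [strip_first a] is the coordinate at a. *)
Lemma strip_first_dec x : ord_ge 1 x -> x = \sum_a arr a * strip_first a x.
Proof.
move: x; apply: ord_ge_ind.
  split=> [|x y e1 e2|c x e1].
  - by rewrite big1 // => a _; rewrite linear0 mulr0.
  - rewrite {1}e1 {1}e2 -big_split; apply: eq_bigr => a _ /=.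
    by rewrite linearD mulrDr.
  - rewrite {1}e1 scaler_sumr; apply: eq_bigr => a _ /=.
    by rewrite linearZ -scalerAr.
move=> v [|b w] // wP _; rewrite (bigD1 b) //= big1 ?addr0 => [|a /negbTE na]; last first.
  by rewrite strip_first_wd // na mulr0.
by rewrite strip_first_wd // eqxx wd_cons; move: wP => /= /andP[-> _].
Qed.

Lemma strip_last_dec x : ord_ge 1 x -> x = \sum_a strip_last a x * arr a.
Proof.
move: x; apply: ord_ge_ind.
  split=> [|x y e1 e2|c x e1].
  - by rewrite big1 // => a _; rewrite linear0 mul0r.
  - rewrite {1}e1 {1}e2 -big_split; apply: eq_bigr => a _ /=.
    by rewrite linearD mulrDl.
  - rewrite {1}e1 scaler_sumr; apply: eq_bigr => a _ /=.
    by rewrite linearZ -scalerAl.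
move=> v w; case/lastP: w => [//|w b] wP _.
rewrite (bigD1 b) //= big1 ?addr0 => [|a /negbTE na]; last first.
  by rewrite strip_last_rcons // na mul0r.
rewrite strip_last_rcons // eqxx wd_rcons //.
by move: wP; rewrite -cats1 is_path_cat /= andbT => /andP[_ /eqP ->].
Qed.

Lemma strip_firstM a x y : ord_ge 1 x -> strip_first a (x * y) = strip_first a x * y.
Proof.
move=> x1; rewrite {1}(strip_first_dec x1) mulr_suml linear_sum (bigD1 a) //= big1 ?addr0.
  rewrite -mulrA strip_first_arr eqxx mulrA.
  have -> : e (src a) * strip_first a x = strip_first a (arr a * strip_first a x).
    by rewrite strip_first_arr eqxx.
  rewrite {2}(strip_first_dec x1) linear_sum (bigD1 a) //= big1 ?addr0 // => b nb.
  by rewrite strip_first_arr eq_sym (negbTE nb).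
by move=> b nb; rewrite -mulrA strip_first_arr eq_sym (negbTE nb).
Qed.

Lemma strip_lastM a x y : ord_ge 1 y -> strip_last a (x * y) = x * strip_last a y.
Proof.
move=> y1; rewrite {1}(strip_last_dec y1) mulr_sumr linear_sum (bigD1 a) //= big1 ?addr0.
  rewrite mulrA strip_last_arr eqxx -mulrA.
  have -> : strip_last a y * e (tgt a) = strip_last a (strip_last a y * arr a).
    by rewrite strip_last_arr eqxx.
  rewrite {2}(strip_last_dec y1) linear_sum (bigD1 a) //= big1 ?addr0 // => b nb.
  by rewrite strip_last_arr eq_sym (negbTE nb).
by move=> b nb; rewrite mulrA strip_last_arr eq_sym (negbTE nb).
Qed.

Lemma strip_first_vxM a v x : strip_first a (e v * x) = if v == tgt a then strip_first a x else 0.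
Proof.
move: x; apply: wd_ind.
  split=> [|x y e1 e2|c x e1].
  - by rewrite mulr0 linear0 if_same.
  - by rewrite mulrDr !linearD /= e1 e2; case: ifP; rewrite ?addr0.
  - by rewrite -scalerAr !linearZ /= e1; case: ifP; rewrite ?scaler0.
move=> v' [|b w] wP; rewrite vx_wd.
  by rewrite strip_first_vx; case: ifP; rewrite ?linear0 ?strip_first_vx !if_same.
move: (wP) => /= /andP[/eqP tb _].
case: (eqVneq a b) => [ab|/negbTE nab].
  by rewrite ab tb; case: ifP; rewrite ?linear0.
by rewrite [in RHS]strip_first_wd // nab if_same; case: ifP; rewrite ?linear0 ?strip_first_wd ?nab.
Qed.

Lemma strip_last_Mvx a v x : strip_last a (x * e v) = if src a == v then strip_last a x else 0.
Proof.
move: x; apply: wd_ind.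
  split=> [|x y e1 e2|c x e1].
  - by rewrite mul0r linear0 if_same.
  - by rewrite mulrDl !linearD /= e1 e2; case: ifP; rewrite ?addr0.
  - by rewrite -scalerAl !linearZ /= e1; case: ifP; rewrite ?scaler0.
move=> v' w; case/lastP: w => [|w b] wP; rewrite wd_vx.
  by rewrite strip_last_vx; case: ifP; rewrite ?linear0 ?strip_last_vx !if_same.
have -> : path_end v' (rcons w b) = src b by rewrite /path_end map_rcons last_rcons.
case: (eqVneq a b) => [->|/negbTE nab]; first by case: ifP; rewrite ?linear0.
by rewrite [in RHS]strip_last_rcons // nab if_same; case: ifP; rewrite ?linear0 ?strip_last_rcons ?nab.
Qed.

Lemma strip_first_typed a x : e (src a) * strip_first a x = strip_first a x.
Proof.
move: x; apply: wd_ind.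
  split=> [|x y e1 e2|c x e1].
  - by rewrite linear0 mulr0.
  - by rewrite linearD /= mulrDr e1 e2.
  - by rewrite linearZ /= -scalerAr e1.
move=> v [|b w] wP; rewrite strip_first_wd // ?mulr0 //.
by case: eqP => [->|_]; rewrite ?vx_wdK ?mulr0.
Qed.

Lemma strip_last_typed a x : strip_last a x * e (tgt a) = strip_last a x.
Proof.
move: x; apply: wd_ind.
  split=> [|x y e1 e2|c x e1].
  - by rewrite linear0 mul0r.
  - by rewrite linearD /= mulrDl e1 e2.
  - by rewrite linearZ /= -scalerAl e1.
move=> v w; case/lastP: w => [|w b] wP; first by rewrite strip_last_vx mul0r.
rewrite strip_last_rcons //; case: eqP => [->|_]; last by rewrite mul0r.
rewrite wd_vx; move: wP; rewrite -cats1 is_path_cat /= andbT => /andP[_].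
by rewrite eq_sym -/(path_end v w) => ->.
Qed.

Lemma typed_strip_first a u v x : typed u v x -> typed (src a) v (strip_first a x).
Proof.
move=> ux; apply: typedP; first exact: strip_first_typed.
rewrite -[in RHS](typedr ux).
move: x {ux}; apply: wd_ind.
  split=> [|x y e1 e2|c x e1].
  - by rewrite mul0r linear0 mul0r.
  - by rewrite mulrDl !linearD /= mulrDl e1 e2.
  - by rewrite -scalerAl !linearZ /= -scalerAl e1.
move=> v' [|b w] wP; rewrite ?strip_first_wd //.
  by rewrite mul0r wd_vx; case: ifP; rewrite ?linear0 ?strip_first_vx.
by rewrite strip_firstM ?strip_first_wd //; apply: ord_ge_wd.
Qed.

Lemma typed_strip_last a u v x : typed u v x -> typed u (tgt a) (strip_last a x).
Proof.
move=> ux; apply: typedP; last exact: strip_last_typed.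
rewrite -[in RHS](typedl ux).
move: x {ux}; apply: wd_ind.
  split=> [|x y e1 e2|c x e1].
  - by rewrite mulr0 linear0 mulr0.
  - by rewrite mulrDr !linearD /= mulrDr e1 e2.
  - by rewrite -scalerAr !linearZ /= -scalerAr e1.
move=> v' [|b w] wP; rewrite ?strip_last_wd //.
  by rewrite mulr0 vx_wd; case: ifP; rewrite ?linear0 ?strip_last_vx.
by rewrite strip_lastM ?strip_last_wd //; apply: ord_ge_wd.
Qed.

Lemma strip_first_ord N a x : ord_ge N.+1 x -> ord_ge N (strip_first a x).
Proof.
move: x; apply: ord_ge_ind.
  split=> [|x y|c x]; rewrite ?linear0 ?linearD ?linearZ /=.
  - exact: ord_ge0.
  - exact: ord_geD.
  - exact: ord_geZ.
move=> v [|b w] // wP wN; rewrite strip_first_wd //.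
by case: ifP => _; [apply: ord_ge_wd|apply: ord_ge0].
Qed.

Lemma strip_last_ord N a x : ord_ge N.+1 x -> ord_ge N (strip_last a x).
Proof.
move: x; apply: ord_ge_ind.
  split=> [|x y|c x]; rewrite ?linear0 ?linearD ?linearZ /=.
  - exact: ord_ge0.
  - exact: ord_geD.
  - exact: ord_geZ.
move=> v w; case/lastP: w => [//|w b] wP; rewrite size_rcons => wN; rewrite strip_last_rcons //.
by case: ifP => _; [apply: ord_ge_wd|apply: ord_ge0].
Qed.

Lemma strip_first_dec_at u v x : typed u v x -> ord_ge 1 x ->
  x = \sum_(a : {a | tgt a == u}) arr (val a) * strip_first (val a) x.
Proof.
move=> ux x1; rewrite {1}(strip_first_dec x1) (sum_sub (fun a => tgt a == u) (fun a => arr a * strip_first a x)).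
rewrite (bigID (fun a => tgt a == u)) /= [X in _ + X]big1 ?addr0 // => a na.
by rewrite -(typedl ux) strip_first_vxM eq_sym (negbTE na) mulr0.
Qed.

Lemma strip_last_dec_at u v x : typed u v x -> ord_ge 1 x ->
  x = \sum_(a : {a | src a == v}) strip_last (val a) x * arr (val a).
Proof.
move=> ux x1; rewrite {1}(strip_last_dec x1) (sum_sub (fun a => src a == v) (fun a => strip_last a x * arr a)).
rewrite (bigID (fun a => src a == v)) /= [X in _ + X]big1 ?addr0 // => a na.
by rewrite -(typedr ux) strip_last_Mvx (negbTE na) mul0r.
Qed.
End Strip.

Section Blocks.
Variables (K : fieldType) (V : finType) (Q : quiver V) (k : V).
Variables (R : path_ring K Q) (R' : path_ring K (premutation k Q)).
Hypothesis Qlf : loop_free Q.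
Local Notation Q' := (premutation k Q).
Local Notation e v := (@vx K V Q R v).
Local Notation e' v := (@vx K V Q' R' v).
Local Notation arr := (@arrow_elt K V Q R).
Local Notation arr' := (@arrow_elt K V Q' R').

Definition arrow_in : finType := {a : arrow Q | tgt a == k}.
Definition arrow_out : finType := {b : arrow Q | src b == k}.
Implicit Types (a : arrow_in) (b : arrow_out) (c : arrow Q) (w : seq (arrow Q)).

Lemma composable a b : through k (val a, val b).
Proof. by apply/andP; split; [exact: valP a|exact: valP b]. Qed.
Definition composite a b : arrow Q' := inr (exist _ (val a, val b) (composable a b)).

Lemma src_in a : src (val a) != k.
Proof. by apply/eqP => sa; apply: (Qlf (a := val a)); rewrite sa (eqP (valP a)). Qed.
Lemma tgt_out b : tgt (val b) != k.
Proof. by apply/eqP => sa; apply: (Qlf (a := val b)); rewrite sa (eqP (valP b)). Qed.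

Definition iarr a : R := arr (val a).
Definition oarr b : R := arr (val b).
Definition istar a : R' := arr' (inl (val a)).
Definition ostar b : R' := arr' (inl (val b)).
Definition comp_arr a b : R' := arr' (composite a b).

Lemma typed_iarr a : typed k (src (val a)) (iarr a).
Proof. by have := typed_arr R (val a); rewrite (eqP (valP a)). Qed.
Lemma typed_oarr b : typed (tgt (val b)) k (oarr b).
Proof. by have := typed_arr R (val b); rewrite (eqP (valP b)). Qed.
Lemma typed_istar a : typed (src (val a)) k (istar a).
Proof.
by have := typed_arr R' (inl (val a)); rewrite /= /incident (eqP (valP a)) eqxx orbT.
Qed.
Lemma typed_ostar b : typed k (tgt (val b)) (ostar b).
Proof. by have := typed_arr R' (inl (val b)); rewrite /= /incident (eqP (valP b)) eqxx. Qed.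
Lemma typed_comp a b : typed (tgt (val b)) (src (val a)) (comp_arr a b).
Proof. exact: (typed_arr R' (composite a b)). Qed.
Lemma typed_keep c : ~~ incident k c -> typed (tgt c) (src c) (arr' (inl c)).
Proof. by move=> /negbTE nc; have := typed_arr R' (inl c); rewrite /= nc. Qed.

Lemma bracket_word_keep c w : src c != k ->
  bracket_word k (c :: w) = inl c :: bracket_word k w :> seq (arrow Q').
Proof.
by case: w => [|d w] sc //=; rewrite insubF //= /through /= (negbTE sc) andbF.
Qed.

Lemma bracket_word_comp a b w :
  bracket_word k (val b :: val a :: w) = composite a b :: bracket_word k w :> seq (arrow Q').
Proof. by rewrite /= insubT /=; [exact: composable|move=> p; congr (inr _ :: _); apply: val_inj]. Qed.

(** A letter of the bracketed word stands for at most two arrows; this is the source of the halving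
    of N. *)
Lemma bracket_word_size w : (size w <= (size (bracket_word k w)).*2)%N.
Proof.
have [n] := ubnP (size w); elim: n w => [|n IHn] [|c [|d w]] //= wn.
case: insub => [p|] /=; rewrite doubleS !ltnS.
  by apply: IHn; rewrite -ltnS; apply: ltnW.
by apply: ltnW; apply: (IHn (d :: w)).
Qed.

Definition br : {linear R -> R'} := wd_lift R (fun v w => wd R' v (bracket_word k w)).

Lemma br_wd v w : is_path v w -> br (wd R v w) = wd R' v (bracket_word k w).
Proof. by move=> wP; rewrite /br wd_liftE. Qed.

Lemma br_vx v : br (e v) = e' v.
Proof. exact: br_wd. Qed.

Lemma br_vxM v x : br (e v * x) = e' v * br x.
Proof.
move: x; apply: wd_ind.
  split=> [|x y h1 h2|c x h1]; rewrite ?mulr0 ?linear0 ?mulr0 ?mulrDr ?linearD /= ?mulrDr ?h1 ?h2 //.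
  by rewrite -scalerAr !linearZ /= h1 -scalerAr.
by move=> v' w wP; rewrite vx_wd br_wd // vx_wd; case: ifP; rewrite ?linear0 ?br_wd.
Qed.

Lemma br_keep c x : ~~ incident k c -> br (arr c * x) = arr' (inl c) * br x.
Proof.
move=> nc; have [sc _] := norP nc; move: x; apply: wd_ind.
  split=> [|x y h1 h2|d x h1]; rewrite ?mulr0 ?linear0 ?mulr0 ?mulrDr ?linearD /= ?mulrDr ?h1 ?h2 //.
  by rewrite -scalerAr !linearZ /= h1 -scalerAr.
move=> v w wP; rewrite br_wd // !wd_mul /path_end /= (negbTE nc).
case: eqP => [sv|_]; rewrite ?linear0 // br_wd ?cat1s ?bracket_word_keep //.
by rewrite /= eqxx sv.
Qed.

Lemma br_comp a b x : br (oarr b * (iarr a * x)) = comp_arr a b * br x.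
Proof.
move: x; apply: wd_ind.
  split=> [|x y h1 h2|d x h1]; rewrite ?mulr0 ?linear0 ?mulr0 ?mulrDr ?linearD /= ?mulrDr ?h1 ?h2 //.
  by rewrite -!scalerAr !linearZ /= h1 -scalerAr.
move=> v w wP; rewrite br_wd // wd_mul /path_end /=.
case: eqP => [sv|sv]; last first.
  by rewrite mulr0 linear0 wd_mul /path_end /=; case: eqP.
have ab : src (val b) = tgt (val a) by rewrite (eqP (valP a)) (eqP (valP b)).
rewrite wd_mul /path_end /= ab eqxx br_wd; last by rewrite /= ab sv !eqxx.
by rewrite [comp_arr a b * _]wd_mul /path_end /= sv eqxx -bracket_word_comp.
Qed.

Lemma br_ord M N x : (N.*2 <= M.+1)%N -> ord_ge M x -> ord_ge N (br x).
Proof.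
move=> NM; move: x; apply: ord_ge_ind.
  split=> [|x y|c x]; rewrite ?linear0 ?linearD ?linearZ /=.
  - exact: ord_ge0.
  - exact: ord_geD.
  - exact: ord_geZ.
move=> v w wP wM; rewrite br_wd //; apply: ord_ge_wd.
rewrite -ltnS -ltn_double doubleS ltnS; apply: leq_trans NM _; rewrite ltnS.
exact: leq_trans wM (bracket_word_size w).
Qed.

Lemma typed_path_ind (S : quiver V) (T : path_ring K S) (P : T -> Prop) u v : is_lin P ->
  (forall w : seq (arrow S), is_path u w -> path_end u w = v -> P (wd T u w)) -> forall x, typed u v x -> P x.
Proof.
move=> [P0 PD PZ] Pw x ->; move: x; apply: wd_ind.
  split=> [|x y h1 h2|c x h1]; rewrite ?mulr0 ?mul0r // ?mulrDr ?mulrDl -?scalerAr -?scalerAl; [exact: PD|exact: PZ].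
move=> v' w wP; rewrite vx_wd; case: eqP => [uv|_]; last by rewrite mul0r.
rewrite wd_vx; case: eqP => // we; rewrite -uv; apply: Pw; by rewrite uv.
Qed.

Section Induction.
Variables (v : V) (vk : v != k).

(* A path between vertices other than k splits into arrows not incident to k
   and composites through k. *)
Lemma block_ind (P : V -> R -> Prop) : (forall u, is_lin (P u)) -> P v (e v) ->
  (forall c x, ~~ incident k c -> P (src c) x -> P (tgt c) (arr c * x)) ->
  (forall a b x, P (src (val a)) x -> P (tgt (val b)) (oarr b * (iarr a * x))) ->
  forall u x, u != k -> typed u v x -> P u x.
Proof.
move=> lP Pv Pc Pab u x uk; apply: (typed_path_ind (lP u)) => w.
have [n] := ubnP (size w); elim: n w u uk => // n IHn [|c w] u uk /=.
  by move=> _ _; rewrite /path_end /= => ->.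
rewrite ltnS => wn /andP[/eqP tc wP] we.
rewrite wd_cons tc eqxx.
have [sck|sck] := eqVneq (src c) k; last first.
  rewrite -tc; apply: Pc; first by rewrite /incident (negbTE sck) tc.
  exact: IHn.
case: w wn wP we => [|d w] wn /=; first by move=> _ we; case/eqP: vk; rewrite -we.
case/andP=> /eqP td wP we; have dk : tgt d == k by rewrite td sck.
have ck : src c == k by rewrite sck.
rewrite wd_cons td eqxx -tc; apply: (Pab (exist _ d dk) (exist _ c ck)) => /=.
apply: IHn => //; do ?[exact: ltnW|exact: (src_in (exist _ d dk))].
Qed.

(** A path of the premutation can pass through k only by some [istar a * ostar b]: a composite
    ending at k would require a loop at k. *)
Lemma block_ind' (P : V -> R' -> Prop) : (forall u, is_lin (P u)) -> P v (e' v) ->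
  (forall c z, ~~ incident k c -> P (src c) z -> P (tgt c) (arr' (inl c) * z)) ->
  (forall a b z, P (src (val a)) z -> P (tgt (val b)) (comp_arr a b * z)) ->
  (forall a b z, P (tgt (val b)) z -> P (src (val a)) (istar a * (ostar b * z))) ->
  forall u z, u != k -> typed u v z -> P u z.
Proof.
move=> lP Pv Pc Pab Pba u x uk; apply: (typed_path_ind (lP u)) => w.
have [n] := ubnP (size w); elim: n w u uk => // n IHn [|c w] u uk /=.
  by move=> _ _; rewrite /path_end /= => ->.
rewrite ltnS => wn /andP[tc wP] we; rewrite wd_cons tc; move/eqP: tc => tc.
case: c tc wP we => [c|[[c d] cd]] /=.
  case: ifP => [ic|/negbT nc] tc wP we; last first.
    rewrite -tc; apply: Pc => //; apply: IHn => //.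
      by case/norP: nc.
    by rewrite -we /path_end /= (negbTE nc).
  have ck : tgt c == k by case/orP: ic => // sck; case/eqP: uk; rewrite -tc (eqP sck).
  case: w wn wP we => [|d w] wn /=.
    by rewrite /path_end /= ic (eqP ck) => _ we; case/eqP: vk.
  case/andP=> td wP we; rewrite wd_cons td; have {}wn : (size w < n)%N by apply: ltnW.
  case: d td wP we => [d|[[c' d] cd]] /=; last first.
    case/andP: (cd) => /= _ /eqP sd /eqP td; case: (Qlf (a := d)); rewrite sd.
    by rewrite td (eqP ck).
  rewrite (eqP ck); case: ifP => [id|nd]; last by move=> td; case/norP: (negbT nd); rewrite td.
  move=> sd wP we; rewrite -tc; apply: (Pba (exist _ c ck) (exist _ d sd)) => /=.
  apply: IHn => //; first exact: (tgt_out (exist _ d sd)).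
  by rewrite -we /path_end /= id.
case/andP: (cd) => /= ck dk td wP we; rewrite -td.
have := Pab (exist _ c ck) (exist _ d dk) (wd R' (src c) w).
rewrite /comp_arr (_ : composite _ _ = inr (exist _ (c, d) cd)) /=; last by congr inr; apply: val_inj.
apply; apply: IHn => //; exact: (src_in (exist _ c ck)).
Qed.

Lemma br_typed u x : u != k -> typed u v x -> typed u v (br x).
Proof.
move=> uk; apply: (block_ind (P := fun u x => typed u v (br x))) u x uk => [u| |c x nc|a b x].
- by split=> [|x y|c x]; rewrite ?linear0 ?linearD ?linearZ /=; [exact: typed0|exact: typedD|exact: typedZ].
- by rewrite br_vx; apply: typed_vx.
- by rewrite br_keep //; apply: typedM; apply: typed_keep.
- by rewrite br_comp; apply: typedM; apply: typed_comp.
Qed.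

(** A cut at a vertex other than k never separates the two arrows of a composite. *)
Lemma brM u x y : u != k -> typed u v x -> br (x * y) = br x * br y.
Proof.
move=> uk; apply: (block_ind (P := fun u x => br (x * y) = br x * br y)) u x uk => [u| |c x nc|a b x].
- split=> [|x x' h1 h2|c x h]; rewrite ?mul0r ?linear0 ?mul0r ?mulrDl ?linearD /= ?mulrDl ?h1 ?h2 //.
  by rewrite -scalerAl !linearZ /= h -scalerAl.
- by rewrite br_vxM br_vx.
- by rewrite -mulrA !br_keep // => ->; rewrite mulrA.
- by rewrite -!mulrA !br_comp => ->; rewrite mulrA.
Qed.
End Induction.

Lemma br_arr c : ~~ incident k c -> br (arr c) = arr' (inl c).
Proof. by move=> /negbTE nc; rewrite br_wd /= ?eqxx // /arrow_elt /= nc. Qed.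

Lemma br_oarr_iarr a b : br (oarr b * iarr a) = comp_arr a b.
Proof.
rewrite -[iarr a](typedr (typed_iarr a)) br_comp br_vx; exact: (typedr (typed_comp a b)).
Qed.

Section Derivative.
Variables (d : arrow Q') (v : V) (vk : v != k) (D : R -> R -> R).
Hypothesis D_lin : forall z, linear (D^~ z).
Hypothesis D_vx : forall z, D (e v) z = 0.
Hypothesis D_keep : forall c x z, ~~ incident k c -> typed (src c) v x -> typed v (tgt c) z ->
  D (arr c * x) z = (if d == inl c then x * z else 0) + D x (z * arr c).
Hypothesis D_comp : forall a b x z, typed (src (val a)) v x -> typed v (tgt (val b)) z ->
  D (oarr b * (iarr a * x)) z =
    (if d == composite a b then x * z else 0) + D x (z * (oarr b * iarr a)).

(** One induction for all kinds of arrows d: any D that obeys the product rule on the two types of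
    blocks describes the derivative of a bracketed element. *)
Lemma cyc_der_br u p z : u != k -> typed u v p -> typed v u z ->
  cyc_der d (br p) (br z) = br (D p z).
Proof.
move=> uk tp; suff [_ h] : typed u v p /\ forall z, typed v u z -> cyc_der d (br p) (br z) = br (D p z).
  exact: h.
have D0 y : D 0 y = 0 by have := D_lin y (-1) 0 0; rewrite scaler0 addr0 scaleN1r addNr.
move: u p uk tp {z}.
apply: (block_ind vk (P := fun u p => typed u v p /\ forall z, typed v u z -> cyc_der d (br p) (br z) = br (D p z))).
- move=> u; split=> [|x y [tx hx] [ty hy]|c x [tx hx]].
  + by split=> [|z _]; [exact: typed0|rewrite D0 !linear0 cyc_der0l].
  + split=> [|z tz]; first exact: typedD.
    have -> : D (x + y) z = D x z + D y z by rewrite -[x]scale1r D_lin !scale1r.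
    by rewrite !linearD /= cyc_derDl hx ?hy.
  + split=> [|z tz]; first exact: typedZ.
    have -> : D (c *: x) z = c *: D x z by rewrite -[_ *: x]addr0 D_lin D0 addr0.
    by rewrite !linearZ /= cyc_derZl hx.
- by split=> [|z _]; [exact: typed_vx|rewrite D_vx linear0 br_vx cyc_der_vx].
- move=> c x nc [tx hx]; split=> [|z tz]; first exact: typedM (typed_arr R c) tx.
  have [sc tc] := norP nc.
  rewrite D_keep // br_keep // cyc_derM linearD /=; congr (_ + _).
    rewrite cyc_der_arr; case: eqP => [->|_]; last by rewrite linear0.
    rewrite /= (negbTE nc) -(brM vk _ sc tx).
    by have := br_typed tc sc (typedM tx tz).
  rewrite -(br_arr nc) -(brM tc _ vk tz); apply: hx; exact: typedM tz (typed_arr R c).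
- move=> a b x [tx hx]; split=> [|z tz].
    exact: typedM (typed_oarr b) (typedM (typed_iarr a) tx).
  rewrite D_comp // br_comp // cyc_derM linearD /=; congr (_ + _).
    rewrite cyc_der_arr; case: eqP => [->|_]; last by rewrite linear0.
    rewrite /= -(brM vk _ (src_in a) tx).
    by have := br_typed (tgt_out b) (src_in a) (typedM tx tz).
  rewrite -br_oarr_iarr -(brM (tgt_out b) _ vk tz); apply: hx.
  exact: typedM tz (typedM (typed_oarr b) (typed_iarr a)).
Qed.
End Derivative.

Lemma val_in_neq_out a b : (val a == val b) = false.
Proof. by apply/negbTE; apply: contraNneq (src_in a) => ->; exact: valP b. Qed.
Lemma keep_neq_in c a : ~~ incident k c -> (c == val a) = false.
Proof. by move=> /norP[_ nc]; apply/negbTE; apply: contraNneq nc => ->; exact: valP a. Qed.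
Lemma keep_neq_out c b : ~~ incident k c -> (c == val b) = false.
Proof. by move=> /norP[nc _]; apply/negbTE; apply: contraNneq nc => ->; exact: valP b. Qed.

Lemma cyc_der_linearl (d : arrow Q) z : linear (fun x : R => cyc_der d x z).
Proof. exact: cyc_der_is_linear. Qed.

Lemma cyc_der_comp d a b x z : cyc_der d (oarr b * (iarr a * x)) z =
  (if d == val b then e (src d) * (iarr a * x * z) * e (tgt d) else 0) +
  ((if d == val a then e (src d) * (x * (z * oarr b)) * e (tgt d) else 0) +
   cyc_der d x (z * (oarr b * iarr a))).
Proof. by rewrite !cyc_derM !cyc_der_arr !mulrA. Qed.

Lemma cyc_der_br_keep c u v p z : ~~ incident k c -> u != k -> v != k ->
  typed u v p -> typed v u z -> cyc_der (inl c : arrow Q') (br p) (br z) = br (cyc_der c p z).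
Proof.
move=> nc uk vk; apply: (cyc_der_br vk (D := fun p z => cyc_der c p z)) uk => [z'|z'|d x y nd tx ty|a b x y tx ty].
- exact: cyc_der_linearl.
- exact: cyc_der_vx.
- rewrite cyc_derM cyc_der_arr (_ : (inl c == inl d :> arrow Q') = (c == d)) //; congr (_ + _).
  case: eqP => // ->; exact: (esym (typedM tx ty)).
- by rewrite cyc_der_comp keep_neq_in // keep_neq_out // !add0r.
Qed.

Lemma composite_eq a b a' b' : (composite a b == composite a' b') = (a == a') && (b == b').
Proof. by []. Qed.

(** Differentiating at a leaves the cycle cut open just after b, so the occurrences of the composite
    are those ending in b. [cyc_der_br_comp'] starts from b instead. *)
Lemma cyc_der_br_comp a b u v p z : u != k -> v != k -> typed u v p -> typed v u z ->
  cyc_der (composite a b) (br p) (br z) = br (strip_last R (val b) (cyc_der (val a) p z)).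
Proof.
move=> uk vk; apply: (cyc_der_br vk (D := fun p z => strip_last R (val b) (cyc_der (val a) p z))) uk.
- by move=> z' c x y; rewrite cyc_der_linearl linearP.
- by move=> z'; rewrite cyc_der_vx linear0.
- by move=> d x y nd tx ty; rewrite cyc_derM cyc_der_arr [val a == d]eq_sym keep_neq_in ?add0r.
move=> a' b' x y tx ty; rewrite cyc_der_comp val_in_neq_out add0r linearD; congr (_ + _).
rewrite composite_eq; case: (a =P a') => [->|na] /=; last first.
  by rewrite (_ : (val a == val a') = false) ?linear0 //; apply/eqP => /val_inj.
rewrite eqxx (eqP (valP a')) -!mulrA (typedr (typed_oarr b')) !mulrA strip_last_arr.
case: (b =P b') => [->|nb]; last by rewrite (_ : (val b == val b') = false) //; apply/eqP => /val_inj.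
by rewrite eqxx -!mulrA (typedr ty) mulrA (typedl tx).
Qed.

Lemma cyc_der_br_comp' a b u v p z : u != k -> v != k -> typed u v p -> typed v u z ->
  cyc_der (composite a b) (br p) (br z) = br (strip_first R (val a) (cyc_der (val b) p z)).
Proof.
move=> uk vk; apply: (cyc_der_br vk (D := fun p z => strip_first R (val a) (cyc_der (val b) p z))) uk.
- by move=> z' c x y; rewrite cyc_der_linearl linearP.
- by move=> z'; rewrite cyc_der_vx linear0.
- by move=> d x y nd tx ty; rewrite cyc_derM cyc_der_arr [val b == d]eq_sym keep_neq_out ?add0r.
move=> a' b' x y tx ty; rewrite cyc_der_comp [val b == val a']eq_sym val_in_neq_out add0r linearD; congr (_ + _).
rewrite composite_eq andbC; case: (b =P b') => [->|nb] /=; last first.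
  by rewrite (_ : (val b == val b') = false) ?linear0 //; apply/eqP => /val_inj.
rewrite eqxx (eqP (valP b')) !mulrA (typedl (typed_iarr a')) -!mulrA strip_first_arr.
case: (a =P a') => [->|na]; last by rewrite (_ : (val a == val a') = false) //; apply/eqP => /val_inj.
by rewrite eqxx (typedr ty) mulrA (typedl tx).
Qed.

Lemma cyc_der_br_star d u v p z : incident k d -> u != k -> v != k -> typed u v p ->
  typed v u z -> cyc_der (inl d : arrow Q') (br p) (br z) = 0.
Proof.
move=> id uk vk tp tz; rewrite -(linear0 br).
apply: (cyc_der_br vk (D := fun _ _ => 0)) uk tp tz => [z' c x y|//|c x y nc _ _|a b x y _ _].
- by rewrite scaler0 addr0.
- rewrite addr0 (_ : (inl d == inl c :> arrow Q') = (d == c)) //.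
  by case: eqP nc => // <-; rewrite id.
- by rewrite addr0.
Qed.

Definition triangle_sum : R' := \sum_a \sum_b comp_arr a b * (istar a * ostar b).

Lemma triangle_sumE : triangle_sum = \sum_(c : {c : arrow Q * arrow Q | through k c})
  wd R' (tgt (val c).2) [:: inr c; inl (val c).1; inl (val c).2].
Proof.
rewrite /triangle_sum pair_bigA /=.
rewrite (reindex (fun p : arrow_in * arrow_out => exist _ (val p.1, val p.2) (composable p.1 p.2))) /=.
  apply: eq_bigr => -[a b] _ /=.
  have ia : incident k (val a) by rewrite /incident (valP a) orbT.
  have ib : incident k (val b) by rewrite /incident (valP b).
  rewrite wd_cons /= eqxx; congr (_ * _); rewrite wd_cons /= ia eqxx; congr (_ * _).
  by rewrite /ostar /arrow_elt /= ib (eqP (valP a)) (eqP (valP b)).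
exists (fun c : {c : arrow Q * arrow Q | through k c} =>
  (exist _ (val c).1 (proj1 (andP (valP c))) : arrow_in,
   exist _ (val c).2 (proj2 (andP (valP c))) : arrow_out)) => [[a b] _|[[a b] c] _] /=.
  by congr (_, _); apply: val_inj.
exact: val_inj.
Qed.

Lemma cyc_der_triangle d a b : cyc_der d (comp_arr a b * (istar a * ostar b)) 1 =
  (if d == composite a b then istar a * ostar b else 0) +
  ((if d == inl (val a) then ostar b * comp_arr a b else 0) +
   (if d == inl (val b) then comp_arr a b * istar a else 0)).
Proof.
rewrite !cyc_derM !cyc_der_arr !mulr1 !mul1r; congr (_ + (_ + _)); case: eqP => // ->.
- exact: (esym (typedM (typed_istar a) (typed_ostar b))).
- have := typedM (typed_ostar b) (typed_comp a b).
  by rewrite /typed /= /incident (eqP (valP a)) eqxx orbT => <-.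
have := typedM (typed_comp a b) (typed_istar a).
by rewrite /typed /= /incident (eqP (valP b)) eqxx => <-.
Qed.

Lemma cyc_der_triangles d : cyc_der d triangle_sum 1 = \sum_a \sum_b (
  (if d == composite a b then istar a * ostar b else 0) +
  ((if d == inl (val a) then ostar b * comp_arr a b else 0) +
   (if d == inl (val b) then comp_arr a b * istar a else 0))).
Proof.
have lin : linear (fun x : R' => cyc_der d x 1) by exact: cyc_der_is_linear.
pose f : {linear R' -> R'} := HB.pack (fun x : R' => cyc_der d x 1) (GRing.isLinear.Build _ _ _ _ _ lin).
rewrite -[LHS]/(f triangle_sum) linear_sum; apply: eq_bigr => a _.
by rewrite linear_sum; apply: eq_bigr => b _; apply: cyc_der_triangle.
Qed.

Lemma cyc_der_triangles_keep c : ~~ incident k c -> cyc_der (inl c : arrow Q') triangle_sum 1 = 0.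
Proof.
move=> nc; rewrite cyc_der_triangles big1 // => a _; rewrite big1 // => b _.
rewrite (_ : (inl c == inl (val a) :> arrow Q') = (c == val a)) // keep_neq_in //.
by rewrite (_ : (inl c == inl (val b) :> arrow Q') = (c == val b)) // keep_neq_out // !addr0.
Qed.

Lemma cyc_der_triangles_comp a b : cyc_der (composite a b) triangle_sum 1 = istar a * ostar b.
Proof.
rewrite cyc_der_triangles (bigD1 a) //= [X in _ + X]big1 ?addr0 => [|a' na]; last first.
  by rewrite big1 // => b' _; rewrite composite_eq eq_sym (negbTE na) !addr0.
rewrite (bigD1 b) //= big1 => [|b' nb]; last by rewrite composite_eq [b == _]eq_sym (negbTE nb) andbF !addr0.
by rewrite composite_eq !eqxx !addr0.
Qed.

Lemma cyc_der_triangles_in a : cyc_der (inl (val a) : arrow Q') triangle_sum 1 = \sum_b ostar b * comp_arr a b.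
Proof.
have E (a' : arrow_in) : (inl (val a) == inl (val a') :> arrow Q') = (a == a') by [].
have E' (b : arrow_out) : (inl (val a) == inl (val b) :> arrow Q') = false.
  by rewrite -(val_in_neq_out a b).
rewrite cyc_der_triangles (bigD1 a) //= [X in _ + X]big1 ?addr0 => [|a' na]; last first.
  by rewrite big1 // => b _; rewrite E E' eq_sym (negbTE na) !addr0.
by apply: eq_bigr => b _; rewrite E E' eqxx addr0 add0r.
Qed.

Lemma cyc_der_triangles_out b : cyc_der (inl (val b) : arrow Q') triangle_sum 1 = \sum_a comp_arr a b * istar a.
Proof.
have E (b' : arrow_out) : (inl (val b) == inl (val b') :> arrow Q') = (b == b') by [].
have E' (a : arrow_in) : (inl (val b) == inl (val a) :> arrow Q') = false.
  by rewrite -(val_in_neq_out a b) eq_sym.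
rewrite cyc_der_triangles; apply: eq_bigr => a _.
rewrite (bigD1 b) //= big1 ?addr0 => [|b' nb]; last by rewrite E E' eq_sym (negbTE nb) !addr0.
by rewrite E E' eqxx !add0r.
Qed.
End Blocks.

(** * Homotopies after premutation *)

Section AbstractMutation.
Variables (A A' : pzRingType) (V : finType) (eps : V -> A) (eps' : V -> A') (k : V).
Variables (J : A -> Prop) (J' : A' -> Prop) (Out : finType) (ov : Out -> V).
Variables (o : Out -> A) (so : Out -> A') (br : A -> A') (rd : Out -> A -> A).
Local Notation ty := (btyped eps).
Local Notation ty' := (btyped eps').

(* The part of the premutation at k that involves the arrows [o] leaving k:
   [so] are the opposite arrows, [br] is the bracket on paths between vertices
   other than k, and [rd b] strips the first arrow b off a path starting at k. *)
Record mutation_data : Prop := MutationData {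
  md_eps : forall v, eps v * eps v = eps v;
  md_eps' : forall v, eps' v * eps' v = eps' v;
  md_J : ideal J;
  md_J' : ideal J';
  md_ov : forall b, ov b != k;
  md_o : forall b, ty (ov b) k (o b);
  md_so : forall b, ty' k (ov b) (so b);
  md_brD : forall x y, br (x + y) = br x + br y;
  md_brM : forall u v t x y, u != k -> v != k -> t != k -> ty u v x -> ty v t y ->
    br (x * y) = br x * br y;
  md_br_ty : forall u v x, u != k -> v != k -> ty u v x -> ty' u v (br x);
  md_rdD : forall b x y, rd b (x + y) = rd b x + rd b y;
  md_rd_ty : forall b u x, ty u k x -> ty u (ov b) (rd b x);
  md_rd_dec : forall u x, u != k -> ty u k x -> x = \sum_b rd b x * o b;
  md_rdM : forall b u v x y, v != k -> ty u v x -> ty v k y -> rd b (x * y) = x * rd b y;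
  md_rd_o : forall b b' u x, u != k -> ty u (ov b') x -> rd b (x * o b') = if b == b' then x else 0;
  md_br_onto : forall u v z, u != k -> v != k -> ty' u v z -> exists2 p, ty u v p & J' (z - br p);
  md_so_onto : forall v z, v != k -> ty' k v z ->
    exists2 zz : Out -> A', forall b, ty' (ov b) v (zz b) & J' (z - \sum_b so b * zz b);
  md_br_J : forall u v m, u != k -> v != k -> ty u v m -> J m -> J' (br m);
  md_rd_J : forall u m, u != k -> ty u k m -> J m ->
    exists2 w, ty' u k w & forall b, J' (br (rd b m) - w * so b);
  md_so_J : forall v x, v != k -> ty k v x -> J' (\sum_b so b * br (o b * x));
  md_loop_J : forall x, ty k k x ->
    exists2 c, ty' k k c & forall b, J' (\sum_b' so b' * br (rd b (o b' * x)) - c * so b)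
}.

Hypothesis md : mutation_data.
Let idJ' := md_J' md.

Lemma br0 : br 0 = 0.
Proof. by apply: (addIr (br 0)); rewrite -(md_brD md) !add0r. Qed.
Lemma br_sum (I : Type) (r : seq I) (P : pred I) (F : I -> A) :
  br (\sum_(i <- r | P i) F i) = \sum_(i <- r | P i) br (F i).
Proof. by elim/big_rec2: _ => [|i x y _ <-]; [exact: br0|exact: md_brD]. Qed.
Lemma rd0 b : rd b 0 = 0.
Proof. by apply: (addIr (rd b 0)); rewrite -(md_rdD md) !add0r. Qed.
Lemma rd_sum b (I : Type) (r : seq I) (P : pred I) (F : I -> A) :
  rd b (\sum_(i <- r | P i) F i) = \sum_(i <- r | P i) rd b (F i).
Proof. by elim/big_rec2: _ => [|i x y _ <-]; [exact: rd0|exact: md_rdD]. Qed.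

Variables (X Y : finType) (xv : X -> V) (yv : Y -> V) (P : Y -> X -> A).
Hypotheses (tP : forall y x, ty (yv y) (xv x) (P y x)) (yk : forall y, yv y != k).

Definition mutX : finType := ({x : X | xv x != k} + {x : X | xv x == k} * Out)%type.
Definition mutY : finType := (Y + {x : X | xv x == k})%type.
Definition mut_xv (x : mutX) : V :=
  match x with inl x => xv (val x) | inr p => ov p.2 end.
Definition mut_yv (y : mutY) : V := match y with inl y => yv y | inr _ => k end.
(** An entry in a column at k factors through the arrows [o b], and its coordinates [rd b] become
    the entries of the new columns. The row of the summand moved to Y consists of the reversed
    arrows. *)
Definition mut_P (y : mutY) (x : mutX) : A' :=
  match y, x with
  | inl y, inl x => br (P y (val x))
  | inl y, inr p => br (rd p.2 (P y (val p.1)))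
  | inr _, inl _ => 0
  | inr a, inr p => if a == p.1 then so p.2 else 0
  end.

Lemma mut_xk x : mut_xv x != k.
Proof. by case: x => [x|p]; [exact: valP x|exact: md_ov md _]. Qed.

Lemma mut_P_ty y x : ty' (mut_yv y) (mut_xv x) (mut_P y x).
Proof.
case: y x => [y|a] [x|[x b]] /=.
- by apply: (md_br_ty md) => //; exact: valP x.
- apply: (md_br_ty md) => //; first exact: md_ov md _.
  by apply: (md_rd_ty md); have := tP y (val x); rewrite (eqP (valP x)).
- exact: btyped0.
by case: eqP => _; [exact: md_so md _|exact: btyped0].
Qed.

Definition bracket_mx (M : Y -> X -> A) (y : mutY) (x : mutX) : A' :=
  match y, x with
  | inl y, inl x => br (M y (val x))
  | inl y, inr p => br (rd p.2 (M y (val p.1)))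
  | inr _, _ => 0
  end.

(** Bracketing the homotopy of M works except at columns belonging to k, where stripping an arrow
    from an element of J, or from a loop at k, leaves a multiple of the new rows. *)
Lemma bracket_homotopic M : (forall y x, ty (yv y) (xv x) (M y x)) ->
  homotopic eps J xv yv P M -> homotopic eps' J' mut_xv mut_yv mut_P (bracket_mx M).
Proof.
move=> tM [U [T [tU tT h]]].
pose E y x := M y x - (\sum_y' U y y' * P y' x + \sum_x' P y x' * T x' x).
have tE y x : ty (yv y) (xv x) (E y x).
  apply: btypedD => //; apply: btypedN; apply: btypedD; apply: btyped_sum => z _.
    exact: (btypedM (md_eps md) (tU _ _) (tP _ _)).
  exact: (btypedM (md_eps md) (tP _ _) (tT _ _)).
have ME y x : M y x = E y x + (\sum_y' U y y' * P y' x + \sum_x' P y x' * T x' x).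
  by rewrite subrK.
have atk (x : {x : X | xv x == k}) : xv (val x) = k by apply/eqP; exact: valP x.
have tPk y (x : {x : X | xv x == k}) : ty (yv y) k (P y (val x)).
  by have := tP y (val x); rewrite atk.
have tEk y (x : {x : X | xv x == k}) : ty (yv y) k (E y (val x)).
  by have := tE y (val x); rewrite atk.
have /fin_all_exists[w wE] : forall p : Y * {x : X | xv x == k}, exists w : A',
    ty' (yv p.1) k w /\ forall b, J' (br (rd b (E p.1 (val p.2))) - w * so b).
  move=> [y x] /=.
  by have [w tw wJ] := md_rd_J md (yk y) (tEk y x) (h y (val x)); exists w.
have tTk x (x' : {x : X | xv x == k}) : ty (xv x) k (T x (val x')).
  by have := tT x (val x'); rewrite atk.
have tkT (x : {x : X | xv x == k}) x' : ty k (xv x') (T (val x) x').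
  by have := tT (val x) x'; rewrite atk.
have /fin_all_exists[c cE] : forall p : {x : X | xv x == k} * {x : X | xv x == k}, exists c : A',
    ty' k k c /\ forall b, J' (\sum_b' so b' * br (rd b (o b' * T (val p.1) (val p.2))) - c * so b).
  move=> [x x'] /=.
  have [|c tc cJ] := md_loop_J md (x := T (val x) (val x')); last by exists c.
  by have := tkT x (val x'); rewrite atk.
(* [w] absorbs the defect of the remainder E in columns at k, and [c] that of the entries of T
   between summands at k. *)
pose U' (y y' : mutY) : A' := match y, y' with
  | inl y, inl y' => br (U y y') | inl y, inr x => w (y, x)
  | inr _, inl _ => 0 | inr x, inr x' => - c (x, x') end.
pose T' (x x' : mutX) : A' := match x, x' with
  | inl x, inl x' => br (T (val x) (val x'))
  | inr p, inl x' => br (o p.2 * T (val p.1) (val x'))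
  | inl x, inr p => br (rd p.2 (T (val x) (val p.1)))
  | inr p, inr p' => br (rd p'.2 (o p.2 * T (val p.1) (val p'.1))) end.
exists U', T'; split.
- case=> [y|x] [y'|x'] /=.
  + exact: (md_br_ty md).
  + by case: (wE (y, x')).
  + exact: btyped0.
  + by apply: btypedN; case: (cE (x, x')).
- case=> [x|[x b]] [x'|[x' b']] /=.
  + by apply: (md_br_ty md) => //; [exact: valP x|exact: valP x'].
  + apply: (md_br_ty md); [exact: valP x|exact: md_ov md _|apply: (md_rd_ty md); exact: tTk].
  + apply: (md_br_ty md); [exact: md_ov md _|exact: valP x'|].
    exact: (btypedM (md_eps md) (md_o md b) (tkT _ _)).
  + apply: (md_br_ty md); [exact: md_ov md _|exact: md_ov md _|apply: (md_rd_ty md)].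
    apply: (btypedM (md_eps md) (md_o md b)); by have := tkT x (val x'); rewrite atk.
have splitX (F : X -> A') : \sum_x F x =
    \sum_(x : {x : X | xv x != k}) F (val x) + \sum_(x : {x : X | xv x == k}) F (val x).
  rewrite (sum_sub (fun x => xv x != k) F) (sum_sub (fun x => xv x == k) F).
  by rewrite (bigID (fun x => xv x == k)) /= addrC.
have PT y x (x' : {x : X | xv x == k}) :
    P y (val x') * T (val x') x = \sum_b rd b (P y (val x')) * (o b * T (val x') x).
  rewrite {1}(md_rd_dec md (yk y) (tPk y x')) mulr_suml.
  by apply: eq_bigr => b _; rewrite mulrA.
have trd b y (x : {x : X | xv x == k}) : ty (yv y) (ov b) (rd b (P y (val x))).
  by apply: (md_rd_ty md).
case=> [y|a] [x|[x b]] /=.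
- have xk := valP x.
  rewrite big_sumType /= big_sumType /= (eq_bigr (fun y' => br (U y y' * P y' (val x)))); last first.
    by move=> y' _; rewrite (md_brM md (yk y) (yk y') xk (tU _ _) (tP _ _)).
  rewrite [X in _ - (_ + X + _)]big1 ?addr0 => [|a _]; last by rewrite mulr0.
  rewrite (eq_bigr (fun x' => br (P y (val x') * T (val x') (val x)))); last first.
    by move=> x' _; rewrite (md_brM md (yk y) (valP x') xk (tP _ _) (tT _ _)).
  rewrite -(pair_bigA _ (fun x' b => br (rd b (P y (val x'))) * br (o b * T (val x') (val x)))) /=.
  rewrite [X in _ - (_ + (_ + X))](eq_bigr (fun x' => br (P y (val x') * T (val x') (val x)))); last first.
    move=> x' _; rewrite PT br_sum; apply: eq_bigr => b _.
    by rewrite (md_brM md (yk y) (md_ov md b) xk (trd b y x')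
      (btypedM (md_eps md) (md_o md b) (tkT x' (val x)))).
  rewrite -(splitX (fun x' => br (P y x' * T x' (val x)))) -!br_sum -(md_brD md).
  rewrite {1}ME (md_brD md) addrK; exact: (md_br_J md (yk y) xk (tE _ _) (h _ _)).
- have bk := md_ov md b.
  rewrite big_sumType /= big_sumType /= (eq_bigr (fun y' => br (rd b (U y y' * P y' (val x))))); last first.
    move=> y' _; rewrite (md_rdM md b (yk y') (tU y y')) //.
    by rewrite (md_brM md (yk y) (yk y') bk (tU _ _)).
  rewrite [X in _ - (_ + X + _)](bigD1 x) //= eqxx [X in _ - (_ + (_ + X) + _)]big1; last first.
    by move=> a /negbTE ->; rewrite mulr0.
  rewrite addr0 (eq_bigr (fun x' => br (rd b (P y (val x') * T (val x') (val x))))); last first.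
    move=> x' _; rewrite (md_rdM md b (valP x') (tP _ _)) //.
    by rewrite (md_brM md (yk y) (valP x') bk (tP _ _)) //; apply: (md_rd_ty md); exact: tTk.
  rewrite -(pair_bigA _ (fun x' b' => br (rd b' (P y (val x'))) * br (rd b (o b' * T (val x') (val x))))) /=.
  rewrite [X in _ - (_ + (_ + X))](eq_bigr (fun x' => br (rd b (P y (val x') * T (val x') (val x))))); last first.
    move=> x' _; rewrite PT rd_sum br_sum; apply: eq_bigr => b' _.
    have t1 : ty (ov b') k (o b' * T (val x') (val x)).
      by apply: (btypedM (md_eps md) (md_o md b')); have := tkT x' (val x); rewrite (atk x).
    rewrite (md_rdM md b (md_ov md b') (trd b' y x') t1).
    by rewrite (md_brM md (yk y) (md_ov md b') bk (trd b' y x')) //; apply: (md_rd_ty md).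
  rewrite -(splitX (fun x' => br (rd b (P y x' * T x' (val x))))) addrAC -!br_sum -!rd_sum -(md_brD md) -(md_rdD md).
  rewrite {1}ME (md_rdD md) (md_brD md) [X in _ - X]addrC opprD addrACA subrr addr0.
  by case: (wE (y, x)).
- rewrite big_sumType /= big1 ?add0r => [|y' _]; last by rewrite mul0r.
  rewrite big1 ?add0r => [|a' _]; last by rewrite mulr0.
  rewrite big_sumType /= big1 ?add0r => [|x' _]; last by rewrite mul0r.
  apply: (idealN idJ').
  rewrite -(pair_bigA _ (fun x' b => (if a == x' then so b else 0) * br (o b * T (val x') (val x)))) /=.
  rewrite (bigD1 a) //= [X in _ + X]big1 => [|a' /negbTE na]; last first.
    by rewrite big1 // => b _; rewrite eq_sym na mul0r.
  rewrite addr0 eqxx; exact: (md_so_J md (valP x) (tkT _ _)).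
rewrite big_sumType /= big1 ?add0r => [|y' _]; last by rewrite mul0r.
rewrite (bigD1 x) //= eqxx big1 ?addr0 => [|a' /negbTE ->]; last by rewrite mulr0.
rewrite big_sumType /= big1 ?add0r => [|x' _]; last by rewrite mul0r.
rewrite -(pair_bigA _ (fun x' b' => (if a == x' then so b' else 0) * br (rd b (o b' * T (val x') (val x))))) /=.
rewrite (bigD1 a) //= [X in _ + (_ + X)]big1 => [|a' /negbTE na]; last first.
  by rewrite big1 // => b' _; rewrite eq_sym na mul0r.
rewrite addr0 eqxx; apply: (idealN idJ'); rewrite addrC mulNr.
by case: (cE (a, x)) => _; apply.
Qed.

(** An elementary matrix in an old row is the bracket of a matrix for P, by surjectivity of [br]
    modulo [J']. One in a new row is moved to the old rows. *)
Theorem rigid_mutation : rigid eps J xv yv P -> rigid eps' J' mut_xv mut_yv mut_P.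
Proof.
move=> rP; apply: (rigid_elementary idJ').
have e'K := md_eps' md.
have inlP y x' z : ty' (yv y) (mut_xv x') z ->
    homotopic eps' J' mut_xv mut_yv mut_P (elementary (inl y : mutY) x' z).
  move=> tz; have [p tp pJ] := md_br_onto md (yk y) (mut_xk x') tz.
  case: x' tz tp pJ => [x|[x b]] /= tz tp pJ.
    have tE y2 x2 : ty (yv y2) (xv x2) (elementary y (val x) p y2 x2).
      by rewrite /elementary; case: ifP => [/andP[/eqP -> /eqP ->] //|_]; apply: btyped0.
    apply: (homotopic_eq idJ' _ (bracket_homotopic tE (rP _ tE))).
    case=> [y2|a] [x2|[x2 b2]]; rewrite /elementary /=; do ?by rewrite subrr; apply: ideal_zero.
      have -> : (inl x2 == inl x :> mutX) = (val x2 == val x) by [].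
      rewrite [inl y2 == inl y]/(y2 == y).
      case: (_ && _) => //; rewrite br0 subrr; exact: ideal_zero idJ'.
    rewrite andbF (_ : val x2 == val x = false) ?andbF ?rd0 ?br0 ?subrr; first exact: ideal_zero.
    by apply/negbTE; apply: contraNneq (valP x) => <-; exact: valP x2.
  (* For a column (x, b) the matrix to be bracketed has entry [p * o b], whose only nonzero
     coordinate is p, at b. *)
  have tpo : ty (yv y) k (p * o b) by exact: (btypedM (md_eps md) tp (md_o md b)).
  have tE y2 x2 : ty (yv y2) (xv x2) (elementary y (val x) (p * o b) y2 x2).
    rewrite /elementary; case: ifP => [/andP[/eqP -> /eqP ->]|_]; last exact: btyped0.
    by rewrite (eqP (valP x)).
  apply: (homotopic_eq idJ' _ (bracket_homotopic tE (rP _ tE))).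
  case=> [y2|a] [x2|[x2 b2]]; rewrite /elementary /=; do ?by rewrite subrr; apply: ideal_zero.
    rewrite andbF (_ : val x2 == val x = false) ?andbF ?br0 ?subrr; first exact: ideal_zero.
    by apply/negbTE; apply: contraNneq (valP x2) => ->; exact: valP x.
  have -> : (inr (x2, b2) == inr (x, b) :> mutX) = (val x2 == val x) && (b2 == b) by [].
  rewrite [inl y2 == inl y]/(y2 == y) andbA.
  case: ((y2 == y) && _) => /=; last by rewrite rd0 br0 subrr; apply: ideal_zero.
  rewrite (md_rd_o md b2 (yk y) tp); case: ifP => _ //.
  by rewrite br0 subrr; apply: ideal_zero.
case=> [y|a] x' z tz; first exact: inlP.
have [zz tzz zJ] := md_so_onto md (mut_xk x') tz.
(* [M1] combines the columns (a, b) of the differential with coefficients [zz b], so it is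
   null-homotopic. In row a it agrees with z modulo [J'], and the old rows are corrected by [s]. *)
pose M1 y2 x2 := \sum_b (if x2 == x' then mut_P y2 (inr (a, b)) * zz b else 0).
have hM1 : homotopic eps' J' mut_xv mut_yv mut_P M1.
  by apply: (homotopic_sum idJ') => b; exact: (homotopic_col idJ' mut_yv mut_P (x0 := x') (x1 := inr (a, b)) (tzz b)).
pose s y := - \sum_b mut_P (inl y) (inr (a, b)) * zz b.
have hs y : homotopic eps' J' mut_xv mut_yv mut_P (elementary (inl y : mutY) x' (s y)).
  apply: inlP; apply: btypedN; apply: btyped_sum => b _.
  exact: (btypedM e'K (mut_P_ty (inl y) (inr (a, b))) (tzz b)).
apply: (homotopic_eq idJ' _ (homotopicD idJ' hM1 (homotopic_sum idJ' (index_enum Y) hs))).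
case=> [y2|a2] x2; rewrite /M1 /elementary /=.
  have -> : \sum_i (if (inl y2 == inl i :> mutY) && (x2 == x') then s i else 0) =
      if x2 == x' then s y2 else 0.
    rewrite (bigD1 y2) // big1 => [|y3 ny]; last first.
      by rewrite (_ : (inl y2 == inl y3 :> mutY) = (y2 == y3)) // eq_sym (negbTE ny).
    by rewrite /= addr0 (_ : (inl y2 == inl y2 :> mutY) = (y2 == y2)) // eqxx.
  rewrite sub0r; apply: (idealN idJ'); case: ifP => _.
    by rewrite /s subrr; apply: ideal_zero.
  by rewrite big1 // addr0; apply: ideal_zero.
rewrite [X in _ - (_ + X)]big1 // addr0 (_ : (inr a2 == inr a :> mutY) = (a2 == a)) //.
case: (a2 == a); case: (x2 == x') => //=.
- by rewrite big1 // subrr; apply: ideal_zero idJ'.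
- by rewrite big1 ?subrr => [|b _]; [exact: ideal_zero idJ'|rewrite mul0r].
by rewrite big1 // subrr; apply: ideal_zero idJ'.
Qed.
End AbstractMutation.

Lemma cyc_der_suml (K : fieldType) (V : finType) (Q : quiver V) (R : path_ring K Q) a
    (I : Type) (r : seq I) (P : pred I) (F : I -> R) y :
  cyc_der a (\sum_(i <- r | P i) F i) y = \sum_(i <- r | P i) cyc_der a (F i) y.
Proof. by rewrite /cyc_der linear_sum. Qed.

(** The idempotents at u, v and at the ends of c can be inserted into each generator, so both outer
    factors may be taken typed. *)
Lemma near_jac_typed_ind (K : fieldType) (V : finType) (Q : quiver V) (R : path_ring K Q)
    (N : nat) (W : R) u v (P : R -> Prop) :
  P 0 -> (forall x y, P x -> P y -> P (x + y)) ->
  (forall c x y, typed u (src c) x -> typed (tgt c) v y -> P (x * cyc_der c W 1 * y)) ->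
  (forall x, typed u v x -> ord_ge N x -> P x) ->
  forall m, typed u v m -> near_jac N W m -> P m.
Proof.
move=> P0 PD Pc PN m tm [y [s yE] oy].
have -> : m = vx R u * y * vx R v + vx R u * (m - y) * vx R v.
  by rewrite -mulrDl -mulrDr addrC subrK; exact: tm.
apply: (PD); last by apply: PN; [exact: typed_proj|apply/ord_geMr/ord_geMl].
rewrite yE mulr_sumr mulr_suml; elim/big_ind: _ => // -[[x c] z] _ /=.
have -> : vx R u * (x * cyc_der c W 1 * z) * vx R v =
    (vx R u * x * vx R (src c)) * cyc_der c W 1 * (vx R (tgt c) * z * vx R v).
  by rewrite [in LHS](typed_cyc_der c W 1) !mulrA.
by apply: Pc; apply: typed_proj.
Qed.

Section Premutation.
Variables (K : fieldType) (V : finType) (Q : quiver V) (k : V).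
Variables (R : path_ring K Q) (R' : path_ring K (premutation k Q)).
Hypothesis Qlf : loop_free Q.
Local Notation Q' := (premutation k Q).
Local Notation e v := (@vx K V Q R v).
Local Notation e' v := (@vx K V Q' R' v).
Local Notation br := (br R R').
Local Notation iarr := (iarr R).
Local Notation oarr := (oarr R).
Local Notation istar := (istar R').
Local Notation ostar := (ostar R').
Local Notation comp_arr := (comp_arr R').
Local Notation sl b := (strip_last R (val b)).
Local Notation sf a := (strip_first R (val a)).
Implicit Types (a : arrow_in Q k) (b : arrow_out Q k) (c : arrow Q).

Variables (N N' : nat) (W0 : R) (W' : R').
Hypotheses (NN : (N'.*2 < N)%N) (W0E : W0 = \sum_(v | v != k) e v * W0 * e v)
  (W'E : forall d, cyc_der d W' 1 = cyc_der d (br W0 + triangle_sum R') 1).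
Local Notation J := (near_jac N W0).
Local Notation J' := (near_jac N' W').
Let idJ' : ideal J' := near_jac_ideal N' W'.
Local Notation der c := (cyc_der c W0 1).

Lemma J'Z t x : J' x -> J' (t *: x).
Proof. by rewrite -mulr_algl; apply: (ideal_mull idJ'). Qed.

Lemma der_W' d (D : R -> R) : linear D ->
  (forall v x, v != k -> typed v v x -> cyc_der d (br x) (br (e v)) = br (D x)) ->
  cyc_der d W' 1 = br (D W0) + cyc_der d (triangle_sum R') 1.
Proof.
move=> lD h; rewrite W'E cyc_derDl; congr (_ + _).
pose D' : {linear R -> R} := HB.pack D (GRing.isLinear.Build _ _ _ _ _ lD).
rewrite -[D _]/(D' _) W0E !linear_sum cyc_der_suml; apply: eq_bigr => v vk.
have tv := typed_proj v v W0.
rewrite /= -(h v _ vk tv) br_vx.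
by rewrite (cyc_der_close _ _ (br_typed R' Qlf vk vk tv)) mulr1 vxK.
Qed.

Lemma der_close c v (x : R) : typed v v x -> cyc_der c x (e v) = cyc_der c x 1.
Proof. by move=> tx; rewrite [RHS](cyc_der_close _ _ tx) mulr1 vxK. Qed.

Lemma keep_J c : ~~ incident k c -> J' (br (der c)).
Proof.
move=> nc; have := jac_der W' (inl c); rewrite (@der_W' _ (fun x => cyc_der c x 1)).
- by rewrite cyc_der_triangles_keep // addr0; exact: near_jac_jac.
- exact: cyc_der_is_linear.
move=> v x vk tx; rewrite (cyc_der_br_keep R' Qlf nc vk vk tx) ?der_close //; exact: typed_vx.
Qed.

(** The relation given by the derivative at a composite: the second term comes from the triangle. *)
Lemma strip_last_J a b : J' (br (sl b (der (val a))) + istar a * ostar b).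
Proof.
have := jac_der W' (composite a b); rewrite (@der_W' _ (fun x => sl b (cyc_der (val a) x 1))).
- by rewrite cyc_der_triangles_comp //; exact: near_jac_jac.
- by move=> t x y; rewrite (cyc_der_is_linear (val a)) linearP.
move=> v x vk tx; rewrite (cyc_der_br_comp R' Qlf a b vk vk tx) ?der_close //; exact: typed_vx.
Qed.

Lemma strip_first_J a b : J' (br (sf a (der (val b))) + istar a * ostar b).
Proof.
have := jac_der W' (composite a b); rewrite (@der_W' _ (fun x => sf a (cyc_der (val b) x 1))).
- by rewrite cyc_der_triangles_comp //; exact: near_jac_jac.
- by move=> t x y; rewrite (cyc_der_is_linear (val b)) linearP.
move=> v x vk tx; rewrite (cyc_der_br_comp' R' Qlf a b vk vk tx) ?der_close //; exact: typed_vx.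
Qed.

Lemma incident_in a : incident k (val a).
Proof. by rewrite /incident (valP a) orbT. Qed.
Lemma incident_out b : incident k (val b).
Proof. by rewrite /incident (valP b). Qed.

(** Reversed arrows occur only in the triangles, so this is the whole derivative at the reversal of
    a. *)
Lemma out_triangles_J a : J' (\sum_b ostar b * comp_arr a b).
Proof.
have := jac_der W' (inl (val a)); rewrite (@der_W' _ (fun => 0)).
- by rewrite linear0 add0r cyc_der_triangles_in //; exact: near_jac_jac.
- by move=> t x y; rewrite scaler0 addr0.
move=> v x vk tx; rewrite (cyc_der_br_star R' Qlf (incident_in a) vk vk tx) ?linear0 //.
exact: typed_vx.
Qed.

Lemma in_triangles_J b : J' (\sum_a comp_arr a b * istar a).
Proof.
have := jac_der W' (inl (val b)); rewrite (@der_W' _ (fun => 0)).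
- by rewrite linear0 add0r cyc_der_triangles_out //; exact: near_jac_jac.
- by move=> t x y; rewrite scaler0 addr0.
move=> v x vk tx; rewrite (cyc_der_br_star R' Qlf (incident_out b) vk vk tx) ?linear0 //.
exact: typed_vx.
Qed.

Lemma ord1_from v (x : R) : v != k -> typed k v x -> ord_ge 1 x.
Proof. by rewrite eq_sym; apply: typed_ord_ge1. Qed.
Lemma ord1_to v (x : R) : v != k -> typed v k x -> ord_ge 1 x.
Proof. exact: typed_ord_ge1. Qed.

Lemma dec_in v (x : R) : typed k v x -> ord_ge 1 x -> x = \sum_(a : arrow_in Q k) iarr a * sf a x.
Proof. exact: strip_first_dec_at. Qed.
Lemma dec_out v (x : R) : typed v k x -> ord_ge 1 x -> x = \sum_(b : arrow_out Q k) sl b x * oarr b.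
Proof. exact: strip_last_dec_at. Qed.

Lemma typed_der_in a : typed (src (val a)) k (der (val a)).
Proof. by have := typed_cyc_der (val a) W0 1; rewrite (eqP (valP a)). Qed.
Lemma typed_der_out b : typed k (tgt (val b)) (der (val b)).
Proof. by have := typed_cyc_der (val b) W0 1; rewrite (eqP (valP b)). Qed.

(** When c is incident to k, one end of its derivative is at k, where [br] cannot be split. The
    neighbouring arrows are detached and regrouped into composites, and the relations at composites
    and at reversed arrows cancel. *)
Lemma br_der_J u v c x y : u != k -> v != k -> typed u (src c) x -> typed (tgt c) v y ->
  J' (br (x * der c * y)).
Proof.
move=> uk vk tx ty.
have [tc|tck] := eqVneq (tgt c) k.
  pose a : arrow_in Q k := exist _ c (introT eqP tc); rewrite -[c]/(val a) in tx *.
  rewrite tc in ty; have y1 := ord1_from vk ty.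
  rewrite {1}(dec_in ty y1) mulr_sumr linear_sum; apply: (ideal_sum idJ') => a' _.
  rewrite /= {1}(dec_out (typed_der_in a) (ord1_to (src_in Qlf a) (typed_der_in a))).
  rewrite mulr_sumr mulr_suml linear_sum.
  rewrite (eq_bigr (fun b => br x * (br (sl b (der (val a))) * comp_arr a' b * br (sf a' y)))); last first.
    move=> b _ /=; have tl := typed_strip_last (val b) (typed_der_in a).
    rewrite -!mulrA (brM R' Qlf (src_in Qlf a) _ uk tx).
    by rewrite (brM R' Qlf (tgt_out Qlf b) _ (src_in Qlf a) tl) br_comp.
  rewrite -mulr_sumr -mulr_suml; apply: (ideal_mull idJ'); apply: (ideal_mulr idJ').
  (* [strip_last_J] trades the bracketed derivative for minus [istar a * ostar b], and the sum of
     [ostar b * comp_arr a' b] over b lies in [J']. *)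
  have h := ideal_sum idJ' (index_enum (arrow_out Q k)) (Q := xpredT)
    (fun b _ => ideal_mulr idJ' (comp_arr a' b) (strip_last_J a b)).
  have := idealB idJ' h (ideal_mull idJ' (istar a) (out_triangles_J a')).
  rewrite mulr_sumr -sumrB; congr J'; apply: eq_bigr => b _.
  by rewrite mulrDl !mulrA addrK.
have [sc|sck] := eqVneq (src c) k.
  pose b : arrow_out Q k := exist _ c (introT eqP sc); rewrite -[c]/(val b) in ty *.
  rewrite sc in tx; have x1 := ord1_to uk tx.
  rewrite {1}(dec_out tx x1) -mulrA mulr_suml linear_sum; apply: (ideal_sum idJ') => b' _.
  rewrite /= {1}(dec_in (typed_der_out b) (ord1_from (tgt_out Qlf b) (typed_der_out b))).
  rewrite mulr_suml mulr_sumr linear_sum.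
  rewrite (eq_bigr (fun a => br (sl b' x) * (comp_arr a b' * br (sf a (der (val b))) * br y))); last first.
    move=> a _ /=; have tl := typed_strip_first (val a) (typed_der_out b).
    rewrite -!mulrA (brM R' Qlf (tgt_out Qlf b') _ uk (typed_strip_last (val b') tx)) br_comp.
    by rewrite (brM R' Qlf (tgt_out Qlf b) _ (src_in Qlf a) tl).
  rewrite -mulr_sumr -mulr_suml; apply: (ideal_mull idJ'); apply: (ideal_mulr idJ').
  have h := ideal_sum idJ' (index_enum (arrow_in Q k)) (Q := xpredT)
    (fun a _ => ideal_mull idJ' (comp_arr a b') (strip_first_J a b)).
  have := idealB idJ' h (ideal_mulr idJ' (ostar b) (in_triangles_J b')).
  rewrite mulr_suml -sumrB; congr J'; apply: eq_bigr => a _.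
  by rewrite mulrDr !mulrA addrK.
rewrite -mulrA (brM R' Qlf sck _ uk tx) (brM R' Qlf tck _ sck (typed_cyc_der c W0 1)).
apply: (ideal_mull idJ'); apply: (ideal_mulr idJ'); apply: keep_J.
by rewrite /incident negb_or sck.
Qed.

Lemma br_J u v m : u != k -> v != k -> typed u v m -> J m -> J' (br m).
Proof.
move=> uk vk; apply: (near_jac_typed_ind (P := fun m => J' (br m))) => [|x y|c x y|x _ xN].
- by rewrite linear0; apply: ideal_zero idJ'.
- by move=> hx hy; rewrite linearD; apply: (ideal_add idJ').
- exact: br_der_J.
by apply: near_jac_ord; apply: br_ord xN; apply/leqW/ltnW.
Qed.

Lemma br_strip_last_J u m : u != k -> typed u k m -> J m ->
  exists2 w, typed u k w & forall b, J' (br (sl b m) - w * ostar b).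
Proof.
move=> uk; apply: (near_jac_typed_ind (P := fun m =>
    exists2 w, typed u k w & forall b, J' (br (sl b m) - w * ostar b))).
- exists 0; first exact: typed0.
  by move=> b; rewrite !linear0 mul0r subr0; apply: ideal_zero idJ'.
- move=> x y [w tw hw] [w' tw' hw']; exists (w + w'); first exact: typedD.
  move=> b; rewrite !linearD /= mulrDl opprD addrACA; exact: (ideal_add idJ' (hw b) (hw' b)).
- move=> c x y tx ty.
  have h z : typed (tgt c) k z -> ord_ge 1 z -> forall b, J' (br (sl b (x * der c * z))).
    move=> tz z1 b; rewrite strip_lastM //.
    exact: br_der_J uk (tgt_out Qlf b) tx (typed_strip_last (val b) tz).
  have [tc|tck] := eqVneq (tgt c) k; last first.
    exists 0; first exact: typed0.
    by move=> b; rewrite mul0r subr0; apply: h; last exact: ord1_to tck ty.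
  have [|t [z z1 yE]] := @typed_const K V Q R k y; first by rewrite tc in ty.
  have tz : typed (tgt c) k z.
    have -> : z = y - t *: e k by rewrite yE addrC addKr.
    by rewrite -tc in ty *; apply: typedD => //; apply/typedN/typedZ/typed_vx.
  pose a : arrow_in Q k := exist _ c (introT eqP tc).
  (* For the constant part t of y, the arrow b is stripped from the derivative itself, and
     [strip_last_J] gives minus [istar a * ostar b]. *)
  exists (- (t *: (br x * istar a))).
    apply/typedN/typedZ; exact: (typedM (br_typed R' Qlf (src_in Qlf a) uk tx) (typed_istar R' a)).
  move=> b; have -> : br (sl b (x * der c * y)) =
      t *: (br x * br (sl b (der c))) + br (sl b (x * der c * z)).
    have dk : der c * e k = der c := typedr (typed_der_in a).
    have d1 : ord_ge 1 (der c) := ord1_to (src_in Qlf a) (typed_der_in a).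
    rewrite yE mulrDr -scalerAr -[x * der c * e k]mulrA dk !linearD !linearZ /=.
    by rewrite (strip_lastM _ _ d1) (brM R' Qlf (src_in Qlf a) _ uk tx).
  rewrite mulNr opprK addrAC -scalerAl -scalerDr -[br x * istar a * ostar b]mulrA -mulrDr.
  apply: (ideal_add idJ'); last exact: h.
  exact/J'Z/(ideal_mull idJ')/(strip_last_J a b).
move=> x _ xN; exists 0 => [|b]; first exact: typed0.
(* Stripping leaves length N - 1, and the bracket keeps at least half of it, rounded up, hence at
   least N' letters. *)
rewrite mul0r subr0; apply: near_jac_ord; apply: (@br_ord _ _ _ _ R R' N.-1).
  by rewrite (ltn_predK NN) ltnW.
by apply: strip_last_ord; rewrite (ltn_predK NN).
Qed.

Lemma br_strip_first_J u m : u != k -> typed k u m -> J m ->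
  exists2 w, typed k u w & forall a, J' (br (sf a m) - istar a * w).
Proof.
move=> uk; apply: (near_jac_typed_ind (P := fun m =>
    exists2 w, typed k u w & forall a, J' (br (sf a m) - istar a * w))).
- exists 0; first exact: typed0.
  by move=> a; rewrite !linear0 mulr0 subr0; apply: ideal_zero idJ'.
- move=> x y [w tw hw] [w' tw' hw']; exists (w + w'); first exact: typedD.
  move=> a; rewrite !linearD /= mulrDr opprD addrACA; exact: (ideal_add idJ' (hw a) (hw' a)).
- move=> c y x ty tx.
  have h z : typed k (src c) z -> ord_ge 1 z -> forall a, J' (br (sf a (z * der c * x))).
    move=> tz z1 a; rewrite -mulrA strip_firstM // mulrA.
    exact: br_der_J (src_in Qlf a) uk (typed_strip_first (val a) tz) tx.
  have [sc|sck] := eqVneq (src c) k; last first.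
    exists 0; first exact: typed0.
    by move=> a; rewrite mulr0 subr0; apply: h; last exact: ord1_from sck ty.
  have [|t [z z1 yE]] := @typed_const K V Q R k y; first by rewrite sc in ty.
  have tz : typed k (src c) z.
    have -> : z = y - t *: e k by rewrite yE addrC addKr.
    by rewrite sc in ty *; apply: typedD => //; apply/typedN/typedZ/typed_vx.
  pose b : arrow_out Q k := exist _ c (introT eqP sc).
  exists (- (t *: (ostar b * br x))).
    apply/typedN/typedZ; exact: (typedM (typed_ostar R' b) (br_typed R' Qlf uk (tgt_out Qlf b) tx)).
  move=> a; have -> : br (sf a (y * der c * x)) =
      t *: (br (sf a (der c)) * br x) + br (sf a (z * der c * x)).
    have dk : e k * der c = der c := typedl (typed_der_out b).
    have d1 : ord_ge 1 (der c) := ord1_from (tgt_out Qlf b) (typed_der_out b).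
    rewrite yE !mulrDl -!scalerAl dk !linearD !linearZ /= (strip_firstM _ _ d1).
    by rewrite (brM R' Qlf (tgt_out Qlf b) _ (src_in Qlf a) (typed_strip_first (val a) (typed_der_out b))).
  rewrite mulrN opprK addrAC -scalerAr -scalerDr [istar a * (ostar b * br x)]mulrA -mulrDl.
  apply: (ideal_add idJ'); last exact: h.
  exact/J'Z/(ideal_mulr idJ')/(strip_first_J a b).
move=> x _ xN; exists 0 => [|b]; first exact: typed0.
rewrite mulr0 subr0; apply: near_jac_ord; apply: (@br_ord _ _ _ _ R R' N.-1).
  by rewrite (ltn_predK NN) ltnW.
by apply: strip_first_ord; rewrite (ltn_predK NN).
Qed.

(** The passages [istar a * ostar b] are not brackets, but by [strip_last_J] they are congruent to
    brackets of stripped derivatives. *)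
Lemma br_onto_J u v z : u != k -> v != k -> typed u v z ->
  exists2 p, typed u v p & J' (z - br p).
Proof.
move=> uk vk; apply: (block_ind' Qlf vk (P := fun u z => exists2 p, typed u v p & J' (z - br p))) uk.
- move=> u'; split=> [|x y [p tp hp] [q tq hq]|t x [p tp hp]].
  + exists 0; first exact: typed0.
    by rewrite linear0 subr0; apply: ideal_zero idJ'.
  + exists (p + q); first exact: typedD.
    by rewrite linearD opprD addrACA; apply: (ideal_add idJ').
  + exists (t *: p); first exact: typedZ.
    by rewrite linearZ -scalerBr; apply: J'Z.
- by exists (e v); [exact: typed_vx|rewrite br_vx subrr; apply: ideal_zero idJ'].
- move=> c x nc [p tp hp]; exists (arrow_elt R c * p); first exact: typedM (typed_arr R c) tp.
  by rewrite br_keep // -mulrBr; apply: (ideal_mull idJ').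
- move=> a b x [p tp hp]; exists (oarr b * (iarr a * p)).
    exact: typedM (typed_oarr R b) (typedM (typed_iarr R a) tp).
  by rewrite br_comp -mulrBr; apply: (ideal_mull idJ').
move=> a b x [p tp hp]; have tl := typed_strip_last (val b) (typed_der_in a).
exists (- (sl b (der (val a)) * p)); first exact: typedN (typedM tl tp).
rewrite linearN /= opprK (brM R' Qlf (tgt_out Qlf b) _ (src_in Qlf a) tl).
have := ideal_add idJ' (ideal_mull idJ' (istar a * ostar b) hp)
  (ideal_mulr idJ' (br p) (strip_last_J a b)).
by congr J'; rewrite mulrBr mulrDl addrA addrAC subrK addrC mulrA addrC.
Qed.

(** Splitting off the first arrow a of x turns the sum over b into the relation at the reversal of
    a. *)
Lemma ostar_J v x : v != k -> typed k v x -> J' (\sum_b ostar b * br (oarr b * x)).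
Proof.
move=> vk tx; have x1 := ord1_from vk tx.
rewrite (eq_bigr (fun b => \sum_a ostar b * comp_arr a b * br (sf a x))); last first.
  move=> b _; rewrite {1}(dec_in tx x1) mulr_sumr linear_sum mulr_sumr.
  by apply: eq_bigr => a _; rewrite /= br_comp mulrA.
rewrite exchange_big; apply: (ideal_sum idJ') => a _ /=.
by rewrite -mulr_suml; apply: (ideal_mulr idJ'); apply: out_triangles_J.
Qed.

Lemma istar_J v x : v != k -> typed v k x -> J' (\sum_a br (x * iarr a) * istar a).
Proof.
move=> vk tx; have x1 := ord1_to vk tx.
rewrite (eq_bigr (fun a => \sum_b br (sl b x) * (comp_arr a b * istar a))); last first.
  move=> a _; rewrite {1}(dec_out tx x1) mulr_suml linear_sum mulr_suml.
  apply: eq_bigr => b _; rewrite /= -mulrA.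
  by rewrite (brM R' Qlf (tgt_out Qlf b) _ vk (typed_strip_last (val b) tx)) br_oarr_iarr mulrA.
rewrite exchange_big; apply: (ideal_sum idJ') => b _ /=.
by rewrite -mulr_sumr; apply: (ideal_mull idJ'); apply: in_triangles_J.
Qed.

(** Write x as t times the idempotent plus an element of the arrow ideal. The latter is covered by
    [ostar_J]; the former contributes t times [ostar b]. *)
Lemma loop_out_J x : typed k k x ->
  exists2 c, typed k k c & forall b, J' (\sum_b' ostar b' * br (sl b (oarr b' * x)) - c * ostar b).
Proof.
move=> tx; have [t [y y1 xE]] := typed_const tx.
have ty : typed k k y.
  have -> : y = x - t *: e k by rewrite xE addrC addKr.
  by apply: typedD => //; apply/typedN/typedZ/typed_vx.
exists (t *: e' k); first exact/typedZ/typed_vx.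
move=> b; have := ostar_J (tgt_out Qlf b) (typed_strip_last (val b) ty); congr J'.
rewrite -scalerAl (typedl (typed_ostar R' b)) xE.
rewrite [in RHS](eq_bigr (fun b' => t *: (if b == b' then ostar b else 0) + ostar b' * br (oarr b' * sl b y))).
  rewrite big_split -scaler_sumr /=; have -> : \sum_i (if b == i then ostar b else 0) = ostar b.
    by rewrite (bigD1 b) //= eqxx big1 ?addr0 // => i ni; rewrite eq_sym (negbTE ni).
  by rewrite addrAC subrr add0r.
move=> b' _; rewrite mulrDr !linearD /= (strip_lastM _ _ y1) -scalerAr !linearZ /= mulrDr -scalerAr.
congr (_ *: _ + _); rewrite (typedr (typed_oarr R b')).
have -> : sl b (oarr b') = if b == b' then e (tgt (val b)) else 0.
  rewrite -[oarr b']mul1r strip_last_arr mul1r (inj_eq val_inj).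
  by case: eqP => // ->.
case: eqP => [<-|_]; last by rewrite linear0 mulr0.
by rewrite br_vx (typedr (typed_ostar R' b)).
Qed.

Lemma loop_in_J x : typed k k x ->
  exists2 c, typed k k c & forall a, J' (\sum_a' br (sf a (x * iarr a')) * istar a' - istar a * c).
Proof.
move=> tx; have [t [y y1 xE]] := typed_const tx.
have ty : typed k k y.
  have -> : y = x - t *: e k by rewrite xE addrC addKr.
  by apply: typedD => //; apply/typedN/typedZ/typed_vx.
exists (t *: e' k); first exact/typedZ/typed_vx.
move=> a; have := istar_J (src_in Qlf a) (typed_strip_first (val a) ty); congr J'.
rewrite -scalerAr (typedr (typed_istar R' a)) xE.
rewrite [in RHS](eq_bigr (fun a' => t *: (if a == a' then istar a else 0) + br (sf a y * iarr a') * istar a')).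
  rewrite big_split -scaler_sumr /=; have -> : \sum_i (if a == i then istar a else 0) = istar a.
    by rewrite (bigD1 a) //= eqxx big1 ?addr0 // => i ni; rewrite eq_sym (negbTE ni).
  by rewrite addrAC subrr add0r.
move=> a' _; rewrite mulrDl !linearD /= (strip_firstM _ _ y1) -scalerAl !linearZ /= mulrDl -scalerAl.
congr (_ *: _ + _); rewrite (typedl (typed_iarr R a')).
have -> : sf a (iarr a') = if a == a' then e (src (val a)) else 0.
  rewrite -[iarr a']mulr1 strip_first_arr mulr1 (inj_eq val_inj).
  by case: eqP => // ->.
case: eqP => [<-|_]; last by rewrite linear0 mul0r.
by rewrite br_vx (typedl (typed_istar R' a)).
Qed.

(** In the premutation the arrows ending at k are exactly the reversals of the arrows leaving k. *)
Lemma ostar_onto v z : v != k -> typed k v z -> exists2 zz : arrow_out Q k -> R',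
  forall b, typed (tgt (val b)) v (zz b) & z = \sum_b ostar b * zz b.
Proof.
move=> vk tz; exists (fun b => strip_first R' (inl (val b)) z).
  by move=> b; have := typed_strip_first (inl (val b) : arrow Q') tz; rewrite /= incident_out.
have z1 : ord_ge 1 z by apply: typed_ord_ge1 tz; rewrite eq_sym.
have st d : tgt d != k -> strip_first R' d z = 0.
  by move=> dk; rewrite -(typedl tz) strip_first_vxM eq_sym (negbTE dk).
rewrite {1}(strip_first_dec z1) big_sumType /= [X in _ + X]big1 ?addr0; last first.
  by move=> [[a b] ab] _; rewrite st ?mulr0 //=; case/andP: ab => _ bk; exact: (tgt_out Qlf (exist _ b bk)).
rewrite (bigID (fun c => src c == k)) /= [X in _ + X]big1 ?addr0; last first.
  move=> c ck; rewrite st ?mulr0 //= /incident (negbTE ck) /=.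
  by case: ifP => // /negbT.
by rewrite (sum_sub (fun c : arrow Q => src c == k) (fun c => arrow_elt R' (inl c) * strip_first R' (inl c) z)).
Qed.

Lemma istar_onto v z : v != k -> typed v k z -> exists2 zz : arrow_in Q k -> R',
  forall a, typed v (src (val a)) (zz a) & z = \sum_a zz a * istar a.
Proof.
move=> vk tz; exists (fun a => strip_last R' (inl (val a)) z).
  by move=> a; have := typed_strip_last (inl (val a) : arrow Q') tz; rewrite /= incident_in.
have z1 : ord_ge 1 z by apply: typed_ord_ge1 tz.
have st d : src d != k -> strip_last R' d z = 0.
  by move=> dk; rewrite -(typedr tz) strip_last_Mvx (negbTE dk).
rewrite {1}(strip_last_dec z1) big_sumType /= [X in _ + X]big1 ?addr0; last first.
  by move=> [[a b] ab] _; rewrite st ?mul0r //=; case/andP: ab => ak _; exact: (src_in Qlf (exist _ a ak)).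
rewrite (bigID (fun c => tgt c == k)) /= [X in _ + X]big1 ?addr0; last first.
  move=> c ck; rewrite st ?mul0r //= /incident (negbTE ck) orbF /=.
  by case: ifP => // /negbT.
by rewrite (sum_sub (fun c : arrow Q => tgt c == k) (fun c => strip_last R' (inl c) z * arrow_elt R' (inl c))).
Qed.

Theorem mutation_data_out : mutation_data (A := R) (A' := R') (vx R) (vx R') k J J'
  (fun b : arrow_out Q k => tgt (val b)) oarr ostar br (fun b => sl b).
Proof.
split=> //.
- exact: vxK.
- exact: vxK.
- exact: near_jac_ideal.
- exact: tgt_out.
- exact: typed_oarr.
- exact: typed_ostar.
- exact: linearD.
- by move=> u v t x y uk vk _ tx _; exact: (brM R' Qlf vk y uk tx).
- by move=> u v x uk vk tx; exact: (br_typed R' Qlf vk uk tx).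
- by move=> b x y; exact: linearD.
- by move=> b u x tx; exact: (typed_strip_last (val b) tx).
- by move=> u x uk tx; apply: dec_out (tx) _; exact: ord1_to uk tx.
- by move=> b u v x y vk _ ty; apply: strip_lastM; exact: ord1_to vk ty.
- move=> b b' u x uk tx; rewrite strip_last_arr (inj_eq val_inj).
  by case: eqP => // _; exact: typedr tx.
- exact: br_onto_J.
- move=> v z vk tz; have [zz tzz zE] := ostar_onto vk tz; exists zz => //.
  by rewrite -zE subrr; apply: ideal_zero idJ'.
- exact: br_J.
- exact: br_strip_last_J.
- exact: ostar_J.
exact: loop_out_J.
Qed.

(** The opposite ring turns the arrows entering k into arrows leaving it, so the same abstract
    theorem applies. *)
Theorem mutation_data_in : mutation_data (A := R^c) (A' := R'^c) (vx R) (vx R') k J J'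
  (fun a : arrow_in Q k => src (val a)) iarr istar br (fun a => sf a).
Proof.
have conv u v x : btyped (vx R : V -> R^c) u v x -> typed v u x by move/btyped_conv.
have conv' u v x : btyped (vx R' : V -> R'^c) u v x -> typed v u x by move/btyped_conv.
split=> //.
- exact: vxK.
- exact: vxK.
- exact/ideal_conv/near_jac_ideal.
- exact/ideal_conv/near_jac_ideal.
- exact: src_in.
- by move=> a; apply/btyped_conv; exact: typed_iarr.
- by move=> a; apply/btyped_conv; exact: typed_istar.
- exact: linearD.
- by move=> u v t x y uk vk tk /conv tx /conv ty; exact: (brM R' Qlf vk x tk ty).
- by move=> u v x uk vk /conv tx; apply/btyped_conv; exact: (br_typed R' Qlf uk vk tx).
- by move=> b x y; exact: linearD.
- by move=> a u x /conv tx; apply/btyped_conv; exact: (typed_strip_first (val a) tx).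
- by move=> u x uk /conv tx; apply: dec_in (tx) _; exact: ord1_from uk tx.
- by move=> a u v x y vk _ /conv ty; apply: strip_firstM; exact: ord1_from vk ty.
- move=> a a' u x uk /conv tx; rewrite [_ * _]/(iarr a' * x :> R) strip_first_arr (inj_eq val_inj).
  by case: eqP => // _; exact: typedl tx.
- move=> u v z uk vk /conv' tz; have [p tp pJ] := br_onto_J vk uk tz.
  by exists p => //; apply/btyped_conv.
- move=> v z vk /conv' tz; have [zz tzz zE] := istar_onto vk tz; exists zz.
    by move=> a; apply/btyped_conv; exact: tzz.
  by have h := ideal_zero idJ'; rewrite -(subrr z) {2}zE in h; exact: h.
- by move=> u v m uk vk /conv tm; exact: br_J vk uk tm.
- move=> u m uk /conv tm mJ; have [w tw hw] := br_strip_first_J uk tm mJ.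
  by exists w => //; apply/btyped_conv.
- by move=> v x vk /conv tx; exact: istar_J vk tx.
move=> x /conv tx; have [c tc hc] := loop_in_J tx.
by exists c => //; apply/btyped_conv.
Qed.
End Premutation.

(** * Indices under premutation *)

Section Count.
Variables (V L T : finType) (tv : T -> V) (tl : T -> L).

Definition label_count l v : int := \sum_(x : T) ((tl x == l) && (tv x == v))%:Z.

Lemma label_count_ge0 l v : 0 <= label_count l v.
Proof. by apply: sumr_ge0 => x _; case: (_ && _). Qed.

Lemma label_count_eq0 l v : (forall x, tv x != v) -> label_count l v = 0.
Proof. by move=> h; rewrite /label_count big1 // => x _; rewrite (negbTE (h x)) andbF. Qed.
End Count.

Section CountMutation.
Variables (V L X Y Out : finType) (k : V) (xv : X -> V) (xl : X -> L) (yv : Y -> V) (yl : Y -> L).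
Variables (ov : Out -> V).
Hypothesis ovk : forall b, ov b != k.

Definition mut_xl (x : mutX k Out xv) : L :=
  match x with inl x => xl (val x) | inr p => xl (val p.1) end.
Definition mut_yl (y : mutY k Y xv) : L :=
  match y with inl y => yl y | inr x => xl (val x) end.

Lemma label_count_mutX l v : label_count (mut_xv (k := k) (xv := xv) ov) mut_xl l v =
  if v == k then 0 else label_count xv xl l v + label_count xv xl l k * \sum_b (ov b == v)%:Z.
Proof.
rewrite /label_count big_sumType /=.
rewrite (sum_sub (fun x => xv x != k) (fun x => ((xl x == l) && (xv x == v))%:Z)).
rewrite -(pair_bigA _ (fun x b => ((xl (val x) == l) && (ov b == v))%:Z)) /=.
rewrite (sum_sub (fun x => xv x == k) (fun x => \sum_b ((xl x == l) && (ov b == v))%:Z)).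
case: eqP => [->|/eqP vk].
  rewrite !big1 // => [x _|x /negbTE ->]; last by rewrite andbF.
  by rewrite big1 // => b _; rewrite (negbTE (ovk b)) andbF.
congr (_ + _).
  rewrite big_mkcond; apply: eq_bigr => x _; case: eqP => //= xk.
  by rewrite xk [k == v]eq_sym (negbTE vk) andbF.
rewrite mulr_suml big_mkcond; apply: eq_bigr => x _; rewrite mulr_sumr.
case: eqP => _; last by rewrite big1 // => b _; rewrite andbF mul0r.
by apply: eq_bigr => b _; case: (xl x == l); case: (ov b == v).
Qed.

Lemma label_count_mutY l v : label_count (mut_yv (k := k) (xv := xv) yv) mut_yl l v =
  label_count yv yl l v + (if v == k then label_count xv xl l k else 0).
Proof.
rewrite /label_count big_sumType /=; congr (_ + _).
rewrite (sum_sub (fun x => xv x == k) (fun x => ((xl x == l) && (k == v))%:Z)).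
rewrite [v == k]eq_sym; case: (k =P v) => [->|_]; last by rewrite big1 // => x _; rewrite andbF.
by rewrite big_mkcond; apply: eq_bigr => x _; case: (xv x == _); rewrite ?andbT ?andbF.
Qed.
End CountMutation.

Lemma num_arrows_out (V : finType) (Q : quiver V) k v :
  (num_arrows Q k v)%:Z = \sum_(b : arrow_out Q k) (tgt (val b) == v)%:Z.
Proof.
rewrite num_arrowsE (sum_sub (fun b => src b == k) (fun b : arrow Q => (tgt b == v)%:Z)).
rewrite (big_morph Posz PoszD (erefl 0)) [RHS]big_mkcond /=.
by apply: eq_bigr => b _; case: (src b == k).
Qed.

Lemma num_arrows_in (V : finType) (Q : quiver V) k v :
  (num_arrows Q v k)%:Z = \sum_(a : arrow_in Q k) (src (val a) == v)%:Z.
Proof.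
rewrite num_arrowsE (sum_sub (fun b => tgt b == k) (fun b : arrow Q => (src b == v)%:Z)).
rewrite (big_morph Posz PoszD (erefl 0)) [RHS]big_mkcond /=.
by apply: eq_bigr => b _; case: (tgt b == k); rewrite ?andbT ?andbF.
Qed.

Lemma pos_part_ge0 (x : int) : 0 <= x -> (pos_part x)%:Z = x.
Proof. rewrite /pos_part; lia. Qed.
Lemma pos_part_le0 (x : int) : x <= 0 -> pos_part x = 0%N.
Proof. rewrite /pos_part; lia. Qed.

Section MutatePresentation.
Variables (K : fieldType) (V L : finType) (Q : quiver V) (k : V).
Variables (R : path_ring K Q) (R' : path_ring K (premutation k Q)).
Hypotheses (Qlf : loop_free Q) (Qtf : two_cycle_free Q).
Variables (N N' : nat) (W0 : R) (W' : R').
Hypotheses (NN : (N'.*2 < N)%N) (W0E : W0 = \sum_(v | v != k) vx R v * W0 * vx R v)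
  (W'E : forall d, cyc_der d W' 1 = cyc_der d (br R R' W0 + triangle_sum R') 1).
Variable D : presentation R V L.
Hypotheses (wD : wf_pres D) (rD : rigid_pres N W0 D).

(** Since Y has no summand at k, the index at k is nonnegative and only the first product in the
    tropical rule remains: one new summand for each arrow leaving k. *)
Lemma premutation_presentation_out : (forall y, @yv _ _ _ D y != k) ->
  exists D' : presentation R' V L, [/\ wf_pres D', rigid_pres N' W' D' &
    forall l v, pres_index D' l v = tropical_mutation k (exchange_matrix Q) (pres_index D) l v].
Proof.
move=> yk; have md := mutation_data_out Qlf NN W0E W'E; have [tP lP] := wD.
exists (@Presentation R' V L (mutX k (arrow_out Q k) (@xv _ _ _ D)) (mutY k (pY D) (@xv _ _ _ D))
  (fun x => mut_xv (fun b : arrow_out Q k => tgt (val b)) x) (mut_yv (@yv _ _ _ D))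
  (mut_xl (@xl _ _ _ D)) (mut_yl (@xl _ _ _ D) (@yl _ _ _ D))
  (mut_P (ostar R') (br R R') (fun b => strip_last R (val b)) (@pP _ _ _ D))).
split.
- split=> [y x|[y|a] [x|[x b]]] /=.
  + exact: (mut_P_ty md tP yk).
  + by move=> nl; rewrite lP // linear0.
  + by move=> nl; rewrite lP // !linear0.
  + by [].
  + by move=> nl; case: eqP => // ea; rewrite ea eqxx in nl.
- exact: (rigid_mutation md tP yk rD).
move=> l v; rewrite /tropical_mutation /pres_index.
rewrite -!/(label_count _ _ _ _) /=.
rewrite label_count_mutX; last exact: tgt_out.
rewrite label_count_mutY (label_count_eq0 _ _ yk) subr0 -num_arrows_out.
case: (v =P k) => [->|_]; first by rewrite (label_count_eq0 _ _ yk) !add0r.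
rewrite (num_arrows_pos_part _ _ Qtf) addr0.
have n0 := label_count_ge0 (@xv _ _ _ D) (@xl _ _ _ D) l k.
rewrite (@pos_part_le0 (- _)) ?oppr_le0 // mul0n subr0 PoszM (pos_part_ge0 n0).
by rewrite addrAC.
Qed.

Lemma premutation_presentation_in : (forall x, @xv _ _ _ D x != k) ->
  exists D' : presentation R' V L, [/\ wf_pres D', rigid_pres N' W' D' &
    forall l v, pres_index D' l v = tropical_mutation k (exchange_matrix Q) (pres_index D) l v].
Proof.
move=> xk; have md := mutation_data_in Qlf NN W0E W'E; have [tP lP] := wD.
have tP' x y : btyped (vx R : V -> R^c) (@xv _ _ _ D x) (@yv _ _ _ D y) (@pP _ _ _ D y x).
  by apply/btyped_conv; exact: tP.
pose P' := mut_P (k := k) (A := R^c) (A' := R'^c) (istar R') (br R R') (fun a : arrow_in Q k => strip_first R (val a))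
  (xv := @yv _ _ _ D) (fun x y => @pP _ _ _ D y x).
exists (@Presentation R' V L (mutY k (pX D) (@yv _ _ _ D)) (mutX k (arrow_in Q k) (@yv _ _ _ D))
  (mut_yv (@xv _ _ _ D)) (fun y => mut_xv (fun a : arrow_in Q k => src (val a)) y)
  (mut_yl (@yl _ _ _ D) (@xl _ _ _ D)) (mut_xl (@yl _ _ _ D)) (fun x y => P' y x)).
split.
- split=> [y x|[y|[y a]] [x|b]] /=.
  + by apply/btyped_conv; exact: (mut_P_ty md tP' xk).
  + by move=> nl; rewrite lP // linear0.
  + by [].
  + by move=> nl; rewrite lP // !linear0.
  + by move=> nl; case: eqP => // ea; rewrite ea eqxx in nl.
- exact: (rigid_conv (rigid_mutation md tP' xk (rigid_conv rD))).
move=> l v; rewrite /tropical_mutation /pres_index.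
rewrite -!/(label_count _ _ _ _) /=.
rewrite label_count_mutX; last exact: src_in.
rewrite label_count_mutY (label_count_eq0 _ _ xk) sub0r -num_arrows_in opprK.
case: (v =P k) => [->|_]; first by rewrite (label_count_eq0 _ _ xk) !add0r ?subr0.
rewrite (num_arrows_pos_part _ _ Qtf) addr0 exchange_matrixN.
have n0 := label_count_ge0 (@yv _ _ _ D) (@yl _ _ _ D) l k.
rewrite (@pos_part_le0 (- label_count _ _ _ _)) ?oppr_le0 // mul0n addr0 PoszM ?opprK (pos_part_ge0 n0).
by rewrite opprD addrA.
Qed.
End MutatePresentation.

(** * Reduction *)

Section PathHom.
Variables (K : fieldType) (V : finType) (Q S : quiver V).
Variables (R : path_ring K Q) (T : path_ring K S) (g : arrow Q -> T).
Hypothesis tg : forall a, typed (tgt a) (src a) (g a).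

Fixpoint word_image v (w : seq (arrow Q)) : T :=
  if w is a :: w' then g a * word_image (src a) w' else vx T v.

Definition path_hom : {linear R -> T} := wd_lift R word_image.

Lemma path_hom_wd v w : is_path v w -> path_hom (wd R v w) = word_image v w.
Proof. by move=> wP; rewrite /path_hom wd_liftE. Qed.

Lemma path_hom_vx v : path_hom (vx R v) = vx T v.
Proof. exact: path_hom_wd. Qed.

Lemma word_image_typed v w : is_path v w -> typed v (path_end v w) (word_image v w).
Proof.
elim: w v => [|a w IHw] v /=; first by move=> _; exact: typed_vx.
by case/andP=> /eqP <- wP; apply: typedM (tg a) (IHw _ wP).
Qed.

Lemma path_hom_arr a : path_hom (arrow_elt R a) = g a.
Proof. by rewrite path_hom_wd /= ?eqxx // (typedr (tg a)). Qed.

Lemma path_homM x y : path_hom (x * y) = path_hom x * path_hom y.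
Proof.
move: x; apply: wd_ind.
  split=> [|x x' h1 h2|c x h]; rewrite ?mul0r ?linear0 ?mul0r ?mulrDl ?linearD /= ?mulrDl ?h1 ?h2 //.
  by rewrite -scalerAl !linearZ /= h -scalerAl.
move=> v w wP; move: y; apply: wd_ind.
  split=> [|x x' h1 h2|c x h]; rewrite ?mulr0 ?linear0 ?mulr0 ?mulrDr ?linearD /= ?mulrDr ?h1 ?h2 //.
  by rewrite -scalerAr !linearZ /= h -scalerAr.
move=> v' w' w'P; rewrite wd_mul !path_hom_wd //.
have := word_image_typed wP; have t' := word_image_typed w'P.
case: eqP => [ve|/eqP ve] tw; last first.
  by rewrite linear0 -(typedl t') mulrA (typed_neqr ve tw) mul0r.
rewrite path_hom_wd ?is_path_cat -/(path_end v w) ?wP ?ve //.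
elim: w v wP ve {tw} => [|a w IHw] v /=; first by rewrite /path_end /= => _ ->; rewrite (typedl t').
by case/andP=> _ wP ve; rewrite -mulrA IHw.
Qed.

Lemma path_hom_ord N x : (forall a, ord_ge 1 (g a)) -> ord_ge N x -> ord_ge N (path_hom x).
Proof.
move=> g1; move: x; apply: ord_ge_ind.
  split=> [|x y|c x]; rewrite ?linear0 ?linearD ?linearZ /=.
  - exact: ord_ge0.
  - exact: ord_geD.
  - exact: ord_geZ.
move=> v w wP wN; rewrite path_hom_wd //; apply: ord_ge_le wN _.
elim: w v {wP} => [|a w IHw] v /=; first exact: ord_ge_all.
by rewrite -add1n; apply: ord_geM.
Qed.
End PathHom.

Lemma path_hom_ext (K : fieldType) (V : finType) (Q S : quiver V) (R : path_ring K Q)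
    (T : path_ring K S) (f h : {linear R -> T}) :
  (forall x y, f (x * y) = f x * f y) -> (forall x y, h (x * y) = h x * h y) ->
  (forall v, f (vx R v) = h (vx R v)) -> (forall a, f (arrow_elt R a) = h (arrow_elt R a)) -> f =1 h.
Proof.
move=> fM hM fv fa; apply: wd_ext => v w; elim: w v => [|a w IHw] v /=; first by move=> _; exact: fv.
by case/andP=> tv wP; rewrite wd_cons tv fM hM fa IHw.
Qed.

Section Rotation.
Variables (K : fieldType) (V : finType) (Q : quiver V) (R : path_ring K Q).

Definition cycle_word n (p : V * seq (arrow Q)) : bool :=
  [&& is_path p.1 p.2, path_end p.1 p.2 == p.1 & (n <= size p.2)%N].

Definition cycle_sum n (x : R) := exists2 s : seq (K * (V * seq (arrow Q))),
  all (fun t => cycle_word n t.2) s & x = \sum_(t <- s) t.1 *: wd R t.2.1 t.2.2.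

Lemma cycle_sum_ord n x : cycle_sum n x -> ord_ge n x.
Proof.
case=> s sP ->; rewrite big_seq; apply: ord_ge_sum => t /(allP sP)/and3P[_ _ h].
by apply/ord_geZ/ord_ge_wd.
Qed.

Definition rotation (p : V * seq (arrow Q)) : V * seq (arrow Q) :=
  if p.2 is a :: w then (src a, rcons w a) else p.

Definition rotation_equivalent (x y : R) := exists2 s : seq (K * (V * seq (arrow Q))),
  all (fun t => cycle_word 1 t.2) s &
  x - y = \sum_(t <- s) t.1 *: (wd R t.2.1 t.2.2 - wd R (rotation t.2).1 (rotation t.2).2).

Lemma rotation_wd p a w : p.2 = a :: w -> cycle_word 1 p ->
  wd R p.1 p.2 = arrow_elt R a * wd R (src a) w /\
  wd R (rotation p).1 (rotation p).2 = wd R (src a) w * arrow_elt R a.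
Proof.
case: p => v w' /= -> /and3P[/= /andP[tv wP] /eqP ve _]; split; first by rewrite wd_cons tv.
by rewrite /rotation /= wd_rcons // (eqP tv) -[RHS]ve.
Qed.

Lemma cyc_der_rotation p a : cycle_word 1 p ->
  cyc_der a (wd R (rotation p).1 (rotation p).2) 1 = cyc_der a (wd R p.1 p.2) 1.
Proof.
move=> cp; case E: p.2 => [|b w]; first by move: cp; rewrite /cycle_word E !andbF.
by have [e1 e2] := rotation_wd E cp; rewrite -E e1 e2 cyc_derC.
Qed.

Lemma cyc_der_rotation_equivalent x y a : rotation_equivalent x y ->
  cyc_der a x 1 = cyc_der a y 1.
Proof.
case=> s sP xy; rewrite -[x](subrK y) xy cyc_derDl cyc_der_suml big_seq big1 ?add0r // => t /(allP sP) tP.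
by rewrite cyc_derZl cyc_derDl -scaleN1r cyc_derZl cyc_der_rotation // scaleN1r subrr scaler0.
Qed.

Lemma rotation_equivalent_ord2 x y : rotation_equivalent x y -> ord_ge 2 x -> ord_ge 2 y.
Proof.
case=> s sP xy x2; have -> : y = x - (x - y) by rewrite opprB addrCA subrr addr0.
apply: ord_geD => //; apply: ord_geN; rewrite xy big_seq; apply: ord_ge_sum => t /(allP sP).
case: t => c [v [|a [|b w]]]; rewrite /cycle_word /rotation /= ?andbF //.
  (* A cycle of length one is a loop, which rotation fixes. *)
  case/and3P=> _ /eqP sv _; have {}sv : src a = v := sv.
  by rewrite sv subrr scaler0; apply: ord_ge0.
by move=> _; apply/ord_geZ/ord_geD; [|apply: ord_geN]; apply: ord_ge_wd; rewrite ?/= ?size_rcons.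
Qed.
End Rotation.

Section RigidTransfer.
Variables (K : fieldType) (V L : finType) (Q S : quiver V).
Variables (R : path_ring K Q) (T : path_ring K S) (chi : {linear R -> T}).
Hypotheses (chiM : forall x y, chi (x * y) = chi x * chi y)
  (chi_vx : forall v, chi (vx R v) = vx T v) (chi_onto : forall z, exists x, chi x = z).
Variables (N : nat) (W : R) (W' : T).
Hypothesis chi_J : forall x, near_jac N W x -> near_jac N W' (chi x).

Lemma presentation_transfer (D : presentation R V L) : wf_pres D -> rigid_pres N W D ->
  exists D' : presentation T V L,
    [/\ wf_pres D', rigid_pres N W' D' & pres_index D' =2 pres_index D].
Proof.
move=> [tP lP] rD.
exists (@Presentation T V L _ _ (@xv _ _ _ D) (@yv _ _ _ D) (@xl _ _ _ D) (@yl _ _ _ D)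
  (fun y x => chi (pP y x))); split=> //.
  split=> /= y x; first exact: (psi_typed chiM chi_vx (tP y x)).
  by move=> nl; rewrite lP // linear0.
move=> M tM.
have /fin_all_exists[m mE] : forall p : pY D * pX D, exists m : R,
    typed (yv p.1) (xv p.2) m /\ chi m = M p.1 p.2.
  move=> [y x]; have [m mE] := chi_onto (M y x).
  exists (vx R (yv y) * m * vx R (xv x)); split; first exact: typed_proj.
  by rewrite !chiM !chi_vx mE; apply/esym; exact: (tM y x).
have [|U [Z [tU tZ h]]] := rD (fun y x => m (y, x)).
  by move=> y x; case: (mE (y, x)).
exists (fun y y' => chi (U y y')), (fun x x' => chi (Z x x')); split=> [y y'|x x'|y x] /=.
- exact: (psi_typed chiM chi_vx (tU y y')).
- exact: (psi_typed chiM chi_vx (tZ x x')).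
have := chi_J (h y x); rewrite linearB linearD !linear_sum /= (mE (y, x)).2 /=.
by congr (near_jac _ _ (_ - (_ + _))); apply: eq_bigr => ? _; rewrite chiM.
Qed.
End RigidTransfer.

Section SplitOff.
Variables (K : fieldType) (V : finType) (Q1 Q2 Q : quiver V).
Local Notation S := (quiver_sum Q1 Q2).
Variables (A : path_ring K S) (T : path_ring K Q1) (U : path_ring K Q2) (R : path_ring K Q).

Definition sum_left : {linear T -> A} := path_hom T (fun a => arrow_elt A (inl a : arrow S)).
Definition sum_right : {linear U -> A} := path_hom U (fun a => arrow_elt A (inr a : arrow S)).
Definition kill_right : {linear A -> T} :=
  path_hom A (fun c : arrow S => match c with inl a => arrow_elt T a | inr _ => 0 end).
Definition kill_left : {linear A -> U} :=
  path_hom A (fun c : arrow S => match c with inr a => arrow_elt U a | inl _ => 0 end).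

Let tl a : typed (tgt a) (src a) (arrow_elt A (inl a : arrow S)) := typed_arr A (inl a : arrow S).
Let tr a : typed (tgt a) (src a) (arrow_elt A (inr a : arrow S)) := typed_arr A (inr a : arrow S).
Let tkr (c : arrow S) : typed (tgt c) (src c) (match c with inl a => arrow_elt T a | inr _ => 0 end).
Proof. by case: c => c; [exact: typed_arr|exact: typed0]. Qed.
Let tkl (c : arrow S) : typed (tgt c) (src c) (match c with inr a => arrow_elt U a | inl _ => 0 end).
Proof. by case: c => c; [exact: typed0|exact: typed_arr]. Qed.

Lemma sum_left_wd v w : is_path v w ->
  sum_left (wd T v w) = wd A v [seq (inl a : arrow S) | a <- w].
Proof.
move=> wP; rewrite /sum_left path_hom_wd //; elim: w v wP => //= a w IHw v /andP[tv wP].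
by rewrite IHw // wd_cons /= tv.
Qed.

Lemma sum_right_wd v w : is_path v w ->
  sum_right (wd U v w) = wd A v [seq (inr a : arrow S) | a <- w].
Proof.
move=> wP; rewrite /sum_right path_hom_wd //; elim: w v wP => //= a w IHw v /andP[tv wP].
by rewrite IHw // wd_cons /= tv.
Qed.

Lemma kill_rightK x : kill_right (sum_left x) = x.
Proof.
pose f : {linear T -> T} := kill_right \o sum_left.
apply: (path_hom_ext (f := f) (h := idfun)) => // [y z|v|a] /=.
- by rewrite !path_homM.
- by rewrite !path_hom_vx.
- by rewrite !path_hom_arr.
Qed.

Lemma kill_leftK x : kill_left (sum_right x) = x.
Proof.
pose f : {linear U -> U} := kill_left \o sum_right.
apply: (path_hom_ext (f := f) (h := idfun)) => // [y z|v|a] /=.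
- by rewrite !path_homM.
- by rewrite !path_hom_vx.
- by rewrite !path_hom_arr.
Qed.

Lemma kill_right_ord N x : ord_ge N x -> ord_ge N (kill_right x).
Proof. by apply: path_hom_ord => -[a|a]; [apply: ord_ge_wd|apply: ord_ge0]. Qed.
Lemma kill_left_ord N x : ord_ge N x -> ord_ge N (kill_left x).
Proof. by apply: path_hom_ord => -[a|a]; [apply: ord_ge0|apply: ord_ge_wd]. Qed.
Lemma sum_left_ord N x : ord_ge N x -> ord_ge N (sum_left x).
Proof. by apply: path_hom_ord => a; apply: ord_ge_wd. Qed.

Lemma kill_right_sum_right x : ord_ge 1 x -> kill_right (sum_right x) = 0.
Proof.
move: x; apply: ord_ge_ind.
  split=> [|x y h1 h2|c x h]; rewrite ?linear0 ?linearD ?linearZ //= ?h1 ?h2 ?h ?addr0 ?scaler0 //.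
move=> v [|a w] // wP _; rewrite wd_cons; case: ifP => _; last by rewrite !linear0.
by rewrite !path_homM // !path_hom_arr // mul0r.
Qed.

Lemma cyc_der_sum_left (c : arrow S) x : cyc_der c (sum_left x) 1 =
  match c with inl a => sum_left (cyc_der a x 1) | inr _ => 0 end.
Proof.
have h1 : sum_left 1 = 1 by apply: psi1 => v; exact: path_hom_vx.
rewrite -h1 cyc_der_chain; [|exact: path_homM|exact: path_hom_vx].
case: c => a; last first.
  by rewrite big1 // => b _; rewrite path_hom_arr // cyc_der_arr.
rewrite (bigD1 a) //= big1 ?addr0 => [|b nb]; last first.
  rewrite path_hom_arr // cyc_der_arr (_ : (inl a == inl b :> arrow S) = (a == b)) //.
  by rewrite eq_sym (negbTE nb).
rewrite path_hom_arr // cyc_der_arr eqxx.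
apply/esym; apply: (psi_typed (psi := sum_left)); [exact: path_homM|exact: path_hom_vx|exact: typed_cyc_der].
Qed.

Lemma cyc_der_sum_right (c : arrow S) x : cyc_der c (sum_right x) 1 =
  match c with inr a => sum_right (cyc_der a x 1) | inl _ => 0 end.
Proof.
have h1 : sum_right 1 = 1 by apply: psi1 => v; exact: path_hom_vx.
rewrite -h1 cyc_der_chain; [|exact: path_homM|exact: path_hom_vx].
case: c => a.
  by rewrite big1 // => b _; rewrite path_hom_arr // cyc_der_arr.
rewrite (bigD1 a) //= big1 ?addr0 => [|b nb]; last first.
  rewrite path_hom_arr // cyc_der_arr (_ : (inr a == inr b :> arrow S) = (a == b)) //.
  by rewrite eq_sym (negbTE nb).
rewrite path_hom_arr // cyc_der_arr eqxx.
apply/esym; apply: (psi_typed (psi := sum_right)); [exact: path_homM|exact: path_hom_vx|exact: typed_cyc_der].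
Qed.

Section Reduction.
Variables (phi : {linear R -> A}) (W : R) (Wr : T) (Wt : U).
Hypotheses (Qlf : loop_free Q) (phi_bij : bijective phi)
  (phiM : forall x y, phi (x * y) = phi x * phi y)
  (phi_vx : forall v, phi (vx R v) = vx A v)
  (phiW : rotation_equivalent (phi W) (sum_left Wr + sum_right Wt))
  (W2 : ord_ge 2 W) (Wr2 : ord_ge 2 Wr).

(** phi does not shorten paths, so the split potential has no terms of length below 2; projecting it
    to the right summand retrieves [Wt]. *)
Lemma split_potential_ord2 : ord_ge 2 Wt.
Proof.
have h : ord_ge 2 (sum_left Wr + sum_right Wt).
  exact: (rotation_equivalent_ord2 phiW (psi_ord phiM phi_vx Qlf W2)).
rewrite -(kill_leftK Wt); apply: kill_left_ord.
have -> : sum_right Wt = sum_left Wr + sum_right Wt - sum_left Wr by rewrite addrAC subrr add0r.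
by apply: ord_geD => //; apply: ord_geN; apply: sum_left_ord.
Qed.

(** Derivatives of the split potential at arrows of Q1 are those of [Wr]. At arrows of Q2 they lie
    in the arrow ideal of the right summand, which [kill_right] sends to 0. *)
Lemma reduction_jac N x : near_jac N W x -> near_jac N Wr (kill_right (phi x)).
Proof.
have idJ := near_jac_ideal N Wr; have krM := path_homM tkr.
move: x; apply: near_jac_min.
- split=> [|x y hx hy|x y hy|x y hx]; rewrite ?linear0 ?linearD ?phiM ?krM.
  + exact: ideal_zero idJ.
  + exact: ideal_add idJ _ _ hx hy.
  + exact: ideal_mull idJ _ _ hy.
  + exact: ideal_mulr idJ _ _ hx.
- have [psi phiK psiK] := phi_bij.
  (* The chain rule is applied to the inverse of phi: W is the image of [phi W], so its derivatives
     come from those of the split potential. *)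
  have psi_lin : linear psi by move=> c x y; apply: (can_inj phiK); rewrite linearP !psiK.
  pose psi' : {linear A -> R} := HB.pack psi (GRing.isLinear.Build _ _ _ _ _ psi_lin).
  have psiM x y : psi' (x * y) = psi' x * psi' y by apply: (can_inj phiK); rewrite phiM !psiK.
  have psi_vx v : psi' (vx A v) = vx R v by apply: (can_inj phiK); rewrite psiK phi_vx.
  move=> a; rewrite -[W in cyc_der a W](phiK W).
  apply: (cyc_der_chain_ideal psiM psi_vx (P := fun x => near_jac N Wr (kill_right (phi x))) (W := phi W) a).
    split=> [|x y hx hy|x y hy|x y hx]; rewrite ?linear0 ?linearD ?phiM ?krM.
    + exact: ideal_zero idJ.
    + exact: ideal_add idJ _ _ hx hy.
    + exact: ideal_mull idJ _ _ hy.
    + exact: ideal_mulr idJ _ _ hx.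
  move=> c; rewrite /= psiK (cyc_der_rotation_equivalent _ phiW) cyc_derDl.
  rewrite cyc_der_sum_left cyc_der_sum_right; case: c => c.
    by rewrite addr0 kill_rightK; apply/near_jac_jac/jac_der.
  rewrite add0r kill_right_sum_right; first exact: ideal_zero idJ.
  exact: cyc_der_ord split_potential_ord2.
- by move=> x xN; apply: near_jac_ord; apply: kill_right_ord; apply: psi_ord.
Qed.

Lemma reduction_presentation (L : finType) N (D : presentation R V L) :
  wf_pres D -> rigid_pres N W D ->
  exists D' : presentation T V L,
    [/\ wf_pres D', rigid_pres N Wr D' & pres_index D' =2 pres_index D].
Proof.
pose chi : {linear R -> T} := kill_right \o phi.
apply: (presentation_transfer (chi := chi)) => [x y|v|z|x].
- by rewrite /= phiM path_homM.
- by rewrite /= phi_vx path_hom_vx.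
- have [psi phiK psiK] := phi_bij.
  by exists (psi (sum_left z)); rewrite /= psiK kill_rightK.
exact: reduction_jac.
Qed.
End Reduction.
End SplitOff.

(** * Mutation of rigid complexes *)

Section Step.
Variables (K : fieldType) (V : finType) (Q : quiver V) (k : V).
Variables (R : path_ring K Q) (R' : path_ring K (premutation k Q)).
Hypotheses (Qlf : loop_free Q) (Qtf : two_cycle_free Q).
Local Notation Q' := (premutation k Q).
Local Notation wordS := (V * seq (arrow Q))%type.

Definition bracket_cycle_word (p : wordS) : R' :=
  if p.2 is a :: w then
    if tgt a == k then wd R' (src a) (bracket_word k (rcons w a))
    else wd R' (tgt a) (bracket_word k (a :: w))
  else 0.

Definition triangle_words : R' := \sum_(c : {c : arrow Q * arrow Q | through k c})
  wd R' (tgt (val c).2) [:: inr c; inl (val c).1; inl (val c).2].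

(** Base points are moved away from k because [br] treats a passage through k correctly only in the
    interior of a word. *)
Definition rotate_off (p : wordS) : wordS :=
  if p.2 is a :: _ then if tgt a == k then rotation p else p else p.

Lemma rotate_off_typed p : cycle_word 1 p ->
  exists2 v, v != k & typed v v (wd R (rotate_off p).1 (rotate_off p).2).
Proof.
move=> cp; case: (and3P cp); case E: p.2 => [|a w] //= /andP[/eqP tv wP] /eqP ve _.
rewrite /rotate_off E; case: eqP => [tk|/eqP tk]; last first.
   exists p.1; first by rewrite -tv.
  by have := typed_wd R p.1 p.2; rewrite [path_end _ _](_ : _ = p.1) // E.
exists (src a); first by apply/eqP => sk; apply: (Qlf (a := a)); rewrite sk tk.
rewrite (rotation_wd R E cp).2; apply: typedM (typed_arr R a).
have := typed_wd R (src a) w; rewrite (_ : path_end (src a) w = tgt a) //.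
by rewrite tv.
Qed.

Lemma br_rotate_off p : cycle_word 1 p ->
  br R R' (wd R (rotate_off p).1 (rotate_off p).2) = bracket_cycle_word p.
Proof.
move=> cp; case: (and3P cp); case E: p.2 => [|a w] //= /andP[/eqP tv wP] /eqP ve _.
rewrite /rotate_off /bracket_cycle_word /rotation E; case: ifP => tk /=; last first.
  by rewrite E -tv br_wd //= eqxx.
rewrite br_wd // -cats1 is_path_cat wP /= andbT; apply/eqP.
by rewrite tv; exact: esym ve.
Qed.

Variables (s : seq (K * wordS)) (s3 : all (fun t => cycle_word 3 t.2) s).

Definition word_sum : R := \sum_(t <- s) t.1 *: wd R t.2.1 t.2.2.
Definition rotated_sum : R := \sum_(t <- s) t.1 *: wd R (rotate_off t.2).1 (rotate_off t.2).2.
Definition premutation_sum : R' := \sum_(t <- s) t.1 *: bracket_cycle_word t.2 + triangle_words.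

Lemma cycle_word1 t : t \in s -> cycle_word 1 t.2.
Proof. by move/(allP s3) => /and3P[h1 h2 h3]; apply/and3P; split=> //; apply: leq_trans h3. Qed.

Lemma word_sum_ord3 : ord_ge 3 word_sum.
Proof.
rewrite /word_sum big_seq; apply: ord_ge_sum => t /(allP s3)/and3P[_ _ h].
by apply/ord_geZ/ord_ge_wd.
Qed.

Lemma rotated_sum_ord3 : ord_ge 3 rotated_sum.
Proof.
rewrite /rotated_sum big_seq; apply: ord_ge_sum => t /(allP s3)/and3P[_ _ h].
apply/ord_geZ/ord_ge_wd; rewrite /rotate_off /rotation.
by case E: t.2.2 h => [|a w] h; rewrite ?E //; case: ifP => _; rewrite ?size_rcons ?E.

Qed.

Lemma rotated_sumE : rotated_sum = \sum_(v | v != k) vx R v * rotated_sum * vx R v.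
Proof.
rewrite {2}/rotated_sum.
under [RHS]eq_bigr do rewrite mulr_sumr mulr_suml.
rewrite exchange_big /rotated_sum /= big_seq [RHS]big_seq; apply: eq_bigr => t ts.
have [v vk tv] := rotate_off_typed (cycle_word1 ts).
rewrite (bigD1 v) //= big1 ?addr0 => [|u /andP[_ uv]].
  by rewrite -scalerAr -scalerAl {1}tv.
by rewrite -scalerAr -scalerAl (typed_neq _ tv) 1?eq_sym // mul0r scaler0.
Qed.

Lemma cyc_der_rotated_sum a : cyc_der a rotated_sum 1 = cyc_der a word_sum 1.
Proof.
rewrite !cyc_der_suml big_seq [RHS]big_seq; apply: eq_bigr => t ts.
rewrite !cyc_derZl /rotate_off; congr (_ *: _); case E: t.2.2 => [|b w] //=; rewrite ?E //.
by case: ifP => _; rewrite ?cyc_der_rotation ?E //; exact: cycle_word1.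
Qed.

Lemma br_rotated_sum : br R R' rotated_sum + triangle_sum R' = premutation_sum.
Proof.
rewrite triangle_sumE /premutation_sum /rotated_sum linear_sum; congr (_ + _).
by rewrite big_seq [RHS]big_seq; apply: eq_bigr => t /cycle_word1 ts; rewrite linearZ /= br_rotate_off.
Qed.

(** A cycle of length at least 3 keeps at least two letters under the bracket. *)
Lemma premutation_sum_ord2 : ord_ge 2 premutation_sum.
Proof.
rewrite -br_rotated_sum; apply: ord_geD; first exact: (br_ord R' (M := 3) _ rotated_sum_ord3).
by rewrite triangle_sumE; apply: ord_ge_sum => c _; apply: ord_ge_wd.
Qed.

Lemma near_jac_rotated_sum N x : near_jac N word_sum x -> near_jac N rotated_sum x.
Proof.
move: x; apply: near_jac_min; first exact: near_jac_ideal.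
  by move=> a; rewrite -cyc_der_rotated_sum; apply/near_jac_jac/jac_der.
exact: near_jac_ord.
Qed.

Variables (Q1 Q2 : quiver V) (A : path_ring K (quiver_sum Q1 Q2)).
Variables (T : path_ring K Q1) (U : path_ring K Q2).
Variables (phi : {linear R' -> A}) (Wr : T) (Wt : U).
Hypotheses (phi_bij : bijective phi) (phiM : forall x y, phi (x * y) = phi x * phi y)
  (phi_vx : forall v, phi (vx R' v) = vx A v)
  (phiW : rotation_equivalent (phi premutation_sum) (sum_left A T Wr + sum_right A U Wt))
  (Wr2 : ord_ge 2 Wr).

Theorem mutation_step (L : finType) (N N' : nat) (D : presentation R V L) :
  (N'.*2 < N)%N -> wf_pres D -> rigid_pres N word_sum D ->
  column_coherent (pres_index D) k /\
  exists D' : presentation T V L, [/\ wf_pres D', rigid_pres N' Wr D' &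
    forall l v, pres_index D' l v = tropical_mutation k (exchange_matrix Q) (pres_index D) l v].
Proof.
move=> NN wD rD; have [D1 [w1 r1 i1 o1]] := minimal_presentation wD rD.
have N0 : (0 < N)%N by apply: leq_ltn_trans NN.
have disj := rigid_disjoint N0 (ord_ge_le (isT : (2 <= 3)%N) word_sum_ord3) r1 o1.
(* Rotating the cycles changes the potential but not its cyclic derivatives. *)
have r0 : rigid_pres N rotated_sum D1.
  move=> M tM; have [U0 [T0 [tU tT h]]] := r1 M tM.
  by exists U0, T0; split=> // y x; apply: near_jac_rotated_sum.
have W'E d : cyc_der d premutation_sum 1 = cyc_der d (br R R' rotated_sum + triangle_sum R') 1.
  by rewrite br_rotated_sum.
have Q'lf : loop_free Q' by apply: premutation_loop_free.
have finish (D2 : presentation R' V L) : wf_pres D2 -> rigid_pres N' premutation_sum D2 ->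
    (forall l v, pres_index D2 l v = tropical_mutation k (exchange_matrix Q) (pres_index D1) l v) ->
    exists D' : presentation T V L, [/\ wf_pres D', rigid_pres N' Wr D' &
      forall l v, pres_index D' l v = tropical_mutation k (exchange_matrix Q) (pres_index D) l v].
  move=> w2 r2 i2.
  have [D3 [w3 r3 i3]] := reduction_presentation Q'lf phi_bij phiM phi_vx phiW premutation_sum_ord2 Wr2 w2 r2.
  by exists D3; split=> // l v; rewrite i3 i2 /tropical_mutation !i1.
(* If X has a summand at k, Y has none and the index at k is nonnegative; otherwise it is minus the
   number of summands of Y. *)
have [/existsP[x /eqP xk]|/existsPn nx] := boolP [exists x, @xv _ _ _ D1 x == k].
  have yk y : @yv _ _ _ D1 y != k by apply/eqP => yk; apply: (disj y x); rewrite yk xk.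
  split; first by left=> l; rewrite -i1 /pres_index -!/(label_count _ _ _ _)
    (label_count_eq0 _ _ yk) subr0; exact: label_count_ge0.
  have [D2 [w2 r2 i2]] := premutation_presentation_out Qlf Qtf NN rotated_sumE W'E w1 r0 yk.
  exact: finish w2 r2 i2.
split; first by right=> l; rewrite -i1 /pres_index -!/(label_count _ _ _ _)
  (label_count_eq0 _ _ nx) sub0r oppr_le0; exact: label_count_ge0.
have [D2 [w2 r2 i2]] := premutation_presentation_in Qlf Qtf NN rotated_sumE W'E w1 r0 nx.
exact: finish w2 r2 i2.
Qed.
End Step.

Section Concrete.
Variables (K : fieldType) (V : finType) (v0 : V).
Local Notation pa Q := (pa_path_ring K Q v0).

Lemma cycle_word_qpath (Q : quiver V) n (p : qpath Q) : is_cycle p -> (n <= plength p)%N ->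
  cycle_word n (qpath_val p).
Proof. by case: p => [[v w] wP] /andP[_ h] le; apply/and3P; split. Qed.

Lemma rotation_equivalent_pa (Q : quiver V) (W W' : path_algebra K Q) :
  rotation_equiv W W' -> @rotation_equivalent K V Q (pa Q) W W'.
Proof.
case=> s sP E; pose s' := [seq (t.1, qpath_val t.2) | t <- s].
have E' : W - W' = \sum_(t <- s') t.1 *: (word Q t.2.1 t.2.2 -
    word Q (rotation t.2).1 (rotation t.2).2) :> path_algebra K Q.
  rewrite E big_map; apply: eq_bigr => -[c p] _ /=; congr (_ *: (_ - _)).
    exact: (esym (word_path K p)).
  rewrite /rotate /rotation /pword; case E2: (qpath_val p).2 => [|a w] //=.
  by rewrite -(word_path K p) /ptgt /pword E2.
exists s'; last exact: E'.
apply/allP => _ /mapP[t ts ->] /=; apply: cycle_word_qpath; first exact: sP.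
by have /andP[] := sP _ ts.
Qed.

Lemma cycle_sum_pa (Q : quiver V) n (W : path_algebra K Q) : is_potential W ->
  (forall p, p \in psupp W -> (n <= plength p)%N) -> @cycle_sum K V Q (pa Q) n W.
Proof.
move=> pW nW; pose s := [seq (pcoeff W p, qpath_val p) | p <- psupp W].
have E : W = \sum_(t <- s) t.1 *: word Q t.2.1 t.2.2 :> path_algebra K Q.
  rewrite big_map [LHS]pa_decomp; apply: eq_bigr => p _.
  by rewrite -word_path.
exists s; last exact: E.
by apply/allP => _ /mapP[p pW' ->]; apply: cycle_word_qpath; [exact: pW|exact: nW].
Qed.

Lemma bracket_pa (Q : quiver V) k n (s : seq (K * (V * seq (arrow Q)))) :
  all (fun t => cycle_word n t.2) s ->
  bracket k (\sum_(t <- s) t.1 *: word Q t.2.1 t.2.2 : path_algebra K Q) =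
  \sum_(t <- s) t.1 *: (bracket_cycle_word (k := k) (pa (premutation k Q)) t.2 : path_algebra K _).
Proof.
move=> sP; rewrite /bracket linear_sum big_seq [RHS]big_seq; apply: eq_bigr => t /(allP sP)/and3P[tP _ _].
rewrite linearZ /=; congr (_ *: _).
have -> := word_path K (QPath (qpath_val := (t.2.1, t.2.2)) tP).
rewrite lin_ext_basis /bracket_cycle /bracket_cycle_word /pword /=.
by case: t.2.2 {tP}.
Qed.

Lemma sum_leftE (Q1 Q2 : quiver V) (W : path_algebra K Q1) :
  pushforward (Q' := quiver_sum Q1 Q2) id inl W =
  @sum_left K V Q1 Q2 (pa (quiver_sum Q1 Q2)) (pa Q1) W.
Proof.
pose f : {linear pa Q1 -> pa (quiver_sum Q1 Q2)} :=
  wd_lift (pa Q1) (fun v w => wd (pa (quiver_sum Q1 Q2)) v [seq inl a | a <- w]).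
transitivity (f W); first by [].
suff h : f =1 sum_left (pa (quiver_sum Q1 Q2)) (pa Q1) by exact: h.
by apply: wd_ext => v w wP; rewrite sum_left_wd // /f wd_liftE.
Qed.

Lemma sum_rightE (Q1 Q2 : quiver V) (W : path_algebra K Q2) :
  pushforward (Q' := quiver_sum Q1 Q2) id inr W =
  @sum_right K V Q1 Q2 (pa (quiver_sum Q1 Q2)) (pa Q2) W.
Proof.
pose f : {linear pa Q2 -> pa (quiver_sum Q1 Q2)} :=
  wd_lift (pa Q2) (fun v w => wd (pa (quiver_sum Q1 Q2)) v [seq inr a | a <- w]).
transitivity (f W); first by [].
suff h : f =1 sum_right (pa (quiver_sum Q1 Q2)) (pa Q2) by exact: h.
by apply: wd_ext => v w wP; rewrite sum_right_wd // /f wd_liftE.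
Qed.

Lemma f_mutation_step (L : finType) k (P P' : qp K V) N N'
    (D : presentation (pa (qp_quiver P)) V L) :
  loop_free (qp_quiver P) -> two_cycle_free (qp_quiver P) ->
  @cycle_sum K V _ (pa (qp_quiver P)) 3 (qp_potential P) -> f_mutation k P P' ->
  (N'.*2 < N)%N -> wf_pres D -> rigid_pres N (qp_potential P : pa (qp_quiver P)) D ->
  [/\ column_coherent (pres_index D) k, @cycle_sum K V _ (pa (qp_quiver P')) 3 (qp_potential P') &
  exists D' : presentation (pa (qp_quiver P')) V L,
    [/\ wf_pres D', rigid_pres N' (qp_potential P' : pa (qp_quiver P')) D' &
     forall l v, pres_index D' l v =
       tropical_mutation k (exchange_matrix (qp_quiver P)) (pres_index D) l v]].
Proof.
case: P P' D => [Q W] [Q1 Wr] /= D Qlf Qtf [s s3 WE].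
case=> -[[pWr lWr] [[Q2 Wt] _ [phi [phi_bij phi_mon phi_idem phiW]]]] _ NN wD rD.
have cWr := cycle_sum_pa pWr lWr.
have Wr2 : @ord_ge K V _ (pa Q1) 2 Wr.
  exact: ord_ge_le (isT : (2 <= 3)%N) (cycle_sum_ord cWr).
have WE' : W = word_sum (pa Q) s := WE.
rewrite WE' in rD.
have W'E : bracket k W + triangles K k Q = premutation_sum (k := k) (pa (premutation k Q)) s :> path_algebra K _.
  rewrite (WE : W = \sum_(t <- s) t.1 *: word Q t.2.1 t.2.2 :> path_algebra K Q).
  by rewrite (bracket_pa k s3).
have phiW' := rotation_equivalent_pa phiW.
rewrite /= W'E sum_leftE sum_rightE in phiW'.
have [coh hD] := @mutation_step K V Q k (pa Q) (pa (premutation k Q)) Qlf Qtf s s3 Q1 Q2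
  (pa (quiver_sum Q1 Q2)) (pa Q1) (pa Q2) phi Wr Wt phi_bij (phi_mon.2) phi_idem phiW' Wr2 L N N' D NN wD rD.
by split.
Qed.

Lemma sign_coherent_of_mutatable (L : finType) ks (P : qp K V)
    (D : presentation (pa (qp_quiver P)) V L) :
  loop_free (qp_quiver P) -> two_cycle_free (qp_quiver P) ->
  @cycle_sum K V _ (pa (qp_quiver P)) 3 (qp_potential P) -> successively_f_mutatable ks P ->
  wf_pres D -> rigid_pres (3 ^ size ks) (qp_potential P : pa (qp_quiver P)) D ->
  sign_coherent ks (exchange_matrix (qp_quiver P)) (pres_index D).
Proof.
elim: ks P D => [|k ks IHks] P D //= Qlf Qtf cW [P' fP mP'] wD rD.
(* The step requires 2N' < N, which the powers of 3 satisfy; this fixes the initial truncation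
   length. *)
have NN : ((3 ^ size ks).*2 < 3 ^ (size ks).+1)%N.
  by rewrite expnS -muln2 mulnC ltn_mul2r expn_gt0.
have [coh cW' [D' [wD' rD' iD']]] := f_mutation_step Qlf Qtf cW fP NN wD rD; split=> //.
have [_ iso] := fP.
have Qlf' := quiver_iso_loop_free iso (mutation_loop_free Qlf Qtf).
have Qtf' := quiver_iso_two_cycle_free iso (mutation_two_cycle_free Qlf Qtf).
have := IHks P' D' Qlf' Qtf' cW' mP' wD' rD'.
congr sign_coherent; apply: functional_extensionality => i; apply: functional_extensionality => j.
  by rewrite -exchange_matrix_mutation // /exchange_matrix !(quiver_iso_num_arrows _ _ iso).
exact: iD'.
Qed.
End Concrete.

(** * The initial complexes and the conclusion *)

Section Start.
Variables (K : fieldType) (V : finType) (Q : quiver V) (R : path_ring K Q) (L : finType) (f : L -> V).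

Definition projectives_pres : presentation R V L :=
  @Presentation R V L L void f (of_void V) id (of_void L) (fun y _ => of_void R y).
Definition shifted_pres : presentation R V L :=
  @Presentation R V L void L (of_void V) f (of_void L) id (fun _ x => of_void R x).

(** One degree is empty, so there is no matrix entry to be contracted. *)
Lemma projectives_rigid N W : wf_pres projectives_pres /\ rigid_pres N W projectives_pres.
Proof.
split; first by split=> -[].
move=> M tM; exists (fun y _ => of_void R y), (fun _ _ => 0).
by split=> [[]|x x'|[]] //; exact: btyped0.
Qed.

Lemma shifted_rigid N W : wf_pres shifted_pres /\ rigid_pres N W shifted_pres.
Proof.
split; first by split=> ? [].
move=> M tM; exists (fun _ _ => 0), (fun x _ => of_void R x).
by split=> [x x'|[]|? []] //; exact: btyped0.
Qed.

Lemma void_sum (F : void -> int) : \sum_x F x = 0.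
Proof. by rewrite big1 // => -[]. Qed.

Lemma projectives_index l v : pres_index projectives_pres l v = (v == f l)%:Z.
Proof.
rewrite /pres_index /= void_sum subr0 (bigD1 l) //= eqxx big1 ?addr0 => [|x /negbTE -> //].
by rewrite eq_sym.
Qed.

Lemma shifted_index l v : pres_index shifted_pres l v = - (v == f l)%:Z.
Proof.
rewrite /pres_index /= void_sum sub0r (bigD1 l) //= eqxx big1 ?addr0 => [|x /negbTE -> //].
by rewrite eq_sym.
Qed.
End Start.

(** A cycle of length 1 or 2 would be a loop or an oriented 2-cycle of Q. *)
Lemma framed_path_cycle_sum (K : fieldType) (I : finType) (v0 : I + I) (Q : quiver I) (W : path_algebra K Q) :
  loop_free Q -> two_cycle_free Q -> is_potential W ->
  @cycle_sum K _ _ (pa_path_ring K (framed_quiver Q) v0) 3 (qp_potential (framed_qp W)).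
Proof.
move=> lf tf pW.
pose s := [seq (pcoeff W p, (inl (ptgt p) : I + I, [seq (inl a : arrow (framed_quiver Q)) | a <- pword p])) | p <- psupp W].
have E : qp_potential (framed_qp W) = \sum_(t <- s) t.1 *: word (framed_quiver Q) t.2.1 t.2.2 :> path_algebra K (framed_quiver Q).
  by rewrite big_map.
exists s; last exact: E.
apply/allP => _ /mapP[p /pW pc ->]; case/andP: pc => p0 /eqP pe.
have iP : is_path (Q := framed_quiver Q) (inl (ptgt p)) [seq inl a | a <- pword p].
  case: p {p0 pe} => -[v w] /=; rewrite /ptgt /pword /=.
  by elim: w v => //= a w IHw v /andP[/eqP -> wP]; rewrite eqxx IHw.
apply/and3P; split=> //=.
  rewrite /path_end -map_comp (eq_map (g := inl \o src)) // map_comp last_map.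
  by rewrite -/(psrc p) pe.
rewrite size_map; case: p p0 pe {iP} => -[v [|a [|b [|c w]]]] //= wP _.
- move: wP; rewrite /psrc /ptgt /= andbT => /eqP ta sa; case: (lf a); by rewrite sa ta.
- move: wP; rewrite /psrc /ptgt /= andbT => /andP[/eqP ta /eqP tb] sb.
  by case: (tf a b); rewrite tb ta sb.
Qed.

Theorem theorem8p9 (R : realType) (n : nat) (Q : quiver 'I_n)
    (W : path_algebra R[i]%C Q) (ks : seq 'I_n)
    (Q_loop_free : loop_free Q) (Q_two_cycle_free : two_cycle_free Q)
    (W_potential : is_potential W)
    (W_mutatable :
      successively_f_mutatable [seq inl k | k <- ks] (framed_qp W))
    (i : 'I_n) :
  exists2 F : {mpoly rat[n]}, is_F_polynomial Q ks i F &
    exists m : 'X_{1..n},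
      [/\ m \in msupp F,
          forall m' : 'X_{1..n},
            m' \in msupp F -> m' <> m -> (mdeg m' < mdeg m)%N,
          F@_m = 1
        & forall m' : 'X_{1..n}, m' \in msupp F -> (m' <= m)%MM].
Proof.
(* The vertex [inl i] witnesses that the path algebra is a nontrivial ring. *)
pose A := pa_path_ring R[i]%C (framed_quiver Q) (inl i).
pose W' : A := qp_potential (framed_qp W).
have lf := framed_loop_free Q_loop_free.
have tf := framed_two_cycle_free Q_two_cycle_free.
have cW := framed_path_cycle_sum (inl i) Q_loop_free Q_two_cycle_free W_potential.
have coherent (D : presentation A ('I_n + 'I_n)%type 'I_n) g :
    wf_pres D /\ rigid_pres (3 ^ size [seq inl k : 'I_n + 'I_n | k <- ks]) W' D ->
    (forall l v, pres_index D l v = g l v) ->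
    sign_coherent [seq inl k | k <- ks] (exchange_matrix (framed_quiver Q)) g.
  move=> [wD rD] iD.
  have := sign_coherent_of_mutatable (P := framed_qp W) lf tf cW W_mutatable wD rD.
  congr sign_coherent; apply: functional_extensionality => l.
  by apply: functional_extensionality => v; exact: iD.
(* Unit vectors start the bottom vectors, which govern constant terms; negated ones start the top
   vectors, which govern leading monomials. *)
have pos := coherent _ _ (projectives_rigid (R := A) (@inl 'I_n 'I_n) _ W') (projectives_index _ _).
have neg := coherent _ _ (shifted_rigid (R := A) (@inl 'I_n 'I_n) _ W') (shifted_index _ _).
exact: corner_of_sign_coherent Q_loop_free Q_two_cycle_free pos neg i.
Qed.
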